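(* Let $(M,\Gamma)$ be a Hopf--von Neumann algebra such that $M$ is injective. Then $\mathcal{WAP}(M_\ast)$ is a bimodule over $\mathcal{CAP}(M_\ast)$ with respect to multiplication in $M$; that is, $xy \in \mathcal{WAP}(M_\ast)$ and $yx \in \mathcal{WAP}(M_\ast)$ for all $x \in \mathcal{WAP}(M_\ast)$ and $y \in \mathcal{CAP}(M_\ast)$.
   Context: A Hopf--von Neumann algebra is a pair $(M,\Gamma)$ where $M$ is a von Neumann algebra and $\Gamma : M \to M \bar{\otimes} M$ is a faithful, normal, unital $^\ast$-homomorphism with $(\Gamma \otimes \mathrm{id}) \circ \Gamma = (\mathrm{id} \otimes \Gamma) \circ \Gamma$. The predual $M_\ast$, with its canonical operator space structure, is a completely contractive Banach algebra under $\langle f \ast g, x \rangle := \langle f \otimes g, \Gamma x\rangle$ ($f,g \in M_\ast$, $x \in M$), and $(M_\ast)^\ast = M$. For a Banach algebra $A$, $A^\ast$ is a Banach $A$-bimodule via $\langle a\cdot\phi, b\rangle = \langle \phi, ba\rangle$ and $\langle \phi\cdot a, b\rangle = \langle \phi, ab\rangle$. A functional $\phi \in A^\ast$ is weakly almost periodic if $A \to A^\ast$, $a \mapsto a \cdot \phi$, is weakly compact (equivalently, $a \mapsto \phi\cdot a$ is weakly compact); $\mathcal{WAP}(A)$ is the set of all such $\phi$. For operator spaces $E,F$, a completely bounded map $T : E \to F$ is completely compact if for each $\epsilon > 0$ there is a finite-dimensional subspace $Y_\epsilon$ of $F$ such that $\|Q_{Y_\epsilon}T\|_{\mathrm{cb}}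 < \epsilon$, where $Q_{Y_\epsilon} : F \to F/Y_\epsilon$ is the quotient map. For a completely contractive Banach algebra $A$, a functional $\phi \in A^\ast$ is completely almost periodic if both maps $A \to A^\ast$, $a \mapsto a\cdot\phi$ and $a \mapsto \phi\cdot a$, are completely compact; $\mathcal{CAP}(A)$ is the set of all such $\phi$. *)

(* Defs.v *)
Set Warnings "-notation-overridden,-ambiguous-paths,-notation-incompatible-prefix".
From HB Require Import structures.
From mathcomp Require Import all_boot all_order all_algebra sesquilinear.
From mathcomp Require Import complex.
From mathcomp Require Import ring lra.
From mathcomp Require Import all_classical all_reals all_analysis.
Import Order.TTheory GRing.Theory Num.Theory.
Import numFieldNormedType.Exports.
Local Open Scope classical_set_scope.
Local Open Scope ring_scope.
Set Warnings "-redundant-canonical-projection,-projection-no-head-constant".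

Set Implicit Arguments.
Unset Strict Implicit.
Unset Printing Implicit Defensive.

(* The complex numbers, typed as a numClosedFieldType so that the topology and
   the normed-module structure of numFieldNormedType are found by inference. *)
Definition cpx (R : realType) : numClosedFieldType := R[i].

(* A linear subspace S of an lmodType V; (lsub S) is S as an lmodType. *)
Record linset (K : fieldType) (V : lmodType K) := Linset {
  lset : set V;
  lset0 : lset 0;
  lsetP : forall (a : K) (u v : V), lset u -> lset v -> lset (a *: u + v) }.

Section SubModule.
Variables (K : fieldType) (V : lmodType K) (S : linset V).

Definition lpred : {pred V} := fun x => `[< lset S x >].

Lemma lpred_closed : submod_closed lpred.
Proof.
split; first by apply/asboolP; exact: lset0.
by move=> a u v /asboolP Su /asboolP Sv; apply/asboolP; exact: lsetP.
Qed.
HB.instance Definition _ := GRing.isSubmodClosed.Build K V lpred lpred_closed.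

Record lsub := Lsub { lval : V; _ : lval \in lpred }.
HB.instance Definition _ := [isSub for lval].
HB.instance Definition _ := [Choice of lsub by <:].
HB.instance Definition _ := [SubChoice_isSubLmodule of lsub by <:].

Lemma lsetV (x : lsub) : lset S (lval x).
Proof. by have /asboolP := valP x. Qed.

Definition mklsub (x : V) (Sx : lset S x) : lsub := Lsub (asboolT Sx).
End SubModule.

Section RealNorm.
Variables (R : realType).
Local Notation C := (cpx R).

(* Norms over C take their values in C; rnorm is the same number in R. *)
Definition rnorm (V : normedModType C) (x : V) : R := complex.Re `|x|.
Definition cre (z : C) : R := complex.Re z.

Lemma creD z w : cre (z + w) = cre z + cre w.
Proof. by case: z w => [a b] [c d]. Qed.
Lemma creN z : cre (- z) = - cre z.
Proof. by case: z => [a b]. Qed.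
Lemma creR (a : R) (z : C) : cre ((a%:C)%C * z) = a * cre z.
Proof. by case: z => [b c]; rewrite /cre /= mul0r subr0. Qed.
Lemma creC (z : C) : cre z^* = cre z.
Proof. by case: z. Qed.
Lemma cre_norm (z : C) : cre z <= rnorm z.
Proof.
rewrite /rnorm /cre normc_def /= (le_trans (ler_norm _)) //.
rewrite -sqrtr_sqr ler_sqrt ?lerDl ?sqr_ge0 //.
by rewrite addr_ge0 ?sqr_ge0.
Qed.

Lemma rnormE (V : normedModType C) (x : V) : `|x| = ((rnorm x)%:C)%C :> C.
Proof. by rewrite /rnorm (@RRe_real R) // realE normr_ge0. Qed.

Lemma cabsE (z : C) : `|z| = ((rnorm z)%:C)%C :> C.
Proof. exact: (rnormE (z : C)). Qed.

Variable V : normedModType C.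
Implicit Types x y : V.

Lemma rnorm_ge0 x : 0 <= rnorm x.
Proof. by have := normr_ge0 x; rewrite rnormE ler0c. Qed.
Lemma rnorm0 : rnorm (0 : V) = 0.
Proof. by rewrite /rnorm normr0. Qed.
Lemma rnormD x y : rnorm (x + y) <= rnorm x + rnorm y.
Proof. by have := ler_normD x y; rewrite !rnormE -rmorphD lecR. Qed.
Lemma rnormZ a x : rnorm (a *: x) = rnorm a * rnorm x.
Proof. by rewrite {1}/rnorm normrZ cabsE !rnormE -rmorphM. Qed.
Lemma rnormN x : rnorm (- x) = rnorm x.
Proof. by rewrite /rnorm normrN. Qed.
Lemma rnorm_eq0 x : rnorm x = 0 -> x = 0.
Proof. by move=> h; apply/eqP; rewrite -normr_eq0 rnormE h. Qed.
Lemma rnormM (a b : C) : rnorm (a * b) = rnorm a * rnorm b.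
Proof. by rewrite {1}/rnorm normrM !cabsE -rmorphM. Qed.
End RealNorm.

Section Hilbert.
Variable R : realType.
Local Notation C := (cpx R).

(* The inner product is linear in its first argument. *)
Record hilbert := Hilbert {
  hcar :> completeNormedModType C;
  hform : {dot hcar for Num.conj};
  hformP : forall x, hform x x = `|x| ^+ 2 }.

Definition ip (H : hilbert) (x y : H) : C := hform H x y.

Variable H : hilbert.
Implicit Types x y : H.

Lemma ip_rnorm x : cre (ip x x) = rnorm x ^+ 2.
Proof. by rewrite /ip hformP rnormE -rmorphXn. Qed.
Lemma ipDl x y z : ip (x + y) z = ip x z + ip y z.
Proof. exact: linearDl. Qed.
Lemma ipZl a x z : ip (a *: x) z = a * ip x z.
Proof. exact: linearZl_LR. Qed.
Lemma ipDr x y z : ip z (x + y) = ip z x + ip z y.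
Proof. exact: linearDr. Qed.
Lemma ipZr a x z : ip z (a *: x) = a^* * ip z x.
Proof. exact: linearZr_LR. Qed.
Lemma ipC x y : ip x y = (ip y x)^*.
Proof. by rewrite /ip hermC /= expr0 mul1r. Qed.
Lemma ip0r x : (forall y, ip y x = 0) -> x = 0.
Proof.
move=> h; apply: rnorm_eq0; apply/eqP; rewrite -sqrf_eq0 -ip_rnorm h.
by [].
Qed.
Lemma ip0x x : ip 0 x = 0.
Proof. by rewrite -(scale0r (0 : H)) ipZl mul0r. Qed.
Lemma ipx0 x : ip x 0 = 0.
Proof. by rewrite -(scale0r (0 : H)) ipZr rmorph0 mul0r. Qed.
Lemma ipNr x y : ip y (- x) = - ip y x.
Proof. by rewrite -scaleN1r ipZr rmorphN1 mulN1r. Qed.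
Lemma ipNl x y : ip (- x) y = - ip x y.
Proof. by rewrite -scaleN1r ipZl mulN1r. Qed.

Lemma cip_sym x y : cre (ip x y) = cre (ip y x).
Proof. by rewrite ipC creC. Qed.

Lemma rnorm_sqD x y :
  rnorm (x + y) ^+ 2 = rnorm x ^+ 2 + rnorm y ^+ 2 + 2 * cre (ip x y).
Proof.
rewrite -!ip_rnorm ipDl !ipDr !creD (cip_sym y x); ring.
Qed.

Lemma rnorm_real (a : R) : rnorm ((a%:C)%C : C) = `|a|.
Proof. by rewrite /rnorm normc_def /= expr0n addr0 sqrtr_sqr. Qed.

Lemma cip_CS x y : cre (ip x y) <= rnorm x * rnorm y.
Proof.
have [s0 t0] := (rnorm_ge0 x, rnorm_ge0 y).
have key : 0 <= rnorm (((rnorm y)%:C)%C *: x + ((- rnorm x)%:C)%C *: y) ^+ 2.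
  by rewrite exprn_ge0 ?rnorm_ge0.
rewrite rnorm_sqD !rnormZ !rnorm_real normrN !ger0_norm // ipZl ipZr in key.
have E : ((- rnorm x)%:C%C : C)^* = ((- rnorm x)%:C)%C by exact: (@conjc_real R (- rnorm x)).
rewrite E !creR in key.
have [x0|x0] := eqVneq (rnorm x) 0.
  by rewrite (rnorm_eq0 x0) rnorm0 mul0r -(scale0r (0 : H)) ipZl mul0r.
have [y0|y0] := eqVneq (rnorm y) 0.
  by rewrite (rnorm_eq0 y0) rnorm0 mulr0 -(scale0r (0 : H)) ipZr rmorph0 mul0r.
have p : 0 < rnorm x * rnorm y by rewrite mulr_gt0 // lt_def ?x0 ?y0.
rewrite -(ler_pM2l p); nra.
Qed.

Lemma ip_CS x y : rnorm (ip x y) <= rnorm x * rnorm y.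
Proof.
set z := ip x y.
have [->|z0] := eqVneq (rnorm z) 0; first by rewrite mulr_ge0 ?rnorm_ge0.
have z1 : 0 < rnorm z by rewrite lt_def z0 rnorm_ge0.
have := cip_CS (z^* *: x) y; rewrite ipZl -/z rnormZ.
have -> : z^* * z = ((rnorm z ^+ 2)%:C)%C.
  by rewrite mulrC -normCK cabsE -rmorphXn.
have -> : rnorm (z^* : C) = rnorm z by rewrite /rnorm norm_conjC.
by rewrite /cre /= expr2 -mulrA ler_pM2l.
Qed.

Section Riesz.
Variable f : H -> C.
Hypotheses (fL : scalar f) (c : R) (fB : forall x, rnorm (f x) <= c * rnorm x).

Let fD x y : f (x + y) = f x + f y.
Proof. by have := fL 1 x y; rewrite scale1r mul1r. Qed.
Let f0 : f 0 = 0.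
Proof. by apply: (addrI (f 0)); rewrite -fD !addr0. Qed.
Let fZ a x : f (a *: x) = a * f x.
Proof. by have := fL a x 0; rewrite f0 !addr0. Qed.

Let q x : R := rnorm x ^+ 2 - 2 * cre (f x).
Let m := inf (range q).

Let q_lb x : m <= q x.
Proof.
apply: ge_inf; last by exists x.
exists (- c ^+ 2) => _ [y _ <-]; rewrite /q.
have := le_trans (cre_norm _) (fB y); have := sqr_ge0 (rnorm y - c); nra.
Qed.

Let minseq (n : nat) : exists x, q x < m + n.+1%:R^-1.
Proof.
have hi : has_inf (range q).
  split; first by exists (q 0), 0.
  by exists m => _ [y _ <-]; exact: q_lb.
have [//|_ [x _ <-] ?] := @inf_adherent _ (range q) n.+1%:R^-1 _ hi.
by exists x.
Qed.

Lemma riesz : exists y, forall x, f x = ip x y.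
Proof.
have [xi xiP] := choice minseq.
have first n z : (cre (ip z (xi n)) - cre (f z)) ^+ 2 <=
    (rnorm z ^+ 2 + 1) * n.+1%:R^-1.
  set d := _ - _; set N := rnorm z ^+ 2.
  have N0 : 0 <= N by rewrite sqr_ge0.
  pose t := - d / (N + 1).
  have := xiP n; have := q_lb (xi n + (t%:C)%C *: z).
  rewrite /q rnorm_sqD fD creD fZ rnormZ rnorm_real cip_sym ipZl !creR.
  rewrite exprMn real_normK ?num_real // -/N.
  set e := _^-1 => h1 h2.
  have h : 0 <= t ^+ 2 * N + 2 * t * d + e by move: h1 h2; rewrite /d; nra.
  have tE : t * (N + 1) = - d by rewrite /t divfK // gt_eqF // ltr_wpDl.
  have -> : d = - (t * (N + 1)) by rewrite tE opprK.
  have h' : t ^+ 2 * (N + 2) <= e.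
    by move: h; rewrite -[d]opprK -tE; move: (t) (N) => a b; nra.
  have -> : (- (t * (N + 1))) ^+ 2 = (N + 1) * (t ^+ 2 * (N + 1)) by ring.
  apply: ler_wpM2l; first by lra.
  by apply: le_trans h'; apply: ler_wpM2l; [exact: sqr_ge0|lra].
have cau e : 0 < e -> exists N, forall n, (N <= n)%N -> rnorm (xi n - xi N) < e.
  move=> e0.
  have ge4 : 0 < e ^+ 2 / 4 by rewrite divr_gt0 // exprn_gt0.
  have [N] := ltr_add_invr ge4; rewrite add0r => NP.
  exists N => n Nn.
  have nN : n.+1%:R^-1 <= N.+1%:R^-1 :> R by rewrite lef_pV2 ?posrE // ler_nat.
  have h := q_lb ((2%:R^-1%:C)%C *: (xi n + xi N)).
  rewrite -(@ltr_pXn2r _ 2) ?nnegrE ?rnorm_ge0 ?ltW //.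
  have h1 := xiP n; have h2 := xiP N; move: h h1 h2.
  rewrite /q rnormZ rnorm_real exprMn real_normK ?num_real // fZ creR fD creD.
  rewrite !rnorm_sqD rnormN ipNr creN.
  move: NP nN; set a := N.+1%:R^-1; set b := n.+1%:R^-1; lra.
have creP (e : C) : 0 < e -> (0 < cre e) * (e = ((cre e)%:C)%C).
  move=> e0; have er : e \is Num.real by rewrite realE ltW.
  have E : e = ((cre e)%:C)%C := esym (@RRe_real R e er).
  by split=> //; rewrite -ltcR -E.
have /cauchy_cvgP/cvg_ex[/= y xiy] : cauchy (xi @ \oo).
  apply: cauchy_exP => e /creP[e0 eE].
  have [N NP] := cau _ e0.
  exists (xi N), N => // n /= Nn.
  rewrite -ball_normE /= -normrN opprB.
  by rewrite rnormE eE ltcR NP.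
exists y.
have ycvg e : 0 < e -> exists N, forall n, (N <= n)%N -> rnorm (y - xi n) < e.
  move=> e0; have eC : (0 : C) < (e%:C)%C by rewrite ltcR.
  have /cvgrPdist_lt /(_ _ eC) [N _ NP] := xiy.
  by exists N => n Nn; have := NP n Nn; rewrite /= rnormE ltcR.
have lim z : cre (ip z y) = cre (f z).
  apply/eqP/negPn/negP => dn0.
  set d := cre (ip z y) - cre (f z).
  have d0 : 0 < `|d| by rewrite normr_gt0 subr_eq0.
  have z0 := rnorm_ge0 z.
  pose e := `|d| / (2 * (rnorm z + 1)).
  have e0 : 0 < e by rewrite divr_gt0 // mulr_gt0 // ltr_wpDl.
  have dE : `|d| = 2 * e * (rnorm z + 1) by rewrite /e; field; lra.
  have [N1 N1P] := ycvg _ e0.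
  have ee : 0 < e ^+ 2 by rewrite exprn_gt0.
  have [N2] := ltr_add_invr ee; rewrite add0r => N2P.
  pose n := maxn N1 N2.
  have := first n z; set dn := _ - _ => dnP.
  have nP : n.+1%:R^-1 < e ^+ 2.
    apply: le_lt_trans N2P; rewrite lef_pV2 ?posrE // ler_nat ltnS.
    exact: leq_maxr.
  have yn := N1P n (leq_maxl _ _).
  have dnb : `|dn| < (rnorm z + 1) * e.
    have nn : 0 <= (rnorm z + 1) * e by rewrite mulr_ge0 ?ltW // ltr_wpDl.
    rewrite -(@ltr_pXn2r _ 2) ?nnegrE //.
    rewrite real_normK ?num_real // (le_lt_trans dnP) //.
    rewrite exprMn (@lt_le_trans _ _ ((rnorm z ^+ 2 + 1) * e ^+ 2)) //.
      by rewrite ltr_pM2l // ltr_wpDl // sqr_ge0.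
    by rewrite ler_pM2r //; lra.
  have b1 : cre (ip z (y - xi n)) <= rnorm z * e.
    by rewrite (le_trans (cip_CS _ _)) // ler_wpM2l // ltW.
  have b2 : - cre (ip z (y - xi n)) <= rnorm z * e.
    rewrite -creN -ipNr (le_trans (cip_CS _ _)) // ler_wpM2l // rnormN ltW //.
  have dd : d = dn + cre (ip z (y - xi n)).
    by rewrite /d /dn ipDr ipNr creD creN; ring.
  have : `|d| <= `|dn| + rnorm z * e.
    by rewrite dd (le_trans (ler_normD _ _)) // lerD2l ler_norml b1 andbT lerNl.
  rewrite dE => h; move: h dnb; lra.
move=> z; apply/eqP; rewrite eq_complex; apply/andP; split.
  exact/eqP/esym/(lim z).
have iE (w : C) : cre ('i%C * w) = - complex.Im w.
  by case: w => a b; rewrite /cre /= mul0r mul1r sub0r.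
by have := lim ('i%C *: z); rewrite ipZl fZ !iE => /oppr_inj ->.
Qed.
End Riesz.
End Hilbert.

Section Operators.
Variable R : realType.
Local Notation C := (cpx R).
Implicit Types H K L : hilbert R.

Definition bounded_op H K (f : H -> K) :=
  exists c : R, forall x, rnorm (f x) <= c * rnorm x.

Definition bop_set H K (f : H -> K) := linear f /\ bounded_op f.

Lemma bop_set0 H K : bop_set (0 : H -> K).
Proof.
split=> [a x y|]; first by rewrite scaler0 addr0.
by exists 0 => x; rewrite rnorm0 mul0r.
Qed.

Lemma bop_setP H K (a : C) (f g : H -> K) :
  bop_set f -> bop_set g -> bop_set (a *: f + g).
Proof.
move=> [fL [c fB]] [gL [d gB]]; split=> [b x y|].
  rewrite -![(_ + _) _]/(_ _ + _ _) -![(_ *: f) _]/(_ *: f _) fL gL.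
  by rewrite !scalerDr !scalerA (mulrC a b) !addrA; congr +%R; rewrite addrAC.
exists (rnorm a * c + d) => x; rewrite (le_trans (rnormD _ _)) // rnormZ.
by rewrite mulrDl lerD // -mulrA ler_wpM2l // rnorm_ge0.
Qed.

Definition bop_linset H K := Linset (@bop_set0 H K) (@bop_setP H K).
Definition bop H K : Type := lsub (bop_linset H K).
HB.instance Definition _ H K := GRing.Lmodule.on (bop H K).
Definition bapp H K (T : bop H K) : H -> K := lval T.
Coercion bapp : bop >-> Funclass.
Definition mkbop H K (f : H -> K) (fP : bop_set f) : bop H K  :=
  mklsub (S := bop_linset H K) fP.

Lemma bopP H K (T : bop H K) : bop_set T.
Proof. exact: (@lsetV _ _ (bop_linset H K)). Qed.
Lemma bop_linear H K (T : bop H K) : linear T.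
Proof. by case: (bopP T). Qed.
Lemma bop0 H K (T : bop H K) : T 0 = 0.
Proof. by have := bop_linear T (-1) 0 0; rewrite scaler0 addr0 scaleN1r addNr. Qed.
Lemma bopZ H K (T : bop H K) a x : T (a *: x) = a *: T x.
Proof. by have := bop_linear T a x 0; rewrite bop0 !addr0. Qed.
Lemma bop_ext H K (S T : bop H K) : (forall x, S x = T x) -> S = T.
Proof. by move=> ST; apply/val_inj/funext. Qed.
Lemma bop_linE H K (S T : bop H K) a x : (a *: S + T : bop H K) x = a *: S x + T x.
Proof. by []. Qed.

Lemma comp_subproof H K L (S : bop K L) (T : bop H K) : bop_set (S \o T).
Proof.
have [[SL [c SB]] [TL [d TB]]] := (bopP S, bopP T).
split=> [a x y|]; first by rewrite /= TL SL.
exists (`|c| * d) => x; rewrite /= (le_trans (SB _)) //.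
rewrite (@le_trans _ _ (`|c| * rnorm (T x))) //.
  by rewrite ler_wpM2r ?rnorm_ge0 // ler_norm.
by rewrite -mulrA ler_wpM2l.
Qed.
Definition bcomp H K L (S : bop K L) (T : bop H K) : bop H L :=
  mkbop (comp_subproof S T).

Lemma id_subproof H : bop_set (@idfun H).
Proof. by split=> [a x y //|]; exists 1 => x; rewrite mul1r. Qed.
Definition bone H : bop H H := mkbop (@id_subproof H).

Lemma adj_subproof H K (T : bop H K) :
  exists S : bop K H, forall x y, ip (T x) y = ip x (S y).
Proof.
have [TL [c TB]] := bopP T.
have /choice[f fP] y : exists z, forall x, ip (T x) y = ip x z.
  apply: (@riesz _ _ (fun x => ip (T x) y) _ (`|c| * rnorm y)) => [a u v|x].
    by rewrite TL ipDl ipZl.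
  rewrite (le_trans (ip_CS _ _)) //.
  rewrite mulrAC ler_wpM2r ?rnorm_ge0 // (le_trans (TB _)) //.
  by rewrite ler_wpM2r ?rnorm_ge0 // ler_norm.
have fB : bop_set f.
  split=> [a u v|].
    apply/eqP; rewrite -subr_eq0; apply/eqP/ip0r => x.
    by rewrite ipDr ipNr ipDr ipZr -!fP ipDr ipZr subrr.
  exists `|c| => y.
  have [->|] := eqVneq (rnorm (f y)) 0; first by rewrite mulr_ge0 ?rnorm_ge0.
  move=> y0; have y1 : 0 < rnorm (f y) by rewrite lt_def y0 rnorm_ge0.
  rewrite -(ler_pM2l y1) -expr2 -ip_rnorm -fP (le_trans (cip_CS _ _)) //.
  rewrite mulrA ler_wpM2r ?rnorm_ge0 // mulrC (le_trans (TB _)) //.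
  by rewrite ler_wpM2r ?rnorm_ge0 // ler_norm.
by exists (mkbop fB) => x y; rewrite fP.
Qed.

Definition adj H K (T : bop H K) : bop K H := projT1 (cid (adj_subproof T)).
Lemma adjP H K (T : bop H K) x y : ip (T x) y = ip x (adj T y).
Proof. by rewrite /adj; case: cid => S SP /=; rewrite SP. Qed.
Lemma adjP' H K (T : bop H K) x y : ip (adj T x) y = ip x (T y).
Proof. by rewrite ipC -adjP -ipC. Qed.
Lemma adj_eq H K (T : bop H K) (S : bop K H) :
  (forall x y, ip (T x) y = ip x (S y)) -> S = adj T.
Proof.
move=> ST; apply: bop_ext => y; apply/eqP; rewrite -subr_eq0; apply/eqP.
by apply: ip0r => x; rewrite ipDr ipNr -ST adjP subrr.
Qed.
Lemma adjK H K (T : bop H K) : adj (adj T) = T.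
Proof. by apply/esym/adj_eq => x y; rewrite adjP'. Qed.

Definition commutant H (S : set (bop H H)) : set (bop H H) :=
  [set T | forall U, S U -> bcomp T U = bcomp U T].

Lemma bcompE H K L (S : bop K L) (T : bop H K) x : bcomp S T x = S (T x).
Proof. by []. Qed.
Lemma adj_comp H K L (S : bop K L) (T : bop H K) :
  adj (bcomp S T) = bcomp (adj T) (adj S).
Proof. by apply/esym/adj_eq => x y; rewrite !bcompE !adjP. Qed.

Definition self_adjoint H (S : set (bop H H)) := forall T, S T -> S (adj T).

Lemma commutant_adj H (S : set (bop H H)) :
  self_adjoint S -> self_adjoint (commutant S).
Proof.
move=> SA T TS U /SA /TS /(congr1 (@adj _ _)).
by rewrite !adj_comp adjK => ->.
Qed.

Lemma commutant_lin H (S : set (bop H H)) a T U :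
  commutant S T -> commutant S U -> commutant S (a *: T + U).
Proof.
move=> TS US V SV; apply: bop_ext => x; rewrite !bcompE !bop_linE.
have [VL _] := bopP V.
by rewrite VL -!bcompE TS // US.
Qed.
Lemma commutant0 H (S : set (bop H H)) : commutant S 0.
Proof.
move=> V SV; apply: bop_ext => x; rewrite !bcompE.
have -> : forall y, (0 : bop H H) y = 0 by [].
exact/esym/bop0.
Qed.
Lemma commutant_comp H (S : set (bop H H)) T U :
  commutant S T -> commutant S U -> commutant S (bcomp T U).
Proof.
move=> TS US V SV; apply: bop_ext => x; rewrite !bcompE.
have e W : commutant S W -> forall y, W (V y) = V (W y).
  by move=> WS y; rewrite -!bcompE WS.
by rewrite !e.
Qed.
Lemma commutant1 H (S : set (bop H H)) : commutant S (bone H).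
Proof. by move=> V SV; apply: bop_ext. Qed.
Lemma commutant3 H (S : set (bop H H)) :
  commutant (commutant (commutant S)) = commutant S.
Proof.
apply/seteqP; split=> T TS U.
  by move=> SU; apply: TS => V VS; rewrite VS.
by move=> US; rewrite US.
Qed.

(* A *-closed set of operators that equals its bicommutant is a unital
   *-subalgebra of B(H); the closure properties are derived below. *)
Record vnAlg H := VnAlg {
  vn_set : set (bop H H);
  vn_adj : self_adjoint vn_set;
  vn_bicommutant : commutant (commutant vn_set) = vn_set }.

Lemma vn0 H (M : vnAlg H) : vn_set M 0.
Proof. by rewrite -vn_bicommutant; exact: commutant0. Qed.
Lemma vn_lin H (M : vnAlg H) a T U :
  vn_set M T -> vn_set M U -> vn_set M (a *: T + U).
Proof. by rewrite -vn_bicommutant; exact: commutant_lin. Qed.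

Definition vn_linset H (M : vnAlg H) := Linset (vn0 M) (@vn_lin H M).
Definition vn_type H (M : vnAlg H) : Type := lsub (vn_linset M).
HB.instance Definition _ H (M : vnAlg H) := GRing.Lmodule.on (vn_type M).
Coercion vn_type : vnAlg >-> Sortclass.
Definition vn_op H (M : vnAlg H) (x : M) : bop H H := lval x.
Coercion vn_op : vn_type >-> bop.

Lemma vnP H (M : vnAlg H) (x : M) : vn_set M x.
Proof. exact: (@lsetV _ _ (vn_linset M)). Qed.

Lemma vn_mul_subproof H (M : vnAlg H) (x y : M) : vn_set M (bcomp x y).
Proof.
have xM := vnP x; have yM := vnP y; move: xM yM.
rewrite -vn_bicommutant; exact: commutant_comp.
Qed.
Definition vn_mul H (M : vnAlg H) (x y : M) : M := mklsub (S := vn_linset M) (vn_mul_subproof x y).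
Lemma vn_one_subproof H (M : vnAlg H) : vn_set M (bone H).
Proof. rewrite -vn_bicommutant; exact: commutant1. Qed.
Definition vn_one H (M : vnAlg H) : M := mklsub (S := vn_linset M) (vn_one_subproof M).
Definition vn_star H (M : vnAlg H) (x : M) : M := mklsub (S := vn_linset M) (vn_adj (vnP x)).

(* A realization of the Hilbert space tensor product, which is unique up to a
   unitary respecting elementary tensors. *)
Record hilbert_tensor H K := HilbertTensor {
  ht_space :> hilbert R;
  tens : {bilinear H -> K -> ht_space};
  tens_ip : forall x x' y y',
    ip (tens x y) (tens x' y') = ip x x' * ip y y';
  tens_dense : dense [set z : ht_space | exists n (x : 'I_n -> H) (y : 'I_n -> K),
    z = \sum_i tens (x i) (y i)] }.

Lemma ht_total H K (HK : hilbert_tensor H K) (z : HK) :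
  (forall x y, ip (tens HK x y) z = 0) -> z = 0.
Proof.
move=> zP; apply: rnorm_eq0; apply/eqP/negPn/negP => z0.
have z1 : 0 < rnorm z by rewrite lt_def z0 rnorm_ge0.
have z2 : (0 : C) < ((rnorm z)%:C)%C by rewrite ltcR.
have [||s [/= zs [n [x [y sE]]]]] := @tens_dense _ _ HK (ball z ((rnorm z)%:C)%C).
- by exists z; exact: ballxx.
- exact: ball_open.
have sz : ip s z = 0.
  rewrite sE; apply: (big_ind (fun s => ip s z = 0)) => [|u v u0 v0|i _].
  - by rewrite -(scale0r (0 : HK)) ipZl mul0r.
  - by rewrite ipDl u0 v0 addr0.
  - exact: zP.
move: zs; rewrite -ball_normE /= rnormE ltcR => zs.
have := ip_rnorm z; rewrite -{1}(subrK s z) ipDl sz addr0 => h.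
have := cip_CS (z - s) z; rewrite h expr2 ler_pM2r // leNgt zs //.
Qed.

(* T is the operator S \otimes U. *)
Definition op_tens H K (HK : hilbert_tensor H K) (T : bop HK HK)
    (S : bop H H) (U : bop K K) :=
  forall x y, T (tens HK x y) = tens HK (S x) (U y).

Section VnTensor.
Variables (H K : hilbert R) (HK : hilbert_tensor H K).
Variables (M : vnAlg H) (N : vnAlg K).

Definition elem_tensors : set (bop HK HK) :=
  [set T | exists (x : M) (y : N), op_tens T x y].

Lemma elem_tensors_adj : self_adjoint elem_tensors.
Proof.
move=> T [x [y xyT]]; exists (vn_star x), (vn_star y) => a b.
apply/eqP; rewrite -subr_eq0; apply/eqP/ht_total => c d.
rewrite ipDr ipNr -adjP xyT !tens_ip !adjP; exact: subrr.
Qed.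

Definition vn_tensor : vnAlg HK :=
  VnAlg (commutant_adj (commutant_adj elem_tensors_adj))
        (commutant3 (commutant elem_tensors)).
End VnTensor.
End Operators.

Section Predual.
Variable R : realType.
Local Notation C := (cpx R).

Definition sq_summable (V : normedModType C) (xi : nat -> V) :=
  cvgn (series (fun n => rnorm (xi n) ^+ 2)).

(* The elements of the predual, that is, the sigma-weakly continuous functionals
   x |-> \sum_n <x xi_n, eta_n>. *)
Definition normal_functional (H : hilbert R) (M : vnAlg H) (f : M -> C) :=
  exists xi eta : nat -> H, [/\ sq_summable xi, sq_summable eta &
    forall x : M, series (fun n => ip (x (xi n)) (eta n)) @ \oo --> (f x : C)].

Section Interleave.
Definition interleave (T : Type) (u v : nat -> T) n :=
  if odd n then v n./2 else u n./2.

Lemma series_interleave (V : zmodType) (u v : nat -> V) n :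
  series (interleave u v) n = series u (uphalf n) + series v n./2.
Proof.
have rec (w : nat -> V) k : series w k.+1 = series w k + w k.
  by rewrite !seriesEnat /= big_nat_recr.
elim: n => [|n IH]; first by rewrite !seriesEnat /= !big_nil addr0.
rewrite rec IH /interleave /= uphalf_half.
case: (odd n) => /=; first by rewrite add1n (rec v) addrA.
by rewrite !add0n (rec u) addrAC.
Qed.

Lemma cvg_uphalf : uphalf @ \oo --> \oo.
Proof.
move=> A [N _ NA]; exists N.*2 => // n /= Nn; apply: NA => /=.
by rewrite -(doubleK N) uphalf_half; apply: leq_trans (leq_addl _ _); apply: half_leq.
Qed.
Lemma cvg_half : half @ \oo --> \oo.
Proof.
move=> A [N _ NA]; exists N.*2 => // n /= Nn; apply: NA => /=.
by rewrite -(doubleK N); apply: half_leq.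
Qed.

Lemma cvg_series0 (K : numFieldType) (V : normedModType K) (u : nat -> V) :
  (forall n, u n = 0) -> series u @ \oo --> (0 : V).
Proof.
move=> u0; have -> : series u = cst 0.
  by apply/funext => n; rewrite seriesEnat /= big1.
exact: cvg_cst.
Qed.

Lemma cvg_interleave (K : numFieldType) (V : normedModType K) (u v : nat -> V) a b :
  series u @ \oo --> a -> series v @ \oo --> b ->
  series (interleave u v) @ \oo --> a + b.
Proof.
move=> ua vb.
have -> : series (interleave u v) = (series u \o uphalf) \+ (series v \o half).
  by apply/funext => n; rewrite series_interleave.
by apply: cvgD; apply: cvg_comp; [exact: cvg_uphalf|exact: ua|exact: cvg_half|exact: vb].
Qed.
End Interleave.

Section Structure.
Variables (H : hilbert R) (M : vnAlg H).

Lemma normal_functional0 : normal_functional (0 : M -> C).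
Proof.
have s0 : sq_summable (fun _ => 0 : H).
  rewrite /sq_summable; apply/cvg_ex; exists 0; apply: cvg_series0 => n.
  by rewrite rnorm0 expr0n.
exists (fun _ => 0), (fun _ => 0); split=> // x.
apply: cvg_series0 => n; exact: ipx0.
Qed.

Lemma normal_functionalP (a : C) (f g : M -> C) :
  normal_functional f -> normal_functional g -> normal_functional (a *: f + g).
Proof.
move=> [xi [eta [sxi seta fP]]] [xi' [eta' [sxi' seta' gP]]].
have s (u v : nat -> H) :
    sq_summable u -> sq_summable v -> sq_summable (interleave u v).
  rewrite /sq_summable => /cvg_ex[b ub] /cvg_ex[c vc].
  apply/cvg_ex; exists (b + c).
  have -> : (fun n => rnorm (interleave u v n) ^+ 2) =
     interleave (fun n => rnorm (u n) ^+ 2) (fun n => rnorm (v n) ^+ 2).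
    by apply/funext => n; rewrite /interleave; case: odd.
  exact: cvg_interleave.
have sa : sq_summable (fun n => a *: xi n).
  rewrite /sq_summable.
  have -> : (fun n => rnorm (a *: xi n) ^+ 2) =
    (rnorm a ^+ 2) *: ((fun n => rnorm (xi n) ^+ 2) : nat -> R).
    by apply/funext => n; rewrite rnormZ exprMn.
  rewrite seriesZ; exact: is_cvgZl_tmp.
exists (interleave (fun n => a *: xi n) xi'), (interleave eta eta').
split; [exact: s|exact: s|move=> x].
have -> : (fun n => ip (x (interleave (fun n0 => a *: xi n0) xi' n))
    (interleave eta eta' n)) =
  interleave (fun n => a * ip (x (xi n)) (eta n)) (fun n => ip (x (xi' n)) (eta' n)).
  apply/funext => n; rewrite /interleave; case: odd => //.
  by rewrite bopZ ipZl.
apply: cvg_interleave; last exact: gP.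
have -> : (fun n => a * ip (x (xi n)) (eta n)) =
  a *: ((fun n => ip (x (xi n)) (eta n)) : nat -> C) by [].
rewrite seriesZ; exact: cvgZl_tmp (fP x).
Qed.

Definition predual_linset := Linset normal_functional0 normal_functionalP.
Definition predual : Type := lsub predual_linset.
HB.instance Definition _ := GRing.Lmodule.on predual.
Definition predual_app (f : predual) : M -> C := lval f.
Coercion predual_app : predual >-> Funclass.
End Structure.
End Predual.

Section OperatorSpaces.
Variable R : realType.
Local Notation C := (cpx R).

Definition l2norm (I : finType) (V : normedModType C) (v : I -> V) : R :=
  Num.sqrt (\sum_i rnorm (v i) ^+ 2).

(* The norm of a scalar matrix as an operator from l2(J) to l2(I). *)
Definition mnorm (I J : finType) (A : I -> J -> C) : R :=
  sup [set l2norm (fun i => \sum_j A i j * xi j) |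
         xi in [set xi : J -> C | l2norm xi <= 1]].

(* A vector space with a norm on each space of square matrices over it; Ruan's
   axioms are stated separately in opspace. *)
Record mxSpace := MxSpace {
  mxcar :> lmodType C;
  mxnorm : forall n, 'M[mxcar]_n -> R }.

Definition opspace (V : mxSpace) : Prop :=
  [/\ forall n (X : 'M[V]_n), mxnorm X = 0 -> X = 0,
      forall n (X Y : 'M[V]_n), mxnorm (X + Y) <= mxnorm X + mxnorm Y,
      forall m n (X : 'M[V]_m) (Y : 'M[V]_n),
        mxnorm (block_mx X 0 0 Y) = Num.max (mxnorm X) (mxnorm Y) &
      forall m n (A : 'M[C]_(n, m)) (X : 'M[V]_m) (B : 'M[C]_(m, n)),
        mxnorm (\matrix_(i < n, j < n)
                  \sum_(k < m) \sum_(l < m) (A i k * B l j) *: X k l)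
        <= mnorm A * mxnorm X * mnorm B].

Definition cbnorm (V W : mxSpace) (T : V -> W) : \bar R :=
  ereal_sup [set r | exists n (X : 'M[V]_n),
                       mxnorm X <= 1 /\ r = (mxnorm (map_mx T X))%:E].

Definition completely_bounded (V W : mxSpace) (T : V -> W) :=
  linear T /\ (cbnorm T < +oo)%E.

Definition complete_contraction (V W : mxSpace) (T : V -> W) :=
  linear T /\ (cbnorm T <= 1)%E.

Definition complete_isometry (V W : mxSpace) (T : V -> W) :=
  linear T /\ forall n (X : 'M[V]_n), mxnorm (map_mx T X) = mxnorm X.

(* Injectivity in the category of operator spaces and complete contractions; the
   subspace E of F is given by the embedding j.  A von Neumann algebra on H is
   injective in this sense iff it is the range of a norm-one projection of B(H). *)
Definition injective_opspace (V : mxSpace) :=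
  forall (E F : mxSpace) (j : E -> F) (T : E -> V),
    opspace E -> opspace F -> complete_isometry j -> complete_contraction T ->
  exists2 S : F -> V, complete_contraction S & forall e, S (j e) = T e.

Definition findim_subspace (V : mxSpace) (Y : set V) :=
  exists k (e : 'I_k -> V), Y = [set \sum_i c i *: e i | c in [set: 'I_k -> C]].

(* The quotient V/Y, presented on V itself: M_n(V/Y) = M_n(V)/M_n(Y), so the
   quotient norm of the class of X is its distance to M_n(Y).  The quotient map
   is then the identity function. *)
Definition mxquot (V : mxSpace) (Y : set V) : mxSpace :=
  MxSpace (fun n (X : 'M[V]_n) =>
    inf [set mxnorm (X - Z) | Z in [set Z : 'M[V]_n | forall i j, Y (Z i j)]]).

Definition completely_compact (V W : mxSpace) (T : V -> W) :=
  completely_bounded T /\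
  forall eps : R, 0 < eps -> exists2 Y : set W, findim_subspace Y &
    (@cbnorm V (mxquot Y) T < eps%:E)%E.

Definition vnorm (V : mxSpace) (v : V) : R := mxnorm (const_mx v : 'M[V]_1).

(* The norm of F = [f_ij] in CB(V, M_n), which is M_n of the dual of V: the
   supremum of the norms of the scalar matrices [f_ij(x_kl)] over all m and all
   X in the unit ball of M_m(V). *)
Definition dual_mxnorm (V : mxSpace) n (F : 'I_n -> 'I_n -> V -> C) : R :=
  sup [set r | exists m (X : 'M[V]_m), mxnorm X <= 1 /\
    r = mnorm (fun p q : 'I_n * 'I_m => F p.1 q.1 (X p.2 q.2))].

Definition bounded_functional (V : mxSpace) (f : V -> C) :=
  scalar f /\ exists c : R, forall v, rnorm (f v) <= c * vnorm v.

Section Dual.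
Variable V : mxSpace.

Lemma bounded_functional0 : bounded_functional (0 : V -> C).
Proof.
split=> [a x y|]; first by rewrite /= mulr0 addr0.
by exists 0 => v; rewrite mul0r rnorm0.
Qed.
Lemma bounded_functionalP (a : C) (f g : V -> C) :
  bounded_functional f -> bounded_functional g -> bounded_functional (a *: f + g).
Proof.
move=> [fL [c fB]] [gL [d gB]]; split=> [b x y|].
  rewrite -![(_ + _) _]/(_ _ + _ _) -![(_ *: f) _]/(_ * f _) fL gL; ring.
exists (rnorm a * c + d) => x; rewrite (le_trans (rnormD _ _)) // rnormZ.
by rewrite mulrDl lerD // -mulrA ler_wpM2l // rnorm_ge0.
Qed.
Definition dual_linset := Linset bounded_functional0 bounded_functionalP.
Definition dual_type : Type := lsub dual_linset.
HB.instance Definition _ := GRing.Lmodule.on dual_type.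
Definition dual_app (f : dual_type) : V -> C := lval f.
Coercion dual_app : dual_type >-> Funclass.
Definition mxdual : mxSpace :=
  @MxSpace dual_type (fun n X => dual_mxnorm (fun i j => dual_app (X i j))).
End Dual.

Definition weak_top (V : mxSpace) :=
  initial_topology (fun (v : V) => (fun f : mxdual V => dual_app f v)
                                     : {ptws mxdual V -> C}).

Definition weakly_compact (V W : mxSpace) (T : V -> W) :=
  linear T /\
  compact (closure ([set T v | v in [set v | vnorm v <= 1]] : set (weak_top W))).

(* T is the map a |-> a . phi, respectively a |-> phi . a, from A to its dual. *)
Definition left_action (A : mxSpace) (mul : A -> A -> A) (phi : mxdual A)
    (T : A -> mxdual A) := forall a b, dual_app (T a) b = dual_app phi (mul b a).
Definition right_action (A : mxSpace) (mul : A -> A -> A) (phi : mxdual A)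
    (T : A -> mxdual A) := forall a b, dual_app (T a) b = dual_app phi (mul a b).

Definition WAP (A : mxSpace) (mul : A -> A -> A) : set (mxdual A) :=
  [set phi | exists2 T : A -> mxdual A, left_action mul phi T & weakly_compact T].
Definition CAP (A : mxSpace) (mul : A -> A -> A) : set (mxdual A) :=
  [set phi | (exists2 T : A -> mxdual A, left_action mul phi T & completely_compact T) /\
             (exists2 T : A -> mxdual A, right_action mul phi T & completely_compact T)].
End OperatorSpaces.

Section HopfVonNeumann.
Variable R : realType.
Local Notation C := (cpx R).

(* M_n(M) acts on the l2-sum of n copies of H. *)
Definition vn_mxnorm (H : hilbert R) (M : vnAlg H) n (X : 'M[M]_n) : R :=
  sup [set l2norm (fun i => \sum_j (X i j : M) (xi j)) |
         xi in [set xi : 'I_n -> H | l2norm xi <= 1]].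

Definition vn_mx (H : hilbert R) (M : vnAlg H) : mxSpace R :=
  MxSpace (@vn_mxnorm H M).

(* The operator space structure of the predual is inherited from the dual
   of M. *)
Definition predual_mx (H : hilbert R) (M : vnAlg H) : mxSpace R :=
  @MxSpace R (predual M)
    (fun n F => @dual_mxnorm R (vn_mx M) n (fun i j => predual_app (F i j))).

(* Normality: composing with a normal functional gives a normal functional. *)
Definition normal_star_hom (H K : hilbert R) (M : vnAlg H) (N : vnAlg K)
    (pi : M -> N) : Prop :=
  [/\ linear pi, pi (vn_one M) = vn_one N,
      forall x y, pi (vn_mul x y) = vn_mul (pi x) (pi y),
      forall x, pi (vn_star x) = vn_star (pi x) &
      forall g : predual N, normal_functional (fun x => g (pi x))].

(* Gl and Gr are Gamma \otimes id and id \otimes Gamma: normal *-homomorphisms are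
   determined by their values on elementary tensors.  Their codomains are algebras
   on (H \otimes H) \otimes H and H \otimes (H \otimes H), which are identified by
   the associator. *)
Definition coassociative (H : hilbert R) (HH : hilbert_tensor H H)
    (HHl : hilbert_tensor HH H) (HHr : hilbert_tensor H HH) (M : vnAlg H)
    (Gamma : M -> vn_tensor HH M M) : Prop :=
  exists (Gl : vn_tensor HH M M -> vn_tensor HHl (vn_tensor HH M M) M)
         (Gr : vn_tensor HH M M -> vn_tensor HHr M (vn_tensor HH M M))
         (assoc : bop HHl HHr),
    [/\ normal_star_hom Gl /\ normal_star_hom Gr,
        forall (T : vn_tensor HH M M) (x y : M),
          op_tens T x y -> op_tens (Gl T) (Gamma x) y,
        forall (T : vn_tensor HH M M) (x y : M),
          op_tens T x y -> op_tens (Gr T) x (Gamma y),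
        forall a b c : H,
          assoc (tens HHl (tens HH a b) c) = tens HHr a (tens HH b c) &
        forall x : M, bcomp assoc (Gl (Gamma x)) = bcomp (Gr (Gamma x)) assoc].

Definition hopf_von_neumann (H : hilbert R) (HH : hilbert_tensor H H)
    (HHl : hilbert_tensor HH H) (HHr : hilbert_tensor H HH) (M : vnAlg H)
    (Gamma : M -> vn_tensor HH M M) : Prop :=
  [/\ normal_star_hom Gamma, injective Gamma & coassociative HHl HHr Gamma].

(* The functional f \otimes g: elementary tensors span a sigma-weakly dense
   subalgebra, so exactly one normal functional satisfies the condition and the
   default value 0 is never used. *)
Definition fun_tens (H K : hilbert R) (HK : hilbert_tensor H K) (M : vnAlg H)
    (N : vnAlg K) (f : predual M) (g : predual N) : predual (vn_tensor HK M N) :=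
  xget 0 [set h : predual (vn_tensor HK M N) |
    forall (T : vn_tensor HK M N) (x : M) (y : N),
      op_tens T x y -> h T = f x * g y].

(* f * g = (f \otimes g) \o Gamma, which is normal when Gamma is. *)
Definition convolution (H : hilbert R) (HH : hilbert_tensor H H) (M : vnAlg H)
    (Gamma : M -> vn_tensor HH M M) (f g : predual_mx M) : predual_mx M :=
  xget 0 [set k : predual M | forall x : M, k x = fun_tens HH f g (Gamma x)].

(* A set S of functionals on the predual, viewed as a subset of M: M is the
   Banach dual of its predual, x acting as f |-> f x. *)
Definition dual_elem (H : hilbert R) (M : vnAlg H) (S : set (mxdual (predual_mx M))) :
    set M :=
  [set x | exists2 phi, S phi & forall f : predual M, dual_app phi f = f x].

Definition WAP_vn (H : hilbert R) (HH : hilbert_tensor H H) (M : vnAlg H)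
    (Gamma : M -> vn_tensor HH M M) : set M :=
  dual_elem (WAP (convolution Gamma)).
Definition CAP_vn (H : hilbert R) (HH : hilbert_tensor H H) (M : vnAlg H)
    (Gamma : M -> vn_tensor HH M M) : set M :=
  dual_elem (CAP (convolution Gamma)).
End HopfVonNeumann.

(* Main.v *)
(* Slice maps turn the question into one about operators on H ⊗ H: x is weakly almost
   periodic iff a |-> (id ⊗ a)(Γ x) is weakly compact from the predual to M.  The elements
   D of the von Neumann tensor product with weakly compact slice map form a norm-closed
   subspace, stable under left and right multiplication by elementary tensors because
   (id ⊗ a)(D (p ⊗ q)) = (id ⊗ qa)(D) p.  So it is enough that Γ y is a norm limit of sums
   of elementary tensors when y is completely almost periodic.  Let T be the completely
   compact map a |-> y · a, within ε of the span of finitely many x_1, ..., x_k in M.  On the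
   finite-codimensional subspace L = {a : a(x_i) = 0} of the predual the transposed map
   a |-> (id ⊗ a)(Γ y) has completely bounded norm at most ε; injectivity of M extends its
   restriction to L to a map S of norm at most ε on the whole predual, and the difference has
   the form a |-> \sum_i a(x_i) p_i.  Hence Γ y - \sum_i p_i ⊗ x_i has slice map S, and its
   operator norm is the completely bounded norm of S.  That a normal functional is determined
   by its values on elementary tensors is von Neumann's density theorem for the sigma-weak
   topology. *)
Set Warnings "-notation-overridden,-ambiguous-paths,-notation-incompatible-prefix".
Require Import Defs.
From HB Require Import structures.
From mathcomp Require Import all_boot all_order all_algebra sesquilinear.
From mathcomp Require Import complex.
From mathcomp Require Import ring lra.
From mathcomp Require Import all_classical all_reals all_analysis.
Import Order.TTheory GRing.Theory Num.Theory.
Import numFieldNormedType.Exports.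
Local Open Scope classical_set_scope.
Local Open Scope ring_scope.

Set Implicit Arguments.
Unset Strict Implicit.
Unset Printing Implicit Defensive.

(** Complete compactness controls the distance of a map to a finite-dimensional subspace of its
    range, whereas injectivity of M extends maps from a subspace of their domain. Transposition
    reconciles the two, because the quotient by a subspace of M is dual to the restriction to its
    preannihilator in the predual. The argument has to run at all matrix levels: the extension
    property is stated for complete contractions, and the operator norm of an element of the von
    Neumann tensor product is the completely bounded norm of its slice map, its plain norm being too
    small in general. Both facts are reached through one test object, the matrix of vector
    functionals of orthonormal systems, which lies in the unit ball of the matrices over the
    predual. Weak compactness is tested on ultrafilters of the unit ball, so that sums,
    multiplications and norm limits of weakly compact maps reduce to limits of scalars. *)

(** * Limits and series in terms of real-valued norms *)

Section RealNormLimits.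
Variable R : realType.
Local Notation C := (cpx R).

Lemma cvg_rnormP (V : normedModType C) (T : Type) (F : set_system T) {FF : Filter F}
    (u : T -> V) (l : V) :
  u @ F --> l <-> forall e : R, 0 < e -> \forall t \near F, rnorm (l - u t) < e.
Proof.
split=> [/cvgrPdist_lt Fl e e0|Fl].
  have eC : (0 : C) < (e%:C)%C by rewrite ltcR.
  by apply: filterS (Fl _ eC) => x; rewrite rnormE ltcR.
apply/cvgrPdist_lt => e e0.
(* A positive element of [C] is real, so [e] comes from the real number [cre e]. *)
have er : e \is Num.real by rewrite realE ltW.
have E : e = ((cre e)%:C)%C := esym (@RRe_real R e er).
have e1 : 0 < cre e by rewrite -ltcR -E.
by apply: filterS (Fl _ e1) => x; rewrite rnormE E ltcR.
Qed.

Lemma cvgn_rnormP (V : normedModType C) (u : nat -> V) (l : V) :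
  u @ \oo --> l <->
  forall e : R, 0 < e -> exists N, forall n, (N <= n)%N -> rnorm (l - u n) < e.
Proof.
split=> [/cvg_rnormP ul e /ul [N _ NP]|ul].
  by exists N => n Nn; exact: NP.
by apply/cvg_rnormP => e /ul [N NP]; exists N => // n /= /NP.
Qed.

Lemma rnormB (V : normedModType C) (x y : V) : rnorm (x - y) = rnorm (y - x).
Proof. by rewrite -rnormN opprB. Qed.

Lemma ler_rnormB (V : normedModType C) (x y : V) : rnorm x - rnorm y <= rnorm (x - y).
Proof. by rewrite lerBlDr (le_trans _ (rnormD _ _)) // subrK. Qed.

Lemma rnorm_sum (V : normedModType C) (I : Type) (r : seq I) (P : pred I) (F : I -> V) :
  rnorm (\sum_(i <- r | P i) F i) <= \sum_(i <- r | P i) rnorm (F i).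
Proof.
elim/big_ind2: _ => [|x a y b xa yb|//]; first by rewrite rnorm0.
by rewrite (le_trans (rnormD _ _)) // lerD.
Qed.

Lemma rnorm_conj (z : C) : rnorm (z^* : C) = rnorm z.
Proof. by rewrite /rnorm norm_conjC. Qed.

Lemma rnormCE (z : C) :
  rnorm z = Num.sqrt (complex.Re z ^+ 2 + complex.Im z ^+ 2).
Proof. by rewrite /rnorm normc_def. Qed.

Lemma ler_rnorm_ReIm (z : C) : rnorm z <= `|complex.Re z| + `|complex.Im z|.
Proof.
rewrite rnormCE -(@ler_pXn2r _ 2) ?nnegrE ?sqrtr_ge0 ?addr_ge0 //.
rewrite sqr_sqrtr ?addr_ge0 ?sqr_ge0 // sqrrD !real_normK ?num_real //.
by rewrite -addrA (addrC (_ *+ 2)) addrA lerDl mulrn_wge0 // mulr_ge0.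
Qed.

Lemma ler_norm_Re (z : C) : `|complex.Re z| <= rnorm z.
Proof.
by rewrite rnormCE -sqrtr_sqr ler_sqrt ?addr_ge0 ?sqr_ge0 // lerDl sqr_ge0.
Qed.

Lemma ler_norm_Im (z : C) : `|complex.Im z| <= rnorm z.
Proof.
by rewrite rnormCE -sqrtr_sqr ler_sqrt ?addr_ge0 ?sqr_ge0 // lerDr sqr_ge0.
Qed.

Lemma ReB (z w : C) : complex.Re (z - w) = complex.Re z - complex.Re w.
Proof. by case: z w => [a b] [c d]. Qed.
Lemma ImB (z w : C) : complex.Im (z - w) = complex.Im z - complex.Im w.
Proof. by case: z w => [a b] [c d]. Qed.

(* Limits in C are taken componentwise, the completeness of R[i] not being
   available as an instance. *)
Lemma cvg_ReIm (T : Type) (F : set_system T) {FF : Filter F} (u : T -> C) (a b : R) :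
  (fun t => complex.Re (u t)) @ F --> a -> (fun t => complex.Im (u t)) @ F --> b ->
  u @ F --> ((a +i* b)%C : C).
Proof.
move=> /cvgrPdist_lt ua /cvgrPdist_lt ub; apply/cvg_rnormP => e e0.
have e2 : 0 < e / 2 by rewrite divr_gt0.
near=> x.
rewrite (le_lt_trans (ler_rnorm_ReIm _)) // [ltRHS]splitr ltrD // ?ReB ?ImB /=.
  by near: x; exact: ua.
by near: x; exact: ub.
Unshelve. all: by end_near. Qed.

Lemma cvg_rnorm_le (T : Type) (F : set_system T) {FF : ProperFilter F}
    (V : normedModType C) (u : T -> V) (l : V) (c : R) :
  u @ F --> l -> (\forall x \near F, rnorm (u x) <= c) -> rnorm l <= c.
Proof.
move=> /cvg_rnormP ul uc; apply/ler_addgt0Pr => e e0.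
have [x [xl xc]] := filter_ex (filterI (ul _ e0) uc).
by rewrite -(subrK (u x) l) (le_trans (rnormD _ _)) // addrC lerD // ltW.
Qed.

Lemma seriesS (V : zmodType) (u : nat -> V) n : series u n.+1 = series u n + u n.
Proof. by rewrite !seriesEnat /= big_nat_recr. Qed.

Lemma series0 (V : zmodType) (u : nat -> V) : series u 0 = 0.
Proof. by rewrite seriesEnat /= big_nil. Qed.

Lemma nneg_series_cvg (u : nat -> R) (B : R) : (forall n, 0 <= u n) ->
  (forall n, series u n <= B) -> cvgn (series u).
Proof.
move=> u0 uB; apply: nondecreasing_is_cvgn.
  by apply: nondecreasing_series => k _ _.
by exists B => _ [n _ <-].
Qed.

Lemma nneg_series_le (u : nat -> R) n : (forall n, 0 <= u n) ->
  cvgn (series u) -> series u n <= limn (series u).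
Proof.
move=> u0 uc; apply: nondecreasing_cvgn_le => //.
by apply: nondecreasing_series => k _ _.
Qed.

Definition abs_summable (V : normedModType C) (u : nat -> V) :=
  cvgn (series (fun n => rnorm (u n))).

Lemma ler_rnorm_series (V : normedModType C) (u : nat -> V) n :
  rnorm (series u n) <= series (fun n => rnorm (u n)) n.
Proof. by rewrite !seriesEnat /= rnorm_sum. Qed.

Lemma ReD (z w : C) : complex.Re (z + w) = complex.Re z + complex.Re w.
Proof. by case: z w => [a b] [c d]. Qed.
Lemma ImD (z w : C) : complex.Im (z + w) = complex.Im z + complex.Im w.
Proof. by case: z w => [a b] [c d]. Qed.

(** The real and the imaginary part are additive and dominated by the modulus, so absolute
    convergence in [R] applies to each. *)
Lemma abs_summable_cvg (u : nat -> C) : abs_summable u ->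
  series u @ \oo --> limn (series u).
Proof.
move=> us.
have comp (f : C -> R) : f 0 = 0 -> {morph f : x y / x + y} ->
    (forall z, `|f z| <= rnorm z) -> cvgn (f \o series u).
  move=> f0 fD fle.
  have -> : f \o series u = series (f \o u).
    apply/funext => n /=; elim: n => [|n IH]; first by rewrite !series0.
    by rewrite !seriesS fD IH.
  apply: normed_cvg; apply: series_le_cvg us => n //=; first exact: rnorm_ge0.
have /cvg_ex[/= a ua] := comp _ erefl ReD ler_norm_Re.
have /cvg_ex[/= b ub] := comp _ erefl ImD ler_norm_Im.
have h : series u @ \oo --> ((a +i* b)%C : C) by exact: cvg_ReIm ua ub.
by have -> : limn (series u) = (a +i* b)%C by apply: (cvg_lim _ h); exact: norm_hausdorff.
Qed.

Lemma sq_summable_le (V : normedModType C) (u : nat -> V) B :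
  (forall n, series (fun n => rnorm (u n) ^+ 2) n <= B) -> sq_summable u.
Proof. by move=> uB; apply: nneg_series_cvg uB => n; rewrite sqr_ge0. Qed.

Lemma sq_summable_mul (V W : normedModType C) (u : nat -> V) (v : nat -> W) :
  sq_summable u -> sq_summable v -> cvgn (series (fun n => rnorm (u n) * rnorm (v n))).
Proof.
rewrite /sq_summable => us vs.
have : cvgn (series (fun n => rnorm (u n) ^+ 2 + rnorm (v n) ^+ 2)).
  have -> : series (fun n => rnorm (u n) ^+ 2 + rnorm (v n) ^+ 2) =
     series (fun n => rnorm (u n) ^+ 2) \+ series (fun n => rnorm (v n) ^+ 2).
    by apply/funext => n; rewrite /= !seriesEnat /= big_split.
  exact: is_cvgD.
apply: series_le_cvg => n.
- by rewrite mulr_ge0 ?rnorm_ge0.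
- by rewrite addr_ge0 ?sqr_ge0.
- have := rnorm_ge0 (u n); have := rnorm_ge0 (v n).
  have := sqr_ge0 (rnorm (u n) - rnorm (v n)); nra.
Qed.

Lemma sq_summable_ip (H : hilbert R) (u v : nat -> H) :
  sq_summable u -> sq_summable v -> abs_summable (fun n => ip (u n) (v n) : C).
Proof.
move=> us vs; apply: series_le_cvg (sq_summable_mul us vs) => n.
- exact: rnorm_ge0.
- by rewrite mulr_ge0 ?rnorm_ge0.
- exact: ip_CS.
Qed.

Lemma series_tail_small (u : nat -> R) : (forall n, 0 <= u n) -> cvgn (series u) ->
  forall e, 0 < e -> exists N, forall m n, (N <= m <= n)%N -> series u n - series u m < e.
Proof.
move=> u0 /cvg_ex[/= l /cvgrPdist_lt ul] e e0.
have e2 : 0 < e / 2 by rewrite divr_gt0.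
have [N _ NP] := ul _ e2; exists N => m n /andP[Nm mn].
have := NP _ Nm; have := NP _ (leq_trans Nm mn) => /=.
by rewrite !ltr_norml => /andP[? ?] /andP[? ?]; lra.
Qed.

End RealNormLimits.

(** * Hilbert spaces from complete inner product spaces *)

Section PreHilbert.
Variable R : realType.
Local Notation C := (cpx R).

(* A complete inner product space presented on a bare lmodType; hilbert_of equips it
   with the norm structure expected by the type hilbert. *)
Record preHilbert := PreHilbert {
  pcar : lmodType C;
  pform : pcar -> pcar -> C;
  pformL : forall y, scalar (pform^~ y);
  pformC : forall x y, pform x y = (pform y x)^*;
  pform_ge0 : forall x, 0 <= pform x x;
  pform_eq0 : forall x, pform x x = 0 -> x = 0;
  pform_complete : forall u : nat -> pcar,
    (forall e : R, 0 < e -> exists N, forall m n, (N <= m)%N -> (N <= n)%N ->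
       cre (pform (u m - u n) (u m - u n)) < e) ->
    exists l, forall e : R, 0 < e -> exists N, forall n, (N <= n)%N ->
       cre (pform (l - u n) (l - u n)) < e }.

Definition hcarrier (P : preHilbert) : Type := pcar P.
HB.instance Definition _ P := GRing.Lmodule.on (hcarrier P).

Section Instances.
Variable P : preHilbert.
Local Notation V := (hcarrier P).
Implicit Types x y z : V.

Definition hipf : V -> V -> C := @pform P.
Local Notation "<| x , y |>" := (hipf x y).

Lemma hipfDl x y z : <|x + y, z|> = <|x, z|> + <|y, z|>.
Proof. by have := @pformL P z 1 x y; rewrite scale1r mul1r. Qed.
Lemma hipf0l z : <|0, z|> = 0.
Proof. by apply: (addrI <|0, z|>); rewrite -hipfDl !addr0. Qed.
Lemma hipfZl a x z : <|a *: x, z|> = a * <|x, z|>.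
Proof.
rewrite -[X in hipf X z]addr0 -[RHS]addr0 -[in RHS](hipf0l z).
exact: (@pformL P z a x 0).
Qed.
Lemma hipfC x y : <|x, y|> = <|y, x|>^*.
Proof. exact: pformC. Qed.
Lemma hipfDr x y z : <|z, x + y|> = <|z, x|> + <|z, y|>.
Proof. by rewrite hipfC hipfDl rmorphD (hipfC z x) (hipfC z y). Qed.
Lemma hipfZr a x z : <|z, a *: x|> = a^* * <|z, x|>.
Proof. by rewrite hipfC hipfZl rmorphM (hipfC z x). Qed.

Definition hsq x : R := cre <|x, x|>.
Lemma hipfxx x : <|x, x|> = ((hsq x)%:C)%C.
Proof. by rewrite /hsq /cre (@RRe_real R) // realE pform_ge0. Qed.
Lemma hsq_ge0 x : 0 <= hsq x.
Proof. by rewrite -lecR -hipfxx; exact: pform_ge0. Qed.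
Definition hnorm x : R := Num.sqrt (hsq x).
Lemma hnorm_ge0 x : 0 <= hnorm x. Proof. exact: sqrtr_ge0. Qed.
Lemma sqr_hnorm x : hnorm x ^+ 2 = hsq x.
Proof. by rewrite sqr_sqrtr ?hsq_ge0. Qed.

Lemma hsqD x y : hsq (x + y) = hsq x + hsq y + 2 * cre <|x, y|>.
Proof.
rewrite /hsq hipfDl !hipfDr !creD.
have -> : cre <|y, x|> = cre <|x, y|> by rewrite hipfC creC.
ring.
Qed.

Lemma hsqZ a x : hsq (a *: x) = rnorm a ^+ 2 * hsq x.
Proof.
rewrite {1}/hsq hipfZl hipfZr mulrA -normCK cabsE -rmorphXn /=.
by rewrite creR.
Qed.

Lemma hnormZ a x : hnorm (a *: x) = rnorm a * hnorm x.
Proof.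
by rewrite /hnorm hsqZ sqrtrM ?sqr_ge0 // sqrtr_sqr ger0_norm ?rnorm_ge0.
Qed.

Lemma hnorm_eq0 x : hnorm x = 0 -> x = 0.
Proof.
move=> /(congr1 (fun r => r ^+ 2)); rewrite sqr_hnorm expr0n /= => x0.
by apply: pform_eq0; rewrite -[pform _ _]/(hipf x x) hipfxx x0.
Qed.

(** Expanding the square of |y| x - |x| y gives the inequality multiplied by 2 |x| |y|, hence the
    separate treatment of zero norms. *)
Lemma hCS x y : cre <|x, y|> <= hnorm x * hnorm y.
Proof.
have [s0 t0] := (hnorm_ge0 x, hnorm_ge0 y).
have key := hsq_ge0 (((hnorm y)%:C)%C *: x + ((- hnorm x)%:C)%C *: y).
rewrite hsqD !hsqZ -!sqr_hnorm hipfZl hipfZr in key.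
rewrite !rnorm_real normrN !ger0_norm // in key.
have E : ((- hnorm x)%:C%C : C)^* = ((- hnorm x)%:C)%C by exact: (@conjc_real R (- hnorm x)).
rewrite E !creR in key.
have [x0|x0] := eqVneq (hnorm x) 0.
  by rewrite x0 (hnorm_eq0 x0) hipf0l mul0r.
have [y0|y0] := eqVneq (hnorm y) 0.
  by rewrite y0 (hnorm_eq0 y0) mulr0 hipfC hipf0l rmorph0.
have p : 0 < hnorm x * hnorm y by rewrite mulr_gt0 // lt_def ?x0 ?y0.
rewrite -(ler_pM2l p); nra.
Qed.

Definition hnormc x : C := ((hnorm x)%:C)%C.

Lemma hnormcD x y : hnormc (x + y) <= hnormc x + hnormc y.
Proof.
rewrite /hnormc -rmorphD lecR -(@ler_pXn2r _ 2) ?nnegrE ?addr_ge0 ?hnorm_ge0 //.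
rewrite sqr_hnorm hsqD -!sqr_hnorm; have := hCS x y; nra.
Qed.
Lemma hnormcZ a x : hnormc (a *: x) = `|a| * hnormc x.
Proof. by rewrite /hnormc hnormZ cabsE rmorphM. Qed.
Lemma hnormc_eq0 x : hnormc x = 0 -> x = 0.
Proof. by move=> /(congr1 (@complex.Re R)) /= /hnorm_eq0. Qed.

HB.instance Definition _ :=
  Lmodule_isNormed.Build C V hnormcD hnormcZ hnormc_eq0.

Lemma rnorm_hnorm x : rnorm x = hnorm x.
Proof. by []. Qed.

(** [pform_complete] speaks of sequences, the library of filters. The centres [x n] of balls of
    radius 1/(n+1) that belong to F form a Cauchy sequence, since two members of a proper filter
    meet; F converges to its limit. *)
Lemma hcauchy (F : set_system V) : ProperFilter F -> cauchy F -> cvg F.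
Proof.
move=> FF /cauchyP Fc.
have xP n : exists x : V, F [set y | rnorm (y - x) < n.+1%:R^-1].
  have n0 : (0 : C) < ((n.+1%:R^-1 : R)%:C)%C by rewrite ltcR invr_gt0.
  have [x xF] := Fc _ n0; exists x; apply: filterS xF => y.
  by rewrite -ball_normE /= -normrN opprB rnormE ltcR.
have [x xF] := choice xP.
have close m n : rnorm (x m - x n) < m.+1%:R^-1 + n.+1%:R^-1.
  have [z [/= zm zn]] := filter_ex (filterI (xF m) (xF n)).
  rewrite -(subrKA z) (le_lt_trans (rnormD _ _)) // ltrD //.
  by rewrite rnormB.
have small e : 0 < e -> exists N, forall n, (N <= n)%N -> n.+1%:R^-1 < e :> R.
  move=> e0; have [N] := ltr_add_invr e0; rewrite add0r => NP; exists N => n Nn.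
  by apply: le_lt_trans NP; rewrite lef_pV2 ?posrE // ler_nat.
have [e e0|l lP] := @pform_complete P x.
  (* [pform_complete] measures squared distances: a distance below both 1 and e has its square below
     e. *)
  have e1 : 0 < Num.min 1 e / 2 by rewrite divr_gt0 // lt_min ltr01.
  have [N NP] := small _ e1; exists N => m n /NP Nm /NP Nn.
  rewrite -[cre _]/(hsq (x m - x n)) -sqr_hnorm -rnorm_hnorm.
  have := lt_trans (close m n) (ltrD Nm Nn); rewrite -splitr lt_min => /andP[h1 he].
  by rewrite expr2 (le_lt_trans _ he) // ler_piMl ?rnorm_ge0 // ltW.
apply/cvg_ex; exists l; apply/(@cvg_rnormP _ _ _ F _ id) => e e0.
have e2 : 0 < e / 2 by rewrite divr_gt0.
have e2' : 0 < (e / 2) ^+ 2 by rewrite exprn_gt0.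
have [N1 N1P] := lP _ e2'; have [N2 N2P] := small _ e2.
pose n := maxn N1 N2.
apply: filterS (xF n) => y /= yn.
rewrite -(subrKA (x n)) (le_lt_trans (rnormD _ _)) // [ltRHS]splitr ltrD //.
  rewrite -(@ltr_pXn2r _ 2) ?nnegrE ?rnorm_ge0 ?ltW // rnorm_hnorm sqr_hnorm.
  exact: N1P (leq_maxl _ _).
by rewrite rnormB (lt_trans yn) // N2P // leq_maxr.
Qed.

HB.instance Definition _ := Uniform_isComplete.Build V hcauchy.

Lemma hipf_zmodl y : zmod_morphism (hipf^~ y).
Proof. by move=> a b; rewrite hipfDl -scaleN1r hipfZl mulN1r. Qed.
Lemma hipf_zmodr x : zmod_morphism (hipf x).
Proof. by move=> a b; rewrite hipfDr -scaleN1r hipfZr rmorphN1 mulN1r. Qed.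
HB.instance Definition _ := @isBilinear.Build C V V C *%R (Num.conj \; *%R) hipf
  hipf_zmodl hipf_zmodr (fun y a x => hipfZl a x y) (fun y a x => hipfZr a x y).
Lemma hipf_herm x y : hipf x y = (-1) ^+ false * Num.conj (hipf y x).
Proof. by rewrite expr0 mul1r -hipfC. Qed.
HB.instance Definition _ := @isHermitianSesquilinear.Build C V false Num.conj hipf hipf_herm.
Lemma hipf_pos x : x != 0 -> 0 < hipf x x.
Proof.
move=> x0; rewrite lt_def; apply/andP; split; last exact: pform_ge0.
by apply: contra x0 => /eqP /pform_eq0 ->.
Qed.
HB.instance Definition _ := @isDotProduct.Build C V hipf hipf_pos.

Lemma hipf_norm x : hipf x x = `|x| ^+ 2.
Proof. by rewrite hipfxx -sqr_hnorm rmorphXn. Qed.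

Definition hilbert_of : hilbert R := @Hilbert R V hipf hipf_norm.

End Instances.
End PreHilbert.

(** * Square-summable sequences *)

Section SquareSummable.
Variable R : realType.
Local Notation C := (cpx R).

(** The form s^2 A + t^2 B + 2 s t X is a sum of squares. At s = B, t = - X it equals B (A B - X^2);
    if B = 0 and X were nonzero, s = 1 and t = - (A + 1) / (2 X) would give -1. *)
Lemma sum_CS (I : Type) (r : seq I) (P : pred I) (a b : I -> R) :
  (\sum_(i <- r | P i) a i * b i) ^+ 2 <=
  (\sum_(i <- r | P i) a i ^+ 2) * (\sum_(i <- r | P i) b i ^+ 2).
Proof.
set A := \sum_(i <- r | P i) a i ^+ 2; set B := \sum_(i <- r | P i) b i ^+ 2.
set X := \sum_(i <- r | P i) _.
have A0 : 0 <= A by apply: sumr_ge0 => i _; rewrite sqr_ge0.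
have B0 : 0 <= B by apply: sumr_ge0 => i _; rewrite sqr_ge0.
have key s t : 0 <= s ^+ 2 * A + t ^+ 2 * B + 2 * s * t * X.
  rewrite /A /B /X !mulr_sumr -!big_split /=; apply: sumr_ge0 => i _.
  have := sqr_ge0 (s * a i + t * b i); nra.
have [B1|B1] := eqVneq B 0.
  have [->|X0] := eqVneq X 0; first by rewrite expr0n mulr_ge0.
  have := key 1 (- (A + 1) / (2 * X)); rewrite B1.
  have -> : 2 * 1 * (- (A + 1) / (2 * X)) * X = - (A + 1).
    by field; exact: X0.
  by nra.
have B2 : 0 < B by rewrite lt_def B1.
rewrite -(ler_pM2l B2); have := key B (- X); nra.
Qed.

Lemma sum_CS_sqrt (I : Type) (r : seq I) (P : pred I) (a b : I -> R) :
  \sum_(i <- r | P i) a i * b i <=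
  Num.sqrt (\sum_(i <- r | P i) a i ^+ 2) * Num.sqrt (\sum_(i <- r | P i) b i ^+ 2).
Proof.
have A0 : 0 <= \sum_(i <- r | P i) a i ^+ 2 by apply: sumr_ge0 => i _; rewrite sqr_ge0.
have B0 : 0 <= \sum_(i <- r | P i) b i ^+ 2 by apply: sumr_ge0 => i _; rewrite sqr_ge0.
rewrite -sqrtrM // (le_trans (ler_norm _)) // -sqrtr_sqr.
by rewrite ler_wsqrtr // sum_CS.
Qed.

Definition csum (u : nat -> C) : C := limn (series u).
Definition nsq (V : normedModType C) (x : nat -> V) : R :=
  limn (series (fun n => rnorm (x n) ^+ 2)).

Lemma csum_eq (u : nat -> C) (l : C) : series u @ \oo --> l -> csum u = l.
Proof. by move=> ul; apply: (cvg_lim _ ul); exact: norm_hausdorff. Qed.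

Lemma cvg_series_lin (u v : nat -> C) (a l m : C) :
  series u @ \oo --> l -> series v @ \oo --> m ->
  series (fun n => a * u n + v n) @ \oo --> (a * l + m : C).
Proof.
move=> ul vm.
have -> : series (fun n => a * u n + v n) = series (a *: u) \+ series v.
  by apply/funext => n /=; rewrite !seriesEnat /= big_split.
apply: cvgD; last exact: vm.
rewrite seriesZ; exact: cvgZl_tmp ul.
Qed.

Lemma cvg_realC (u : nat -> R) (l : R) : u @ \oo --> l ->
  (fun n => ((u n)%:C)%C : C) @ \oo --> ((l%:C)%C : C).
Proof.
move=> /cvgrPdist_lt ul; apply/cvgn_rnormP => e /ul [N _ NP]; exists N => n Nn.
by rewrite -rmorphB rnorm_real; exact: NP.
Qed.

Section Sums.
Variable V : normedModType C.
Implicit Types x y : nat -> V.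

Lemma nsq_ge x n : sq_summable x -> series (fun n => rnorm (x n) ^+ 2) n <= nsq x.
Proof. by move=> xs; apply: nneg_series_le xs => k; rewrite sqr_ge0. Qed.

Lemma nsq_ge0 x : sq_summable x -> 0 <= nsq x.
Proof. by move=> /(nsq_ge 0); rewrite series0. Qed.

Lemma nsq_le x B : sq_summable x ->
  (forall n, series (fun n => rnorm (x n) ^+ 2) n <= B) -> nsq x <= B.
Proof. by move=> xs xB; apply: limr_le => //; exists 0. Qed.

Lemma nsq_coord x n : sq_summable x -> rnorm (x n) ^+ 2 <= nsq x.
Proof.
move=> xs; apply: le_trans (nsq_ge n.+1 xs); rewrite seriesS lerDr.
by rewrite seriesEnat; apply: sumr_ge0 => i _; rewrite sqr_ge0.
Qed.

Lemma sq_summable0 : sq_summable (fun=> 0 : V).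
Proof.
apply: (@sq_summable_le _ _ _ 0) => n; rewrite seriesEnat /= big1 // => i _.
by rewrite rnorm0 expr0n.
Qed.

Lemma sq_summableZ a x : sq_summable x -> sq_summable (fun n => a *: x n).
Proof.
move=> xs; apply: (@sq_summable_le _ _ _ (rnorm a ^+ 2 * nsq x)) => n.
have -> : series (fun n => rnorm (a *: x n) ^+ 2) n =
  rnorm a ^+ 2 * series (fun n => rnorm (x n) ^+ 2) n.
  by rewrite !seriesEnat /= mulr_sumr; apply: eq_bigr => i _; rewrite rnormZ exprMn.
by rewrite ler_wpM2l ?sqr_ge0 // nsq_ge.
Qed.

Lemma sq_summableD x y : sq_summable x -> sq_summable y ->
  sq_summable (fun n => x n + y n).
Proof.
move=> xs ys; apply: (@sq_summable_le _ _ _ (2 * nsq x + 2 * nsq y)) => n.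
apply: le_trans (lerD (ler_wpM2l _ (nsq_ge n xs)) (ler_wpM2l _ (nsq_ge n ys))) => //.
rewrite !seriesEnat /= !mulr_sumr -big_split /=; apply: ler_sum => i _.
have := rnormD (x i) (y i); have := rnorm_ge0 (x i + y i).
have := sqr_ge0 (rnorm (x i) - rnorm (y i)); nra.
Qed.

Lemma cvg_rnorm (T : Type) (F : set_system T) {FF : Filter F} (u : T -> V) (l : V) :
  u @ F --> l -> (fun t => rnorm (u t)) @ F --> rnorm l.
Proof.
move=> /cvg_rnormP ul; apply/cvgrPdist_lt => e /ul; apply: filterS => t /=.
apply: le_lt_trans; rewrite ler_norml ler_rnormB andbT lerNl opprB.
by rewrite rnormB ler_rnormB.
Qed.

End Sums.

Lemma cauchy_rnorm_cvg (V : completeNormedModType C) (u : nat -> V) :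
  (forall e : R, 0 < e -> exists N, forall m n, (N <= m)%N -> (N <= n)%N ->
     rnorm (u m - u n) < e) -> exists l : V, u @ \oo --> l.
Proof.
move=> uc; suff /cauchy_cvgP/cvg_ex[/= l ul] : cauchy (u @ \oo) by exists l.
apply: cauchy_exP => e e0.
have er : e \is Num.real by rewrite realE ltW.
have E : e = ((cre e)%:C)%C := esym (@RRe_real R e er).
have e1 : 0 < cre e by rewrite -ltcR -E.
have [N NP] := uc _ e1.
exists (u N), N => // n /= Nn.
by rewrite -ball_normE /= rnormE E ltcR; exact: NP.
Qed.

Section Bounds.
Variables H K : hilbert R.

Lemma bop_bound (T : bop H K) : exists2 c, 0 <= c & forall x, rnorm (T x) <= c * rnorm x.
Proof.
have [_ [c cP]] := bopP T; exists `|c| => // x.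
by rewrite (le_trans (cP x)) // ler_wpM2r ?rnorm_ge0 // ler_norm.
Qed.

Lemma sq_summable_bop (T : bop H K) (x : nat -> H) :
  sq_summable x -> sq_summable (fun n => T (x n)).
Proof.
move=> xs; have [c c0 cP] := bop_bound T.
apply: (@sq_summable_le _ _ _ (c ^+ 2 * nsq x)) => n.
apply: le_trans (ler_wpM2l _ (nsq_ge n xs)); last by rewrite sqr_ge0.
rewrite !seriesEnat /= mulr_sumr; apply: ler_sum => i _.
by rewrite -exprMn lerXn2r ?nnegrE ?mulr_ge0 ?rnorm_ge0.
Qed.

Lemma csum_ip_cvg (x y : nat -> H) : sq_summable x -> sq_summable y ->
  series (fun n => ip (x n) (y n) : C) @ \oo --> csum (fun n => ip (x n) (y n)).
Proof. by move=> xs ys; apply: abs_summable_cvg; exact: sq_summable_ip. Qed.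

Lemma series_ip_le (x y : nat -> H) n : sq_summable x -> sq_summable y ->
  series (fun n => rnorm (x n) * rnorm (y n)) n <= Num.sqrt (nsq x) * Num.sqrt (nsq y).
Proof.
move=> xs ys; rewrite seriesEnat (le_trans (sum_CS_sqrt _ _ _ _)) //.
have := nsq_ge n xs; have := nsq_ge n ys; rewrite !seriesEnat => hy hx.
by rewrite ler_pM ?sqrtr_ge0 // ler_wsqrtr.
Qed.

Lemma csum_ip_le (x y : nat -> H) : sq_summable x -> sq_summable y ->
  rnorm (csum (fun n => ip (x n) (y n))) <= Num.sqrt (nsq x) * Num.sqrt (nsq y).
Proof.
move=> xs ys; apply: (cvg_rnorm_le (csum_ip_cvg xs ys)).
near=> n; rewrite (le_trans (ler_rnorm_series _ _)) // (le_trans _ (series_ip_le n xs ys)) //.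
by rewrite !seriesEnat; apply: ler_sum => i _; exact: ip_CS.
Unshelve. all: by end_near. Qed.

Lemma csum_ip_lin a (x y z : nat -> H) : sq_summable x -> sq_summable y -> sq_summable z ->
  csum (fun n => ip (a *: x n + y n) (z n)) =
  a * csum (fun n => ip (x n) (z n)) + csum (fun n => ip (y n) (z n)).
Proof.
move=> xs ys zs; apply: csum_eq.
have -> : (fun n => ip (a *: x n + y n) (z n)) =
    (fun n => a * ip (x n) (z n) + ip (y n) (z n)).
  by apply/funext => n; rewrite ipDl ipZl.
by apply: cvg_series_lin; exact: csum_ip_cvg.
Qed.

Lemma csum_ipxx (x : nat -> H) : sq_summable x ->
  csum (fun n => ip (x n) (x n)) = ((nsq x)%:C)%C.
Proof.
move=> xs; apply: csum_eq.
have -> : series (fun n => ip (x n) (x n)) =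
   (fun n => ((series (fun n => rnorm (x n) ^+ 2) n)%:C)%C : C).
  apply/funext => n; rewrite !seriesEnat /= rmorph_sum /=.
  by apply: eq_bigr => i _; rewrite /ip hformP rnormE -rmorphXn.
exact: cvg_realC.
Qed.

Lemma nsq_bop (T : bop H K) (x : nat -> H) c : 0 <= c ->
  (forall z, rnorm (T z) <= c * rnorm z) -> sq_summable x ->
  nsq (fun n => T (x n)) <= c ^+ 2 * nsq x.
Proof.
move=> c0 cP xs; apply: nsq_le => [|n]; first exact: sq_summable_bop.
apply: le_trans (ler_wpM2l _ (nsq_ge n xs)); last by rewrite sqr_ge0.
rewrite !seriesEnat /= mulr_sumr; apply: ler_sum => i _.
by rewrite -exprMn lerXn2r ?nnegrE ?mulr_ge0 ?rnorm_ge0.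
Qed.
End Bounds.
End SquareSummable.

(** * Gram-Schmidt and extension by density *)

Section Geometry.
Variables (R : realType).
Local Notation C := (cpx R).
Implicit Types H K X Y : hilbert R.

Lemma ip_suml H (I : Type) (r : seq I) (P : pred I) (F : I -> H) y :
  ip (\sum_(i <- r | P i) F i) y = \sum_(i <- r | P i) ip (F i) y.
Proof.
apply: (big_morph (fun x => ip x y)) => [u v|]; first exact: ipDl.
exact: ip0x.
Qed.

Lemma ip_sumr H (I : Type) (r : seq I) (P : pred I) (F : I -> H) y :
  ip y (\sum_(i <- r | P i) F i) = \sum_(i <- r | P i) ip y (F i).
Proof.
apply: (big_morph (fun x => ip y x)) => [u v|]; first exact: ipDr.
exact: ipx0.
Qed.

Lemma bopD H K (T : bop H K) x y : T (x + y) = T x + T y.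
Proof. by have := bop_linear T 1 x y; rewrite !scale1r. Qed.

Lemma bopN H K (T : bop H K) x : T (- x) = - T x.
Proof. by rewrite -scaleN1r bopZ scaleN1r. Qed.

Lemma bop_sum H K (T : bop H K) (I : Type) (r : seq I) (P : pred I) (F : I -> H) :
  T (\sum_(i <- r | P i) F i) = \sum_(i <- r | P i) T (F i).
Proof. by apply: (big_morph T) => [u v|]; [exact: bopD|exact: bop0]. Qed.

Lemma ipxx H (x : H) : ip x x = ((rnorm x ^+ 2)%:C)%C.
Proof. by rewrite /ip hformP rnormE -rmorphXn. Qed.

Lemma ip_ext H (y z : H) : (forall x, ip x y = ip x z) -> y = z.
Proof.
move=> yz; apply/eqP; rewrite -subr_eq0; apply/eqP/ip0r => x.
by rewrite ipDr ipNr yz subrr.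
Qed.

Lemma rnorm_sqr_sum H n (F : 'I_n -> H) : (forall i j, i != j -> ip (F i) (F j) = 0) ->
  rnorm (\sum_i F i) ^+ 2 = \sum_i rnorm (F i) ^+ 2.
Proof.
move=> F0; rewrite -ip_rnorm ip_suml.
under eq_bigr => i _.
  rewrite ip_sumr (bigD1 i) //= big1 ?addr0; last by move=> j ji; rewrite F0 // eq_sym.
  rewrite ipxx; over.
by rewrite -rmorph_sum.
Qed.

Definition orthosys H n (e : 'I_n -> H) :=
  (forall i j, i != j -> ip (e i) (e j) = 0) /\ (forall i, rnorm (e i) = 1 \/ e i = 0).

Lemma orthosys_ip H n (e : 'I_n -> H) : orthosys e ->
  forall (c : 'I_n -> C) l, ip (\sum_i c i *: e i) (e l) = c l * ip (e l) (e l).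
Proof.
move=> [e0 _] c l; rewrite ip_suml (bigD1 l) //= big1 ?addr0 ?ipZl // => i il.
by rewrite ipZl e0 // mulr0.
Qed.

Definition expands H n (e : 'I_n -> H) (x : H) := x = \sum_l ip x (e l) *: e l.

(** Induction on n: the residual r of the last vector is normalized, or replaced by 0 if it
    vanishes; in both cases r is [ip r f *: f]. *)
Lemma gram_schmidt H n (x : 'I_n -> H) : exists2 e : 'I_n -> H, orthosys e &
  forall j, expands e (x j).
Proof.
elim: n x => [|n IH] x; first by exists x; [split; case|case].
have [e eo ex] := IH (x \o lift ord_max).
have exn j : expands e (x (lift ord_max j)) := ex j.
pose r := x ord_max - \sum_l ip (x ord_max) (e l) *: e l.
have re l : ip r (e l) = 0.
  rewrite ipDl ipNl orthosys_ip //; case: eo => _ /(_ l) [e1|->].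
    by rewrite ipxx e1 expr1n mulr1 subrr.
  by rewrite !ipx0 mulr0 subrr.
have [f [fr f1 xf]] : exists f : H, [/\ (forall l, ip f (e l) = 0),
    (rnorm f = 1 \/ f = 0) & r = ip r f *: f].
  have [r0|r0] := eqVneq (rnorm r) 0.
    exists 0; split=> [l||]; first by rewrite ip0x.
      by right.
    by rewrite (rnorm_eq0 r0) scaler0.
  exists ((((rnorm r)^-1)%:C)%C *: r); split=> [l||].
  - by rewrite ipZl re mulr0.
  - by left; rewrite rnormZ rnorm_real ger0_norm ?invr_ge0 ?rnorm_ge0 // mulVf.
  - rewrite ipZr ipxx scalerA.
    have -> : (((rnorm r)^-1)%:C%C : C)^* = (((rnorm r)^-1)%:C)%C by exact: (@conjc_real R _).
    rewrite -!rmorphM /=.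
    by rewrite expr2 mulrA mulVf // mul1r mulfV // rmorph1 scale1r.
pose g i := if unlift ord_max i is Some j then e j else f.
have gl j : g (lift ord_max j) = e j by rewrite /g liftK.
have gm : g ord_max = f by rewrite /g unlift_none.
have sumg (c : 'I_n.+1 -> C) : \sum_i c i *: g i =
    \sum_l c (lift ord_max l) *: e l + c ord_max *: f.
  rewrite big_ord_recr /= gm; congr (_ + _); apply: eq_bigr => i _.
  have -> : widen_ord (leqnSn n) i = lift ord_max i by apply: val_inj; rewrite [RHS]lift_max.
  by rewrite gl.
have [eo1 eo2] := eo.
exists g; first split.
- move=> i j; case: (unliftP ord_max i) => [i'|] ->; case: (unliftP ord_max j) => [j'|] ->.
  + by rewrite (inj_eq (@lift_inj _ _)) !gl; exact: eo1.
  + by rewrite gl gm ipC fr rmorph0.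
  + by rewrite gl gm fr.
  + by rewrite eqxx.
- by move=> i; case: (unliftP ord_max i) => [i'|] ->; rewrite ?gl ?gm.
move=> j; rewrite /expands sumg; case: (unliftP ord_max j) => [i|] ->.
  rewrite gm; under eq_bigr do rewrite gl.
  rewrite -exn.
  have -> : ip (x (lift ord_max i)) f = 0.
    rewrite exn ip_suml big1 // => l _; rewrite ipZl (ipC (e l)) fr rmorph0 mulr0 //.
  by rewrite scale0r addr0.
rewrite gm; under eq_bigr do rewrite gl.
have -> : ip (x ord_max) f = ip r f.
  rewrite /r ipDl ipNl ip_suml big1 ?subr0 // => l _.
  by rewrite ipZl (ipC (e l)) fr rmorph0 mulr0.
by rewrite -xf /r addrC subrK.
Qed.

Lemma expands_parseval H n (e : 'I_n -> H) x : expands e x ->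
  rnorm x ^+ 2 = \sum_l rnorm (ip x (e l)) ^+ 2.
Proof.
move=> ex; rewrite -ip_rnorm {2}ex ip_sumr.
under eq_bigr => l _ do rewrite ipZr mulrC -normCK cabsE -rmorphXn.
by rewrite -rmorph_sum.
Qed.

Lemma orthosys_norm_le H n (e : 'I_n -> H) (c : 'I_n -> C) : orthosys e ->
  rnorm (\sum_l c l *: e l) ^+ 2 <= \sum_l rnorm (c l) ^+ 2.
Proof.
move=> [e0 e1]; rewrite rnorm_sqr_sum => [|i j ij]; last first.
  by rewrite ipZl ipZr e0 // !mulr0.
apply: ler_sum => l _; rewrite rnormZ exprMn.
by case: (e1 l) => ->; rewrite ?rnorm0 ?expr1n ?mulr1 // expr0n mulr0 sqr_ge0.
Qed.

Lemma dense_rnorm X (S : set X) : dense S -> forall (z : X) (d : R), 0 < d ->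
  exists2 s, S s & rnorm (z - s) < d.
Proof.
move=> Sd z d d0.
have dC : (0 : C) < (d%:C)%C by rewrite ltcR.
have [||s [/= zs Ss]] := Sd (ball z (d%:C)%C).
- by exists z; exact: ballxx.
- exact: ball_open.
by exists s => //; move: zs; rewrite -ball_normE /= rnormE ltcR.
Qed.

(** Continuity enters as a one-sided Lipschitz bound, which suits differences of the two sides of a
    norm inequality. *)
Lemma dense_le X (S : set X) (f : X -> R) (L : R) : dense S ->
  (forall z w, f z - f w <= L * rnorm (z - w)) -> (forall z, S z -> f z <= 0) ->
  forall z, f z <= 0.
Proof.
move=> Sd fL fS z; apply/ler_addgt0Pr => e e0; rewrite add0r.
have L0 : 0 < `|L| + 1 by rewrite ltr_wpDl.
have [s Ss zs] := dense_rnorm Sd z (divr_gt0 e0 L0).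
have := fL z s; have := fS s Ss.
have : L * rnorm (z - s) <= (`|L| + 1) * rnorm (z - s).
  by rewrite ler_wpM2r ?rnorm_ge0 // (le_trans (ler_norm _)) // lerDl.
have : (`|L| + 1) * rnorm (z - s) <= e by rewrite mulrC -ler_pdivlMr // ltW.
lra.
Qed.

Lemma dense_bop_le X Y (S : set X) (T : bop X Y) (c : R) : 0 <= c -> dense S ->
  (forall z, S z -> rnorm (T z) <= c * rnorm z) -> forall z, rnorm (T z) <= c * rnorm z.
Proof.
move=> c0 Sd TS z; rewrite -subr_le0; have [b b0 bT] := bop_bound T.
move: z; apply: (@dense_le _ S (fun z => rnorm (T z) - c * rnorm z) (b + c) Sd).
  move=> z w.
  have h1 : rnorm (T z) - rnorm (T w) <= b * rnorm (z - w).
    by rewrite (le_trans (ler_rnormB _ _)) // -bopN -bopD.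
  have h2 : c * (rnorm w - rnorm z) <= c * rnorm (z - w).
    by rewrite ler_wpM2l // rnormB ler_rnormB.
  by move: h1 h2; rewrite mulrDl mulrBr; lra.
by move=> z /TS; rewrite subr_le0.
Qed.

Lemma dense_form_le X Y (S : set X) (S' : set Y) (T : bop X Y) (c : R) : 0 <= c ->
  dense S -> dense S' ->
  (forall z w, S z -> S' w -> rnorm (ip (T z) w) <= c * rnorm z * rnorm w) ->
  forall z, rnorm (T z) <= c * rnorm z.
Proof.
move=> c0 Sd Sd' TS; apply: (dense_bop_le c0 Sd) => z Sz.
have h w : rnorm (ip (T z) w) - c * rnorm z * rnorm w <= 0.
  move: w; apply: (@dense_le _ S' _ (rnorm (T z) + c * rnorm z) Sd') => [w w'|w S'w].
    have h1 : rnorm (ip (T z) w) - rnorm (ip (T z) w') <= rnorm (T z) * rnorm (w - w').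
      by rewrite (le_trans (ler_rnormB _ _)) // -ipNr -ipDr ip_CS.
    have h2 : c * rnorm z * (rnorm w' - rnorm w) <= c * rnorm z * rnorm (w - w').
      by rewrite ler_wpM2l ?mulr_ge0 ?rnorm_ge0 // rnormB ler_rnormB.
    by move: h1 h2; rewrite mulrDl mulrBr; lra.
  by rewrite subr_le0 TS.
have [T0|T0] := eqVneq (rnorm (T z)) 0; first by rewrite T0 mulr_ge0 ?rnorm_ge0.
have T1 : 0 < rnorm (T z) by rewrite lt_def T0 rnorm_ge0.
rewrite -(ler_pM2r T1) -expr2 -ip_rnorm (le_trans (cre_norm _)) //.
by rewrite -subr_le0 h.
Qed.

Section Extension.
Variables (X Y : hilbert R) (G : X -> Y -> Prop) (c : R).
Hypotheses (c0 : 0 <= c) (Gd : dense [set z | exists w, G z w]).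
Hypothesis GL : forall a z w z' w', G z w -> G z' w' -> G (a *: z + z') (a *: w + w').
Hypothesis GB : forall z w, G z w -> rnorm w <= c * rnorm z.

(** The closure of the graph G: density of the domain makes it total, the bound [GB] makes it
    single-valued. G is a relation because a vector of the algebraic tensor product has many
    expressions as a sum of elementary tensors. *)
Let Gbar z w := forall e : R, 0 < e ->
  exists z' w', [/\ G z' w', rnorm (z - z') < e & rnorm (w - w') < e].

Let Gbar_ex z : exists w, Gbar z w.
Proof.
have pick n : exists zw : X * Y, G zw.1 zw.2 /\ rnorm (z - zw.1) < n.+1%:R^-1.
  have n0 : (0 : R) < n.+1%:R^-1 by rewrite invr_gt0.
  by have [s [w sw] zs] := dense_rnorm Gd z n0; exists (s, w).
have [s sP] := choice pick.
have small e : 0 < e -> exists N, forall n, (N <= n)%N -> n.+1%:R^-1 < e :> R.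
  move=> e0; have [N] := ltr_add_invr e0; rewrite add0r => NP; exists N => n Nn.
  by apply: le_lt_trans NP; rewrite lef_pV2 ?posrE // ler_nat.
have [e e0|w sw] := @cauchy_rnorm_cvg _ Y (fun n => (s n).2).
  have c1 : 0 < c + 1 by rewrite ltr_wpDl.
  have e1 : 0 < e / (c + 1) / 2 by rewrite !divr_gt0.
  have [N NP] := small _ e1; exists N => m n /NP Nm /NP Nn.
  have [[Gm zm] [Gn zn]] := (sP m, sP n).
  have := GB (GL (-1) Gn Gm); rewrite !scaleN1r !(addrC (- _)) => h.
  apply: (le_lt_trans h).
  have h1 : rnorm ((s m).1 - (s n).1) < e / (c + 1).
    rewrite -(subrKA z) (le_lt_trans (rnormD _ _)) // [ltRHS]splitr ltrD //.
      by rewrite rnormB (lt_trans zm).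
    exact: lt_trans zn Nn.
  apply: (@le_lt_trans _ _ ((c + 1) * rnorm ((s m).1 - (s n).1))).
    by rewrite ler_wpM2r ?rnorm_ge0 // lerDl.
  by rewrite mulrC -ltr_pdivlMr.
exists w => e e0; have [N1 N1P] := small _ e0.
have /cvgn_rnormP /(_ _ e0) [N2 N2P] := sw.
exists (s (maxn N1 N2)).1, (s (maxn N1 N2)).2; have [Gn zn] := sP (maxn N1 N2).
split=> //; last exact: N2P (leq_maxr _ _).
by rewrite (lt_trans zn) // N1P // leq_maxl.
Qed.

Let GbarL a z w z' w' : Gbar z w -> Gbar z' w' -> Gbar (a *: z + z') (a *: w + w').
Proof.
move=> zw zw' e e0.
have a1 : 0 < rnorm a + 1 by rewrite ltr_wpDl ?rnorm_ge0.
have e1 : 0 < e / (rnorm a + 1) by rewrite divr_gt0.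
have [u [v [Guv uz vw]]] := zw _ e1; have [u' [v' [Guv' uz' vw']]] := zw' _ e1.
exists (a *: u + u'), (a *: v + v'); split; first exact: GL.
  rewrite opprD addrACA -scalerBr (le_lt_trans (rnormD _ _)) // rnormZ.
  have -> : e = rnorm a * (e / (rnorm a + 1)) + e / (rnorm a + 1) by field; rewrite gt_eqF.
  by rewrite ler_ltD // ler_wpM2l ?rnorm_ge0 ?ltW.
rewrite opprD addrACA -scalerBr (le_lt_trans (rnormD _ _)) // rnormZ.
have -> : e = rnorm a * (e / (rnorm a + 1)) + e / (rnorm a + 1) by field; rewrite gt_eqF.
by rewrite ler_ltD // ler_wpM2l ?rnorm_ge0 ?ltW.
Qed.

Let GbarB z w : Gbar z w -> rnorm w <= c * rnorm z.
Proof.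
move=> zw; apply/ler_addgt0Pr => e e0.
have c1 : 0 < c + 1 by rewrite ltr_wpDl.
have e1 : 0 < e / (c + 1) by rewrite divr_gt0.
have [z' [w' [Gzw zz ww]]] := zw _ e1.
have -> : e = c * (e / (c + 1)) + e / (c + 1) by field; rewrite gt_eqF.
have h1 : rnorm w <= rnorm w' + e / (c + 1).
  by rewrite -lerBlDl (le_trans (ler_rnormB _ _)) // ltW.
have h2 : c * rnorm z' <= c * rnorm z + c * (e / (c + 1)).
  rewrite -mulrDr ler_wpM2l // -lerBlDl (le_trans (ler_rnormB _ _)) //.
  by rewrite rnormB ltW.
by have := GB Gzw; lra.
Qed.

Let Gbar_fun z w w' : Gbar z w -> Gbar z w' -> w = w'.
Proof.
move=> zw zw'; have := GbarB (GbarL (-1) zw zw').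
rewrite !scaleN1r addNr rnorm0 mulr0 => h.
have /rnorm_eq0 /eqP : rnorm (- w + w') = 0 by apply/eqP; rewrite eq_le h rnorm_ge0.
by rewrite addrC subr_eq0 eq_sym => /eqP.
Qed.

Lemma dense_extend : exists2 T : bop X Y, (forall z w, G z w -> T z = w) &
  forall z, rnorm (T z) <= c * rnorm z.
Proof.
have [T TP] := choice Gbar_ex.
have Tb : bop_set T.
  split=> [a z z'|]; first exact: Gbar_fun (TP _) (GbarL a (TP z) (TP z')).
  by exists c => z; exact: GbarB.
exists (mkbop Tb) => [z w zw|z]; last exact: GbarB.
by apply: Gbar_fun (TP z) _ => e e0; exists z, w; split=> //; rewrite subrr rnorm0.
Qed.
End Extension.

End Geometry.

(** * Sigma-weak density of self-adjoint algebras *)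

Section Bicommutant.
Variables (R : realType) (K : hilbert R).
Local Notation C := (cpx R).
Variables (A : set (bop K K)) (theta : nat -> K).

(** Sequences stand for vectors of the countable l2-sum of K, on which operators act diagonally.
    This turns a normal functional into a single vector functional. *)
Definition annih (x : nat -> K) :=
  forall S, A S -> csum (fun n => ip (S (x n)) (theta n)) = 0.

Section Annihilator.
Hypothesis thetas : sq_summable theta.

Lemma sq_summable_lin a (x y : nat -> K) : sq_summable x -> sq_summable y ->
  sq_summable (fun n => a *: x n + y n).
Proof. by move=> xs ys; apply: sq_summableD ys; exact: sq_summableZ. Qed.

Lemma csum_bop_lin (S : bop K K) a (x y : nat -> K) : sq_summable x -> sq_summable y ->
  csum (fun n => ip (S (a *: x n + y n)) (theta n)) =
  a * csum (fun n => ip (S (x n)) (theta n)) + csum (fun n => ip (S (y n)) (theta n)).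
Proof.
move=> xs ys; rewrite -csum_ip_lin //; try exact: sq_summable_bop.
by congr csum; apply/funext => n; rewrite bop_linear.
Qed.

Lemma csum_bop_le (S : bop K K) c (x : nat -> K) : 0 <= c ->
  (forall z, rnorm (S z) <= c * rnorm z) -> sq_summable x ->
  rnorm (csum (fun n => ip (S (x n)) (theta n))) <=
  c * Num.sqrt (nsq theta) * Num.sqrt (nsq x).
Proof.
move=> c0 cP xs; rewrite (le_trans (csum_ip_le (sq_summable_bop (T := S) xs) thetas)) //.
rewrite [leRHS]mulrAC ler_wpM2r ?sqrtr_ge0 //.
rewrite -(ger0_norm c0) -sqrtr_sqr -sqrtrM ?sqr_ge0 // ler_wsqrtr //.
exact: nsq_bop.
Qed.

Let l2annih : set (nat -> K) := [set x | sq_summable x /\ annih x].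

Lemma l2annih0 : l2annih 0.
Proof.
split=> [|S AS]; first exact: sq_summable0.
apply: csum_eq; apply: cvg_series0 => n.
by rewrite bop0 ip0x.
Qed.

Lemma l2annihP (a : C) (x y : nat -> K) : l2annih x -> l2annih y -> l2annih (a *: x + y).
Proof.
move=> [xs xA] [ys yA]; split=> [|S AS]; first exact: sq_summable_lin.
by rewrite (csum_bop_lin S a xs ys) xA // yA // mulr0 addr0.
Qed.

Definition l2annih_set := Linset l2annih0 l2annihP.
Local Notation V := (lsub l2annih_set).
Definition coord (x : V) : nat -> K := lval x.

Lemma coord_sum (x : V) : sq_summable (coord x).
Proof. by case: (lsetV x). Qed.
Arguments coord_sum : clear implicits.
Lemma coord_annih (x : V) : annih (coord x).
Proof. by case: (lsetV x). Qed.
Lemma coord_inj : injective coord.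
Proof. exact: val_inj. Qed.
Lemma coordB (x y : V) n : coord (x - y) n = coord x n - coord y n.
Proof. by []. Qed.

Definition l2form (x y : V) : C := csum (fun n => ip (coord x n) (coord y n)).

Lemma l2formL y : scalar (l2form^~ y).
Proof. by move=> a x x'; rewrite /l2form csum_ip_lin //; exact: coord_sum. Qed.

Lemma l2formC x y : l2form x y = (l2form y x)^*.
Proof.
apply: csum_eq.
have /cvgn_rnormP h := csum_ip_cvg (coord_sum y) (coord_sum x).
apply/cvgn_rnormP => e /h [N NP]; exists N => n /NP.
rewrite /l2form -[X in X < e -> _]rnorm_conj; congr (rnorm _ < e).
rewrite rmorphB /= !seriesEnat /= rmorph_sum; congr (_ - _).
by apply: eq_bigr => i _; rewrite [RHS]ipC.
Qed.

Lemma l2formxx x : l2form x x = ((nsq (coord x))%:C)%C.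
Proof. exact: csum_ipxx (coord_sum x). Qed.

Lemma l2form_ge0 x : 0 <= l2form x x.
Proof. by rewrite l2formxx ler0c nsq_ge0 //; exact: coord_sum. Qed.

Lemma l2form_eq0 x : l2form x x = 0 -> x = 0.
Proof.
rewrite l2formxx => /(congr1 (@complex.Re R)) /= x0.
apply: coord_inj; apply/funext => n; apply: rnorm_eq0; apply/eqP.
rewrite -sqrf_eq0 eq_le sqr_ge0 andbT -x0.
exact: nsq_coord (coord_sum x).
Qed.

Lemma cvg_series_sq (u : nat -> nat -> K) (l y : nat -> K) p :
  (forall k, u ^~ k @ \oo --> l k) ->
  (fun n => series (fun k => rnorm (u n k - y k) ^+ 2) p) @ \oo -->
  series (fun k => rnorm (l k - y k) ^+ 2) p.
Proof.
move=> ul; elim: p => [|p IH].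
  rewrite series0; under eq_fun do rewrite series0; exact: cvg_cst.
rewrite seriesS; under eq_fun do rewrite seriesS.
apply: cvgD; first exact: IH.
have h : (fun n => rnorm (u n p - y p)) @ \oo --> rnorm (l p - y p).
  apply: cvg_rnorm; apply: cvgB; [exact: ul|exact: cvg_cst].
by rewrite expr2; under eq_fun do rewrite expr2; exact: cvgM.
Qed.

(** Limits are taken coordinatewise. The Cauchy bound passes to the limit in each finite partial
    sum, uniformly in its length, which gives square summability and norm convergence; [csum_bop_le]
    makes the annihilator closed. *)
Lemma l2_complete (u : nat -> V) :
  (forall e : R, 0 < e -> exists N, forall m n, (N <= m)%N -> (N <= n)%N ->
     cre (l2form (u m - u n) (u m - u n)) < e) ->
  exists l, forall e : R, 0 < e -> exists N, forall n, (N <= n)%N ->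
     cre (l2form (l - u n) (l - u n)) < e.
Proof.
move=> uc.
have cauc k : exists l : K, (fun n => coord (u n) k) @ \oo --> l.
  apply: cauchy_rnorm_cvg => e e0.
  have e2 : 0 < e ^+ 2 by rewrite exprn_gt0.
  have [N NP] := uc _ e2; exists N => m n Nm Nn.
  rewrite -(@ltr_pXn2r _ 2) ?nnegrE ?rnorm_ge0 ?ltW //.
  apply: le_lt_trans (NP m n Nm Nn); rewrite l2formxx /cre /= -coordB.
  exact: nsq_coord (coord_sum _).
have [l ul] := choice cauc.
have close e : 0 < e -> exists N, forall n, (N <= n)%N ->
   forall p, series (fun k => rnorm (l k - coord (u n) k) ^+ 2) p <= e.
  move=> /uc [N NP]; exists N => n Nn p.
  have cv := @cvg_series_sq (fun n => coord (u n)) l (coord (u n)) p ul.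
  apply: (cvgr_to_le cv); exists N => // m /= Nm.
  apply/ltW; apply: le_lt_trans (NP m n Nm Nn); rewrite l2formxx /cre /=.
  exact: (nsq_ge p (coord_sum (u m - u n))).
have ls : sq_summable l.
  have [N NP] := close _ ltr01.
  have s1 : sq_summable (fun k => l k - coord (u N) k) := sq_summable_le (NP N (leqnn N)).
  have := sq_summableD s1 (coord_sum (u N)).
  by under [X in sq_summable X]eq_fun do rewrite subrK.
have lA : annih l.
  move=> S AS; apply: rnorm_eq0; apply/eqP; rewrite eq_le rnorm_ge0 andbT.
  have [c c0 cP] := bop_bound S.
  set b := c * Num.sqrt (nsq theta).
  have b0 : 0 <= b by rewrite mulr_ge0 ?sqrtr_ge0.
  apply/ler_addgt0Pr => e e0; rewrite add0r.
  have e1 : 0 < e / (b + 1) by rewrite divr_gt0 // ltr_wpDl.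
  have e2 : 0 < (e / (b + 1)) ^+ 2 by rewrite exprn_gt0.
  have [N /(_ N (leqnn N)) NP] := close _ e2.
  have s1 : sq_summable (fun k => l k - coord (u N) k) := sq_summable_le NP.
  have -> : csum (fun n => ip (S (l n)) (theta n)) =
            csum (fun n => ip (S (l n - coord (u N) n)) (theta n)).
    have := csum_bop_lin S (-1) (coord_sum (u N)) ls.
    rewrite (coord_annih _ AS) mulr0 add0r => <-.
    by congr csum; apply/funext => n; rewrite scaleN1r addrC.
  rewrite (le_trans (csum_bop_le c0 cP s1)) // -/b.
  have : Num.sqrt (nsq (fun k => l k - coord (u N) k)) <= e / (b + 1).
    rewrite -(ger0_norm (ltW e1)) -sqrtr_sqr ler_wsqrtr //.
    exact: nsq_le.
  move=> h; rewrite (le_trans (ler_wpM2l b0 h)) // mulrCA ler_piMr ?ltW //.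
  by rewrite ltr_pdivrMr ?ltr_wpDl // mul1r ltrDl.
pose x : V := @mklsub _ _ l2annih_set l (conj ls lA).
exists x => e e0.
have e2 : 0 < e / 2 by rewrite divr_gt0.
have [N NP] := close _ e2; exists N => n Nn.
have h := nsq_le (coord_sum (x - u n)) (NP n Nn).
rewrite l2formxx -[cre _]/(nsq (coord (x - u n))).
by rewrite (le_lt_trans h) // ltr_pdivrMr // mulrDr mulr1 ltrDl.
Qed.

Definition l2pre : preHilbert R :=
  PreHilbert l2formL l2formC l2form_ge0 l2form_eq0 l2_complete.
Definition l2perp : hilbert R := hilbert_of l2pre.
End Annihilator.
End Bicommutant.

Section SigmaWeakDensity.
Variables (R : realType) (K : hilbert R).
Local Notation C := (cpx R).
Variables (A : set (bop K K)) (theta : nat -> K).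
Hypotheses (thetas : sq_summable theta) (A1 : A (bone K)) (Aadj : self_adjoint A).
Hypothesis AM : forall S T, A S -> A T -> A (bcomp S T).

Local Notation V := (l2perp A thetas).
Local Notation W := (lsub (l2annih_set A thetas)).
Local Notation co := (fun x : V => coord (x : W)).

Let coS (x : V) : sq_summable (co x).
Proof. exact: coord_sum. Qed.
Arguments coS : clear implicits.

Let ipV (x y : V) : ip x y = csum (fun n => ip (co x n) (co y n)).
Proof. by []. Qed.

Let rnormV (x : V) : rnorm x ^+ 2 = nsq (co x).
Proof. by rewrite -ip_rnorm ipV csum_ipxx. Qed.

Let coord_le (x : V) n : rnorm (co x n) <= rnorm x.
Proof.
rewrite -(@ler_pXn2r _ 2) ?nnegrE ?rnorm_ge0 // rnormV.
exact: nsq_coord.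
Qed.

Lemma coord_proj_ex n (u : K) : exists y : V, forall x : V, ip (co x n) u = ip x y.
Proof.
apply: (@riesz _ _ (fun x : V => ip (co x n) u : C) _ (rnorm u)) => [a x y|x].
  by rewrite ipDl ipZl.
rewrite (le_trans (ip_CS _ _)) // mulrC ler_wpM2l ?rnorm_ge0 //.
Qed.

(** The adjoint of the n-th coordinate map, that is, the orthogonal projection onto the annihilator
    applied to the sequence with u in place n and 0 elsewhere. *)
Definition coord_proj n u : V := projT1 (cid (coord_proj_ex n u)).
Lemma coord_projP n u x : ip (co x n) u = ip x (coord_proj n u).
Proof. by rewrite /coord_proj; case: cid. Qed.

Let coord_proj_lin n : linear (coord_proj n).
Proof.
move=> a u v; apply: ip_ext => x.
by rewrite -coord_projP ipDr ipZr ipDr ipZr -!coord_projP.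
Qed.

Let coord_proj_le n u : rnorm (coord_proj n u) <= rnorm u.
Proof.
have [->|y0] := eqVneq (rnorm (coord_proj n u)) 0; first exact: rnorm_ge0.
have y1 : 0 < rnorm (coord_proj n u) by rewrite lt_def y0 rnorm_ge0.
rewrite -(ler_pM2l y1) -expr2 -ip_rnorm -coord_projP (le_trans (cip_CS _ _)) //.
by rewrite ler_wpM2r ?rnorm_ge0.
Qed.

Let entry_subproof m n : bop_set (fun u => co (coord_proj n u) m : K).
Proof.
split=> [a u v|]; first by rewrite coord_proj_lin.
by exists 1 => u; rewrite mul1r (le_trans (coord_le _ _)) ?coord_proj_le.
Qed.
Let entry m n : bop K K := mkbop (entry_subproof m n).

Let actV_subproof S (AS : A S) (x : V) :
  lset (l2annih_set A thetas) (fun n => S (co x n)).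
Proof.
split; first exact: sq_summable_bop.
move=> U AU; have := coord_annih (x : W) (AM AU AS).
by congr (_ = _); congr csum; apply/funext => n.
Qed.
Let actV S (AS : A S) (x : V) : V := mklsub (actV_subproof AS x).

(** The annihilator is invariant under S and under its adjoint, so the projection onto it commutes
    with the diagonal action of S. *)
Let entry_comm m n : commutant A (entry m n).
Proof.
move=> S AS; apply: bop_ext => u; rewrite !bcompE.
have : coord_proj n (S u) = actV AS (coord_proj n u).
  apply: ip_ext => x; rewrite -coord_projP.
  rewrite -adjP'.
  have -> : ip (adj S (co x n)) u = ip (actV (Aadj AS) x) (coord_proj n u).
    exact: (coord_projP n u (actV (Aadj AS) x)).
  rewrite !ipV; congr csum; apply/funext => k.
  by rewrite adjP'.
by move=> /(congr1 (fun y => co y m)).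
Qed.

(* l2perp is the orthogonal complement of A theta in l2(K).  The matrix entries of its
   projection lie in the commutant of A, so they commute with T, and T maps zeta, which
   belongs to the complement, into it. *)
Lemma bicommutant_annih (zeta : nat -> K) (T : bop K K) :
  sq_summable zeta -> annih A theta zeta -> commutant (commutant A) T ->
  csum (fun n => ip (T (zeta n)) (theta n)) = 0.
Proof.
move=> zs zA TA.
pose z : V := mklsub (conj zs zA : lset (l2annih_set A thetas) zeta).
(* [y k] and [w k] are the projections of the first k coordinates of zeta and of T zeta. T commutes
   with the matrix entries and so takes the coordinates of [y k] to those of [w k]. *)
pose y k : V := \sum_(n < k) coord_proj n (zeta n).
pose w k : V := \sum_(n < k) coord_proj n (T (zeta n)).
have coD (x x' : V) n : co (x + x') n = co x n + co x' n by [].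
have yS k : y k.+1 = y k + coord_proj k (zeta k) by exact: big_ord_recr.
have wS k : w k.+1 = w k + coord_proj k (T (zeta k)) by exact: big_ord_recr.
have Ty k m : T (co (y k) m) = co (w k) m.
  elim: k => [|k IH]; first by rewrite /y /w !big_ord0; exact: bop0.
  have hT : co (coord_proj k (T (zeta k))) m = T (co (coord_proj k (zeta k)) m).
    have := TA _ (entry_comm m k) => /(congr1 (fun U : bop K K => U (zeta k))).
    by rewrite !bcompE.
  have := bop_linear T 1 (co (y k) m) (co (coord_proj k (zeta k)) m).
  by rewrite !scale1r -coD IH -hT -coD -yS -wS.
(* The vector [w k] lies in the annihilator; its defining condition is read at the identity, by
   [A1]. *)
have T0 k : csum (fun n => ip (T (co (y k) n)) (theta n)) = 0.
  rewrite -(coord_annih (w k : W) A1).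
  by congr csum; apply/funext => n; rewrite Ty.
(* The projection fixes z, so pairing with d = z - [y N] amounts to pairing with the tail of zeta
   beyond N. Taken at d itself, this bounds the norm of d by the l2-norm of that tail. *)
have dist e : 0 < e -> exists k, rnorm (z - y k) <= e.
  move=> e0; have e2 : 0 < e ^+ 2 by rewrite exprn_gt0.
  have [N NP] := series_tail_small (fun n => sqr_ge0 (rnorm (zeta n))) zs e2.
  exists N; set d := z - y N.
  have ipd (x : V) : ip x d = csum (fun n => ip (co x n) (zeta n)) -
      series (fun n => ip (co x n) (zeta n)) N.
    rewrite ipDr ipNr ipV; congr (_ - _).
    rewrite seriesEord /y /=; elim: (N) => [|k IH]; first by rewrite !big_ord0 ipx0.
    by rewrite !big_ord_recr /= ipDr IH -coord_projP.
  have tail p : (N <= p)%N ->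
    rnorm (series (fun n => ip (co d n) (zeta n)) p - series (fun n => ip (co d n) (zeta n)) N)
    <= rnorm d * e.
    move=> Np; rewrite !seriesEnat /= (big_cat_nat (n := N)) //= addrAC subrr add0r.
    rewrite (le_trans (rnorm_sum _ _ _)) //.
    rewrite (@le_trans _ _ (\sum_(N <= i < p) rnorm (co d i) * rnorm (zeta i))) //.
      by apply: ler_sum => i _; exact: ip_CS.
    rewrite (le_trans (sum_CS_sqrt _ _ _ _)) // ler_pM ?sqrtr_ge0 //.
      rewrite -[leRHS](ger0_norm (rnorm_ge0 d)) -sqrtr_sqr ler_wsqrtr // rnormV.
      apply: le_trans (nsq_ge p (coS d)).
      rewrite seriesEnat /= (big_cat_nat (n := N) (m := 0%N) (p := p)) //= lerDr.
      by apply: sumr_ge0 => i _; rewrite sqr_ge0.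
    rewrite -[leRHS](ger0_norm (ltW e0)) -sqrtr_sqr ler_wsqrtr //.
    apply/ltW; apply: le_lt_trans (NP N p _); last by rewrite leqnn.
    by rewrite !seriesEnat /= (big_cat_nat (n := N) (m := 0%N) (p := p)) //= addrAC subrr add0r.
  have [->|d0] := eqVneq (rnorm d) 0; first exact: ltW.
  have d1 : 0 < rnorm d by rewrite lt_def d0 rnorm_ge0.
  rewrite -(ler_pM2l d1) -expr2 -ip_rnorm (le_trans (cre_norm _)) // ipd.
  apply: (@cvg_rnorm_le _ _ \oo _ C (fun p => series (fun n => ip (co d n) (zeta n)) p -
     series (fun n => ip (co d n) (zeta n)) N)).
    by apply: cvgB; [exact: csum_ip_cvg|exact: cvg_cst].
  by exists N => // p /= /tail.
have [c c0 cP] := bop_bound T.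
set b := c * Num.sqrt (nsq theta).
have b0 : 0 <= b by rewrite mulr_ge0 ?sqrtr_ge0.
apply: rnorm_eq0; apply/eqP; rewrite eq_le rnorm_ge0 andbT.
apply/ler_addgt0Pr => e e0; rewrite add0r.
have e1 : 0 < e / (b + 1) by rewrite divr_gt0 // ltr_wpDl.
have [k kP] := dist _ e1.
have -> : csum (fun n => ip (T (zeta n)) (theta n)) =
          csum (fun n => ip (T (co (z - y k) n)) (theta n)).
  have := csum_bop_lin thetas T (-1) (coS (y k)) zs.
  rewrite T0 mulr0 add0r => <-.
  by congr csum; apply/funext => n; rewrite scaleN1r addrC.
rewrite (le_trans (csum_bop_le thetas c0 cP (coS (z - y k)))) // -/b.
rewrite -rnormV sqrtr_sqr ger0_norm ?rnorm_ge0 //.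
rewrite (le_trans (ler_wpM2l b0 kP)) // mulrCA ler_piMr ?ltW //.
by rewrite ltr_pdivrMr ?ltr_wpDl // mul1r ltrDl.
Qed.
End SigmaWeakDensity.

(** * Hilbert space tensor products *)

Section Tensors.
Variables (R : realType) (H K : hilbert R) (HK : hilbert_tensor H K).
Local Notation "x '⊗' y" := (tens HK x y) (at level 40).

Lemma tensDl x x' y : (x + x') ⊗ y = x ⊗ y + x' ⊗ y.
Proof. exact: linearDl. Qed.
Lemma tensDr x y y' : x ⊗ (y + y') = x ⊗ y + x ⊗ y'.
Proof. exact: linearDr. Qed.
Lemma tensZl a x y : (a *: x) ⊗ y = a *: (x ⊗ y).
Proof. exact: linearZl_LR. Qed.
Lemma tensZr a x y : x ⊗ (a *: y) = a *: (x ⊗ y).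
Proof. exact: linearZr_LR. Qed.
Lemma tens0l y : 0 ⊗ y = 0.
Proof. by rewrite -(scale0r (0 : H)) tensZl scale0r. Qed.
Lemma tens0r x : x ⊗ 0 = 0.
Proof. by rewrite -(scale0r (0 : K)) tensZr scale0r. Qed.
Lemma tens_suml (I : Type) (r : seq I) (P : pred I) (F : I -> H) y :
  (\sum_(i <- r | P i) F i) ⊗ y = \sum_(i <- r | P i) F i ⊗ y.
Proof. by apply: (big_morph (fun x => x ⊗ y)) => [u v|]; [exact: tensDl|exact: tens0l]. Qed.
Lemma tens_sumr (I : Type) (r : seq I) (P : pred I) (F : I -> K) x :
  x ⊗ (\sum_(i <- r | P i) F i) = \sum_(i <- r | P i) x ⊗ F i.
Proof. by apply: (big_morph (fun y => x ⊗ y)) => [u v|]; [exact: tensDr|exact: tens0r]. Qed.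

Lemma rnorm_tens x y : rnorm (x ⊗ y) = rnorm x * rnorm y.
Proof.
apply/eqP; rewrite -(@eqrXn2 _ 2) ?mulr_ge0 ?rnorm_ge0 // -ip_rnorm tens_ip.
by rewrite !ipxx -rmorphM /cre /= exprMn.
Qed.

Lemma tens_expandr n m (e : 'I_n -> K) (x : 'I_m -> H) (y : 'I_m -> K) :
  (forall i, expands e (y i)) ->
  \sum_i x i ⊗ y i = \sum_l (\sum_i ip (y i) (e l) *: x i) ⊗ e l.
Proof.
move=> ey; under [in RHS]eq_bigr do rewrite tens_suml.
rewrite exchange_big /=; apply: eq_bigr => i _.
rewrite {1}(ey i) tens_sumr; apply: eq_bigr => l _.
by rewrite tensZl tensZr.
Qed.

Lemma tens_expandl n m (e : 'I_n -> H) (x : 'I_m -> H) (y : 'I_m -> K) :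
  (forall i, expands e (x i)) ->
  \sum_i x i ⊗ y i = \sum_l e l ⊗ (\sum_i ip (x i) (e l) *: y i).
Proof.
move=> ex; under [in RHS]eq_bigr do rewrite tens_sumr.
rewrite exchange_big /=; apply: eq_bigr => i _.
rewrite {1}(ex i) tens_suml; apply: eq_bigr => l _.
by rewrite tensZl tensZr.
Qed.

Lemma rnorm_tens_sumr n (e : 'I_n -> K) (x : 'I_n -> H) : orthosys e ->
  rnorm (\sum_l x l ⊗ e l) ^+ 2 = \sum_l (rnorm (x l) * rnorm (e l)) ^+ 2.
Proof.
move=> [e0 _]; rewrite rnorm_sqr_sum => [|i j ij].
  by apply: eq_bigr => l _; rewrite rnorm_tens.
by rewrite tens_ip e0 // mulr0.
Qed.

Lemma rnorm_tens_suml n (e : 'I_n -> H) (y : 'I_n -> K) : orthosys e ->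
  rnorm (\sum_l e l ⊗ y l) ^+ 2 = \sum_l (rnorm (e l) * rnorm (y l)) ^+ 2.
Proof.
move=> [e0 _]; rewrite rnorm_sqr_sum => [|i j ij].
  by apply: eq_bigr => l _; rewrite rnorm_tens.
by rewrite tens_ip e0 // mul0r.
Qed.

(** Once the right legs form an orthogonal system, the squared norm is a sum over the left legs and
    S acts on each of them separately. *)
Lemma tens_bop_le_l (S : bop H H) c n (x : 'I_n -> H) (y : 'I_n -> K) : 0 <= c ->
  (forall z, rnorm (S z) <= c * rnorm z) ->
  rnorm (\sum_i S (x i) ⊗ y i) <= c * rnorm (\sum_i x i ⊗ y i).
Proof.
move=> c0 cS; have [e eo ey] := gram_schmidt y.
rewrite -(@ler_pXn2r _ 2) ?nnegrE ?mulr_ge0 ?rnorm_ge0 // exprMn.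
rewrite !(tens_expandr _ ey) !rnorm_tens_sumr // mulr_sumr; apply: ler_sum => l _.
rewrite -exprMn mulrA lerXn2r ?nnegrE ?mulr_ge0 ?rnorm_ge0 // ler_wpM2r ?rnorm_ge0 //.
have -> : \sum_i ip (y i) (e l) *: S (x i) = S (\sum_i ip (y i) (e l) *: x i).
  by rewrite bop_sum; apply: eq_bigr => i _; rewrite bopZ.
exact: cS.
Qed.

Lemma tens_bop_le_r (S : bop K K) c n (x : 'I_n -> H) (y : 'I_n -> K) : 0 <= c ->
  (forall z, rnorm (S z) <= c * rnorm z) ->
  rnorm (\sum_i x i ⊗ S (y i)) <= c * rnorm (\sum_i x i ⊗ y i).
Proof.
move=> c0 cS; have [e eo ex] := gram_schmidt x.
rewrite -(@ler_pXn2r _ 2) ?nnegrE ?mulr_ge0 ?rnorm_ge0 // exprMn.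
rewrite !(tens_expandl _ ex) !rnorm_tens_suml // mulr_sumr; apply: ler_sum => l _.
rewrite -exprMn mulrCA lerXn2r ?nnegrE ?mulr_ge0 ?rnorm_ge0 // ler_wpM2l ?rnorm_ge0 //.
have -> : \sum_i ip (x i) (e l) *: S (y i) = S (\sum_i ip (x i) (e l) *: y i).
  by rewrite bop_sum; apply: eq_bigr => i _; rewrite bopZ.
exact: cS.
Qed.

(** The candidate is given on sums of elementary tensors. Bounding one leg at a time, as for (1 ⊗
    U)(S ⊗ 1), lets [dense_extend] produce an operator without a separate check of
    well-definedness. *)
Lemma op_tens_ex (S : bop H H) (U : bop K K) : exists T : bop HK HK, op_tens T S U.
Proof.
have [c c0 cS] := bop_bound S; have [d d0 dU] := bop_bound U.
pose G (z w : HK) := exists n (x : 'I_n -> H) (y : 'I_n -> K),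
  z = \sum_i x i ⊗ y i /\ w = \sum_i S (x i) ⊗ U (y i).
have GL a z w z' w' : G z w -> G z' w' -> G (a *: z + z') (a *: w + w').
  move=> [n [x [y [-> ->]]]] [m [x' [y' [-> ->]]]].
  exists (n + m)%N, (fun i : 'I_(n + m) => match fintype.split i with inl j => a *: x j | inr j => x' j end),
    (fun i : 'I_(n + m) => match fintype.split i with inl j => y j | inr j => y' j end).
  rewrite !big_split_ord /= !scaler_sumr; split; congr (_ + _); apply: eq_bigr => i _.
  - by rewrite (unsplitK (inl _ i)) tensZl.
  - by rewrite (unsplitK (inr _ i)).
  - by rewrite (unsplitK (inl _ i)) bopZ tensZl.
  - by rewrite (unsplitK (inr _ i)).
have GB z w : G z w -> rnorm w <= (d * c) * rnorm z.
  move=> [n [x [y [-> ->]]]]; rewrite (le_trans (tens_bop_le_r _ _ d0 dU)) //.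
  by rewrite -mulrA ler_wpM2l // tens_bop_le_l.
have Gd : dense [set z | exists w, G z w].
  move=> O On Oo; have [z [Oz [n [x [y zE]]]]] := @tens_dense _ _ _ HK O On Oo.
  by exists z; split=> //; exists (\sum_i S (x i) ⊗ U (y i)), n, x, y.
have [T TP _] := dense_extend (mulr_ge0 d0 c0) Gd GL GB.
exists T => x y; apply: TP; exists 1%N, (fun=> x), (fun=> y).
by rewrite !big_ord1.
Qed.

Lemma tens_bop_ext (X : hilbert R) (T S : bop HK X) :
  (forall x y, T (x ⊗ y) = S (x ⊗ y)) -> T = S.
Proof.
move=> TS; apply: bop_ext => z; apply/eqP; rewrite -subr_eq0; apply/eqP/ip0r => w.
have -> : ip w (T z - S z) = ip (adj T w - adj S w) z.
  by rewrite ipDr ipNr ipDl ipNl !adjP'.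
have -> : adj T w - adj S w = 0.
  by apply: (ht_total (HK := HK)) => x y; rewrite ipDr ipNr -!adjP TS subrr.
exact: ip0x.
Qed.

End Tensors.

(** * Matrix norms and duality *)

Section MatrixNorms.
Variable R : realType.
Local Notation C := (cpx R).

(** The empty set has [sup] 0, whence the assumption on c. *)
Lemma sup_ler (S : set R) c : 0 <= c -> (forall x, S x -> x <= c) -> sup S <= c.
Proof.
move=> c0 Sc; have [->|/set0P S0] := eqVneq S set0; last exact: ge_sup.
by rewrite sup0.
Qed.

Lemma le_sup (S : set R) c x : (forall x, S x -> x <= c) -> S x -> x <= sup S.
Proof. by move=> Sc Sx; apply: ub_le_sup => //; exists c. Qed.

Lemma sup_ge0 (S : set R) : (forall x, S x -> 0 <= x) -> 0 <= sup S.
Proof.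
move=> S0; have [hS|hS] := pselect (has_sup S); last by rewrite sup_out.
by have [[x Sx] [c cP]] := hS; apply: le_trans (S0 _ Sx) _; apply: ub_le_sup => //; exists c.
Qed.

Section L2norm.
Variables (I : finType) (V : normedModType C).
Implicit Types v w : I -> V.

Lemma sum_rnorm_ge0 v : 0 <= \sum_i rnorm (v i) ^+ 2.
Proof. by apply: sumr_ge0 => i _; rewrite sqr_ge0. Qed.
Lemma l2norm_ge0 v : 0 <= l2norm v.
Proof. exact: sqrtr_ge0. Qed.
Lemma sqr_l2norm v : l2norm v ^+ 2 = \sum_i rnorm (v i) ^+ 2.
Proof. by rewrite sqr_sqrtr ?sum_rnorm_ge0. Qed.
Lemma l2norm_le v c : 0 <= c -> \sum_i rnorm (v i) ^+ 2 <= c ^+ 2 -> l2norm v <= c.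
Proof. by move=> c0 h; rewrite -(ger0_norm c0) -sqrtr_sqr ler_wsqrtr. Qed.
Lemma l2normZ a v : l2norm (fun i => a *: v i) = rnorm a * l2norm v.
Proof.
rewrite /l2norm; under eq_bigr do rewrite rnormZ exprMn.
by rewrite -mulr_sumr sqrtrM ?sqr_ge0 // sqrtr_sqr ger0_norm ?rnorm_ge0.
Qed.
Lemma l2norm_coord v i : rnorm (v i) <= l2norm v.
Proof.
rewrite -(@ler_pXn2r _ 2) ?nnegrE ?rnorm_ge0 ?l2norm_ge0 // sqr_l2norm.
by rewrite (bigD1 i) //= lerDl; apply: sumr_ge0 => j _; rewrite sqr_ge0.
Qed.
Lemma l2norm_eq0 v : l2norm v = 0 -> forall i, v i = 0.
Proof.
move=> v0 i; apply: rnorm_eq0; apply/eqP.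
by rewrite eq_le rnorm_ge0 andbT -v0 l2norm_coord.
Qed.
Lemma l2norm0 : l2norm (fun _ : I => 0 : V) = 0.
Proof.
rewrite /l2norm big1 ?sqrtr0 // => i _; by rewrite rnorm0 expr0n.
Qed.
Lemma l2normD v w : l2norm (fun i => v i + w i) <= l2norm v + l2norm w.
Proof.
apply: l2norm_le; first by rewrite addr_ge0 ?l2norm_ge0.
rewrite sqrrD !sqr_l2norm.
have cs : \sum_i rnorm (v i) * rnorm (w i) <= l2norm v * l2norm w by exact: sum_CS_sqrt.
apply: (@le_trans _ _ (\sum_i rnorm (v i) ^+ 2 + (\sum_i rnorm (v i) * rnorm (w i)) *+ 2 +
   \sum_i rnorm (w i) ^+ 2)); last by rewrite lerD2r lerD2l lerMn2r.
rewrite -sumrMnl -!big_split /=; apply: ler_sum => i _.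
by rewrite -sqrrD lerXn2r ?nnegrE ?addr_ge0 ?rnorm_ge0 // rnormD.
Qed.
End L2norm.

Lemma l2norm_sum (I : finType) (V : normedModType C) (J : Type) (r : seq J) (P : pred J)
    (v : J -> I -> V) :
  l2norm (fun i => \sum_(j <- r | P j) v j i) <= \sum_(j <- r | P j) l2norm (v j).
Proof.
elim: r => [|j r IH].
  by rewrite big_nil; under [X in l2norm X]eq_fun do rewrite big_nil; rewrite l2norm0.
rewrite big_cons; under [X in l2norm X]eq_fun do rewrite big_cons; case: (P j) => //.
by rewrite (le_trans (l2normD _ _)) // lerD2l.
Qed.

Lemma l2norm_eq (I : finType) (V W : normedModType C) (v : I -> V) (w : I -> W) :
  (forall i, rnorm (v i) = rnorm (w i)) -> l2norm v = l2norm w.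
Proof. by move=> vw; rewrite /l2norm; under eq_bigr do rewrite vw. Qed.

Lemma l2_homogeneous (I J : finType) (V W : normedModType C) (T : (I -> V) -> J -> W) c :
  (forall a v, T (fun i => a *: v i) = (fun j => a *: T v j)) ->
  (forall v, l2norm v <= 1 -> l2norm (T v) <= c) ->
  forall v, l2norm (T v) <= c * l2norm v.
Proof.
move=> TZ Tc v.
have [v0|v0] := eqVneq (l2norm v) 0.
  have T0 : T v = (fun j => 0 *: T v j).
    rewrite -TZ; congr T; apply/funext => i; rewrite scale0r; exact: l2norm_eq0.
  by rewrite T0 l2normZ rnorm0 v0 mul0r mulr0.
have v1 : 0 < l2norm v by rewrite lt_def v0 l2norm_ge0.
have := Tc (fun i => (((l2norm v)^-1)%:C)%C *: v i).
rewrite TZ !l2normZ rnorm_real ger0_norm ?invr_ge0 ?l2norm_ge0 // mulVf //.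
by move=> /(_ (lexx _)); rewrite mulrC ler_pdivrMr.
Qed.

Section Mnorm.
Variables I J : finType.
Implicit Types (A B : I -> J -> C) (xi : J -> C) (eta : I -> C).

Definition mact A xi i := \sum_j A i j * xi j.

Lemma mactZ A a xi : mact A (fun j => a *: xi j) = (fun i => a *: mact A xi i).
Proof.
apply/funext => i; rewrite /mact scaler_sumr; apply: eq_bigr => j _.
exact: mulrCA.
Qed.

Lemma mact_bound A : exists c, forall xi, l2norm xi <= 1 -> l2norm (mact A xi) <= c.
Proof.
exists (\sum_j l2norm (A^~ j)) => xi x1.
rewrite (le_trans (l2norm_sum _ _ _)) //; apply: ler_sum => j _.
have -> : (fun i => A i j * xi j) = (fun i => xi j *: A i j).
  by apply/funext => i; rewrite mulrC.
rewrite l2normZ ler_piMl ?l2norm_ge0 // (le_trans _ x1) //; exact: l2norm_coord.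
Qed.

Lemma mnormP A xi : l2norm (mact A xi) <= mnorm A * l2norm xi.
Proof.
move: xi; apply: l2_homogeneous => [a v|xi x1]; first exact: mactZ.
have [c cP] := mact_bound A; apply: (@le_sup _ c); last by exists xi.
by move=> _ [eta e1 <-]; exact: cP.
Qed.

Lemma mnorm_ge0 A : 0 <= mnorm A.
Proof. by apply: sup_ge0 => _ [xi _ <-]; exact: l2norm_ge0. Qed.

Lemma mnorm_le A c : 0 <= c -> (forall xi, l2norm (mact A xi) <= c * l2norm xi) ->
  mnorm A <= c.
Proof.
move=> c0 Ac; apply: sup_ler => // _ [xi /= x1 <-].
by rewrite (le_trans (Ac xi)) // ler_piMr.
Qed.

(** Bilinear rather than sesquilinear: conjugates are put into the test vectors where they occur. *)
Definition mform A eta xi := \sum_i \sum_j eta i * A i j * xi j.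

Lemma mformE A eta xi : mform A eta xi = \sum_i eta i * mact A xi i.
Proof.
apply: eq_bigr => i _; rewrite /mact mulr_sumr; apply: eq_bigr => j _.
by rewrite mulrA.
Qed.

Lemma mform_le A eta xi : rnorm (mform A eta xi) <= mnorm A * l2norm eta * l2norm xi.
Proof.
rewrite mformE (le_trans (rnorm_sum _ _ _)) //.
under eq_bigr do rewrite rnormM.
rewrite (le_trans (sum_CS_sqrt _ _ _ _)) // -/(l2norm eta) -/(l2norm (mact A xi)).
by rewrite (mulrC (mnorm A)) -mulrA ler_wpM2l ?l2norm_ge0 // mnormP.
Qed.

(** Testing at the conjugate of A xi turns the form into the squared norm of A xi. *)
Lemma mnorm_form_le A c : 0 <= c ->
  (forall eta xi, rnorm (mform A eta xi) <= c * l2norm eta * l2norm xi) -> mnorm A <= c.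
Proof.
move=> c0 Ac; apply: mnorm_le => // xi.
have [->|n0] := eqVneq (l2norm (mact A xi)) 0; first by rewrite mulr_ge0 ?l2norm_ge0.
have n1 : 0 < l2norm (mact A xi) by rewrite lt_def n0 l2norm_ge0.
rewrite -(ler_pM2l n1) -expr2 sqr_l2norm mulrCA mulrA.
have := Ac (fun i => (mact A xi i)^*) xi.
rewrite mformE (@l2norm_eq _ _ _ (fun i => (mact A xi i)^* : C) (mact A xi)); last first.
  by move=> i; rewrite rnorm_conj.
apply: le_trans; rewrite (le_trans _ (cre_norm _)) //.
have -> : \sum_i (mact A xi i)^* * mact A xi i = ((\sum_i rnorm (mact A xi i) ^+ 2)%:C)%C.
  by rewrite rmorph_sum; apply: eq_bigr => i _; rewrite mulrC -normCK cabsE -rmorphXn.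
by [].
Qed.

Lemma mnormD A B : mnorm (fun i j => A i j + B i j) <= mnorm A + mnorm B.
Proof.
apply: mnorm_le => [|xi]; first by rewrite addr_ge0 ?mnorm_ge0.
have -> : mact (fun i j => A i j + B i j) xi = (fun i => mact A xi i + mact B xi i).
  by apply/funext => i; rewrite /mact -big_split; apply: eq_bigr => j _; rewrite mulrDl.
by rewrite (le_trans (l2normD _ _)) // mulrDl lerD ?mnormP.
Qed.

Lemma mnorm_entry A i j : rnorm (A i j) <= mnorm A.
Proof.
have l1 (L : finType) (l : L) : l2norm (fun k => (k == l)%:R : C) = 1.
  rewrite /l2norm (bigD1 l) //= eqxx big1 ?addr0.
    by rewrite /rnorm normr1 expr1n sqrtr1.
  by move=> k /negbTE ->; rewrite rnorm0 expr0n.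
have := mform_le A (fun k => (k == i)%:R) (fun k => (k == j)%:R).
rewrite !l1 !mulr1; congr (rnorm _ <= _).
rewrite /mform (bigD1 i) //= [X in _ + X]big1 ?addr0.
  rewrite (bigD1 j) //= [X in _ + X]big1 ?addr0; first by rewrite !eqxx mul1r mulr1.
  by move=> k /negbTE ->; rewrite mulr0.
by move=> k /negbTE ->; rewrite big1 // => l _; rewrite !mul0r.
Qed.
End Mnorm.
End MatrixNorms.

(** * Matrix norms on dual spaces *)

Section DualNorms.
Variable R : realType.
Local Notation C := (cpx R).

Lemma ler_sqr_ge0 (a b : R) : 0 <= a -> a <= b -> a ^+ 2 <= b ^+ 2.
Proof. by move=> a0 ab; rewrite lerXn2r ?nnegrE // (le_trans a0). Qed.

Lemma sum_pair (V : nmodType) (I J : finType) (E : I * J -> V) :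
  \sum_p E p = \sum_i \sum_j E (i, j).
Proof. by rewrite pair_bigA; apply: eq_bigr => -[]. Qed.

Lemma sqr_l2norm_pair (V : normedModType C) (I J : finType) (v : I * J -> V) :
  l2norm v ^+ 2 = \sum_i l2norm (fun j => v (i, j)) ^+ 2.
Proof. by rewrite sqr_l2norm sum_pair; apply: eq_bigr => i _; rewrite sqr_l2norm. Qed.

Lemma l2norm_slice (V : normedModType C) (I J : finType) (v : I * J -> V) i :
  l2norm (fun j => v (i, j)) <= l2norm v.
Proof.
rewrite -(@ler_pXn2r _ 2) ?nnegrE ?l2norm_ge0 // sqr_l2norm_pair.
by rewrite (bigD1 i) //= lerDl; apply: sumr_ge0 => k _; rewrite sqr_ge0.
Qed.

Lemma exchange_big22 (V : nmodType) (I J I' J' : finType) (E : I -> J -> I' -> J' -> V) :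
  \sum_i \sum_j \sum_k \sum_l E i j k l = \sum_k \sum_l \sum_i \sum_j E i j k l.
Proof.
transitivity (\sum_(p : I * J) \sum_(q : I' * J') E p.1 p.2 q.1 q.2).
  rewrite sum_pair; apply: eq_bigr => i _; apply: eq_bigr => j _ /=.
  by rewrite sum_pair.
rewrite exchange_big sum_pair; apply: eq_bigr => k _; apply: eq_bigr => l _ /=.
by rewrite sum_pair.
Qed.

Lemma mform_pair (I J I' J' : finType) (A : I * J -> I' * J' -> C) eta xi :
  mform A eta xi = \sum_q \sum_r
    mform (fun i j => A (i, q) (j, r)) (fun i => eta (i, q)) (fun j => xi (j, r)).
Proof.
rewrite /mform sum_pair exchange_big; apply: eq_bigr => q _ /=.
rewrite [RHS]exchange_big; apply: eq_bigr => i _ /=.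
by rewrite sum_pair exchange_big.
Qed.

(** The transpose is bounded by the same norm: test the form of A at the conjugate of the transpose
    applied to eta. *)
Lemma mnormPT (I J : finType) (A : I -> J -> C) (eta : I -> C) :
  l2norm (fun j => \sum_i eta i * A i j) <= mnorm A * l2norm eta.
Proof.
set v := fun j => _.
have [->|n0] := eqVneq (l2norm v) 0; first by rewrite mulr_ge0 ?l2norm_ge0 ?mnorm_ge0.
have n1 : 0 < l2norm v by rewrite lt_def n0 l2norm_ge0.
rewrite -(ler_pM2r n1) -expr2 sqr_l2norm.
have := mform_le A eta (fun j => (v j)^*).
rewrite (@l2norm_eq _ _ _ _ (fun j => (v j)^* : C) v); last by move=> i; rewrite rnorm_conj.
apply: le_trans; rewrite (le_trans _ (cre_norm _)) //.
have -> : mform A eta (fun j => (v j)^*) = ((\sum_i rnorm (v i) ^+ 2)%:C)%C.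
  rewrite rmorph_sum /mform exchange_big; apply: eq_bigr => j _ /=.
  by rewrite -mulr_suml -normCK cabsE -rmorphXn.
by [].
Qed.

(* The part of Ruan's axioms that makes bounded functionals completely bounded. *)
Definition regular (V : mxSpace R) := [/\ forall n (X : 'M[V]_n), 0 <= mxnorm X,
  forall n (t : C) (X : 'M[V]_n), mxnorm (map_mx ( *:%R t) X : 'M[V]_n) <= rnorm t * mxnorm X &
  forall m (X : 'M[V]_m) (a b : 'I_m -> C),
    vnorm (\sum_k \sum_l (b k * a l) *: X k l) <= mxnorm X * l2norm b * l2norm a].

Definition ev (V : mxSpace R) n (F : 'I_n -> 'I_n -> V -> C) m (X : 'M[V]_m) :=
  fun p q : 'I_n * 'I_m => F p.1 q.1 (X p.2 q.2).

Definition bfam (V : mxSpace R) n (F : 'I_n -> 'I_n -> V -> C) :=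
  forall i j, bounded_functional (F i j).

Lemma scalar_sum (V : lmodType C) (f : V -> C) : scalar f ->
  forall (I : Type) (r : seq I) (P : pred I) (c : I -> C) (F : I -> V),
  f (\sum_(i <- r | P i) c i *: F i) = \sum_(i <- r | P i) c i * f (F i).
Proof.
move=> fL; have f0 : f 0 = 0 by have := fL (-1) 0 0; rewrite scaler0 addr0 mulN1r addNr.
move=> I r P c F; elim: r => [|i r IH]; first by rewrite !big_nil.
by rewrite !big_cons; case: (P i) => //; rewrite fL IH.
Qed.

Lemma scalar_sum1 (V : lmodType C) (f : V -> C) : scalar f ->
  forall (I : Type) (r : seq I) (P : pred I) (F : I -> V),
  f (\sum_(i <- r | P i) F i) = \sum_(i <- r | P i) f (F i).
Proof.
move=> fL I r P F; have := scalar_sum fL r P (fun=> 1) F.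
under eq_bigr do rewrite scale1r; by under [RHS]eq_bigr do rewrite mul1r.
Qed.

Lemma mform_ev (V : mxSpace R) n (F : 'I_n -> 'I_n -> V -> C) m (X : 'M[V]_m) eta xi :
  (forall i j, scalar (F i j)) ->
  mform (ev F X) eta xi =
  \sum_i \sum_j F i j (\sum_k \sum_l (eta (i, k) * xi (j, l)) *: X k l).
Proof.
move=> FL; rewrite /mform sum_pair; apply: eq_bigr => i _.
under eq_bigr do rewrite sum_pair.
rewrite exchange_big; apply: eq_bigr => j _ /=.
rewrite (scalar_sum1 (FL i j)); apply: eq_bigr => k _.
rewrite (scalar_sum (FL i j)); apply: eq_bigr => l _.
by rewrite /ev /= mulrAC.
Qed.

Lemma dual_mxnorm_le (V : mxSpace R) n (F : 'I_n -> 'I_n -> V -> C) c : 0 <= c ->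
  (forall m (X : 'M[V]_m), mxnorm X <= 1 -> mnorm (ev F X) <= c) -> dual_mxnorm F <= c.
Proof. by move=> c0 Fc; apply: sup_ler => // _ [m [X [X1 ->]]]; exact: Fc. Qed.

Lemma dual_mxnorm_ge0 (V : mxSpace R) n (F : 'I_n -> 'I_n -> V -> C) : 0 <= dual_mxnorm F.
Proof. by apply: sup_ge0 => _ [m [X [_ ->]]]; exact: mnorm_ge0. Qed.

Section Regular.
Variable V : mxSpace R.
Hypothesis Vr : regular V.

Lemma vnorm_ge0 (v : V) : 0 <= vnorm v.
Proof. by have [h _ _] := Vr; exact: h. Qed.

(** [dual_mxnorm] is a supremum and needs an upper bound to be meaningful. Each F i j is evaluated
    at a combination of the entries of X, whose norm the last clause of [regular] controls; the
    bounds of the finitely many entries are added. *)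
Lemma dual_bounded n (F : 'I_n -> 'I_n -> V -> C) : bfam F ->
  exists c, forall m (X : 'M[V]_m), mxnorm X <= 1 -> mnorm (ev F X) <= c.
Proof.
have [V0 _ Vc] := Vr => Fb.
have FL i j : scalar (F i j) by case: (Fb i j).
have : forall ij : 'I_n * 'I_n, exists c, forall v, rnorm (F ij.1 ij.2 v) <= c * vnorm v.
  by move=> [i j]; case: (Fb i j).
move=> /choice[c cP].
exists (\sum_ij `|c ij|) => m X X1.
have c0 : 0 <= \sum_ij `|c ij| by exact: sumr_ge0.
apply: mnorm_form_le => // eta xi; rewrite mform_ev //.
rewrite (le_trans (rnorm_sum _ _ _)) // sum_pair !mulr_suml; apply: ler_sum => i _.
rewrite (le_trans (rnorm_sum _ _ _)) // !mulr_suml; apply: ler_sum => j _.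
rewrite (le_trans (cP (i, j) _)) //.
have h := Vc m X (fun l => xi (j, l)) (fun k => eta (i, k)).
apply: (@le_trans _ _ (`|c (i, j)| *
    vnorm (\sum_k \sum_l (eta (i, k) * xi (j, l)) *: X k l))).
  by rewrite ler_wpM2r ?V0 // ler_norm.
rewrite -mulrA ler_wpM2l // (le_trans h) //.
by apply: le_trans (ler_pM (l2norm_ge0 _) (l2norm_ge0 _) (l2norm_slice eta i) (l2norm_slice xi j));
  rewrite -mulrA ler_piMl ?mulr_ge0 ?l2norm_ge0.
Qed.

Lemma dual_ub n (F : 'I_n -> 'I_n -> V -> C) m (X : 'M[V]_m) : bfam F ->
  mxnorm X <= 1 -> mnorm (ev F X) <= dual_mxnorm F.
Proof.
move=> /dual_bounded [c cP] X1; apply: (@le_sup _ _ c); last by exists m, X.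
by move=> _ [k [Y [Y1 ->]]]; exact: cP.
Qed.

Lemma ev_scale n (F : 'I_n -> 'I_n -> V -> C) m (X : 'M[V]_m) (t : C) : bfam F ->
  ev F (map_mx ( *:%R t) X) = (fun p q => t * ev F X p q).
Proof.
move=> Fb; apply/funext => p; apply/funext => q; rewrite /ev mxE.
have [FL _] := Fb p.1 q.1.
have F0 : F p.1 q.1 0 = 0 by have := FL (-1) 0 0; rewrite scaler0 addr0 mulN1r addNr.
by have := FL t (X p.2 q.2) 0; rewrite F0 !addr0.
Qed.

Lemma mnormZ (I J : finType) (A : I -> J -> C) (t : C) :
  rnorm t * mnorm A <= mnorm (fun i j => t * A i j).
Proof.
have [->|t0] := eqVneq t 0; first by rewrite rnorm0 mul0r mnorm_ge0.
have t1 : 0 < rnorm t.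
  by rewrite lt_def rnorm_ge0 andbT; apply: contra t0 => /eqP /rnorm_eq0 ->.
rewrite mulrC -ler_pdivlMr //; apply: mnorm_le => [|xi].
  by rewrite divr_ge0 ?mnorm_ge0 ?rnorm_ge0.
rewrite mulrAC ler_pdivlMr // mulrC -l2normZ; apply: le_trans (mnormP _ _).
rewrite le_eqVlt; apply/orP; left; apply/eqP; congr l2norm; apply/funext => i.
rewrite /mact scaler_sumr; apply: eq_bigr => j _; exact: mulrA.
Qed.

Lemma dual_le n (F : 'I_n -> 'I_n -> V -> C) m (X : 'M[V]_m) : bfam F ->
  mnorm (ev F X) <= dual_mxnorm F * mxnorm X.
Proof.
move=> Fb; have [V0 VZ _] := Vr.
have key (t : R) : 0 < t -> t * mxnorm X <= 1 -> t * mnorm (ev F X) <= dual_mxnorm F.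
  move=> t0 tX; have : mnorm (ev F (map_mx ( *:%R (t%:C)%C) X)) <= dual_mxnorm F.
    apply: dual_ub => //; rewrite (le_trans (VZ _ _ _)) // rnorm_real ger0_norm //.
    exact: ltW.
  apply: le_trans; rewrite ev_scale //; have := mnormZ (ev F X) (t%:C)%C.
  by rewrite rnorm_real ger0_norm // ltW.
(* If X has norm 0, all its multiples lie in the unit ball, and a large factor t forces the
   left-hand side below every e. *)
have [X0|X0] := eqVneq (mxnorm X) 0.
  rewrite X0 mulr0; apply/ler_addgt0Pr => e e0; rewrite add0r.
  have d0 : 0 <= dual_mxnorm F := dual_mxnorm_ge0 F.
  have d1 : 0 < dual_mxnorm F + 1 by rewrite ltr_wpDl.
  have := key ((dual_mxnorm F + 1) / e); rewrite X0 mulr0 ler01 divr_gt0 // => /(_ isT isT).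
  rewrite mulrAC ler_pdivrMr // => h.
  have : (dual_mxnorm F + 1) * mnorm (ev F X) <= (dual_mxnorm F + 1) * e.
    by rewrite (le_trans h) // ler_pM2r // lerDl.
  by rewrite ler_pM2l.
have X1 : 0 < mxnorm X by rewrite lt_def X0 V0.
have := key (mxnorm X)^-1; rewrite invr_gt0 X1 mulVf // lexx => /(_ isT isT).
by rewrite mulrC ler_pdivrMr.
Qed.

Definition norm1 (f : V -> C) : R := dual_mxnorm (fun _ _ : 'I_1 => f).

Lemma norm1_ge0 f : 0 <= norm1 f. Proof. exact: dual_mxnorm_ge0. Qed.

Lemma norm1P (f : V -> C) v : bounded_functional f -> rnorm (f v) <= norm1 f * vnorm v.
Proof.
move=> fb; have Fb : bfam (fun _ _ : 'I_1 => f) by [].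
apply: le_trans (dual_le (const_mx v : 'M[V]_1) Fb).
have := mnorm_entry (ev (fun _ _ : 'I_1 => f) (const_mx v : 'M[V]_1)) (ord0, ord0) (ord0, ord0).
by rewrite /ev mxE.
Qed.

(** The completely bounded norm of a functional equals its norm: the last clause of [regular]
    reduces every matrix level to a single vector. *)
Lemma norm1_le (f : V -> C) c : 0 <= c -> scalar f ->
  (forall v, rnorm (f v) <= c * vnorm v) -> norm1 f <= c.
Proof.
move=> c0 fL fc; have [V0 _ Vc] := Vr.
apply: dual_mxnorm_le => // m X X1; apply: mnorm_form_le => // eta xi.
rewrite mform_ev // !big_ord1 (le_trans (fc _)) // -mulrA ler_wpM2l //.
rewrite (le_trans (Vc _ _ _ _)) //.
by apply: le_trans (ler_pM (l2norm_ge0 _) (l2norm_ge0 _) (l2norm_slice eta ord0)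
  (l2norm_slice xi ord0)); rewrite -mulrA ler_piMl ?mulr_ge0 ?l2norm_ge0.
Qed.

Lemma dual_eq0 n (F : 'I_n -> 'I_n -> V -> C) : bfam F -> dual_mxnorm F = 0 ->
  forall i j v, F i j v = 0.
Proof.
move=> Fb F0 i j v; apply: rnorm_eq0; apply/eqP; rewrite eq_le rnorm_ge0 andbT.
have := dual_le (const_mx v : 'M[V]_1) Fb; rewrite F0 mul0r; apply: le_trans.
have := mnorm_entry (ev F (const_mx v : 'M[V]_1)) (i, ord0) (j, ord0).
by rewrite /ev mxE.
Qed.

Lemma dual_mxnormD n (F G H : 'I_n -> 'I_n -> V -> C) : bfam F -> bfam G ->
  (forall i j v, H i j v = F i j v + G i j v) ->
  dual_mxnorm H <= dual_mxnorm F + dual_mxnorm G.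
Proof.
move=> Fb Gb HE; apply: dual_mxnorm_le => [|m X X1].
  by rewrite addr_ge0 ?dual_mxnorm_ge0.
have -> : ev H X = fun p q => ev F X p q + ev G X p q.
  by apply/funext => p; apply/funext => q; exact: HE.
by rewrite (le_trans (mnormD _ _)) // lerD ?dual_ub.
Qed.

(** The scalar matrices are moved onto the test vectors: the transpose of A acts on eta and B on xi,
    slice by slice. *)
Lemma dual_mxnorm_mul m n (A : 'M[C]_(n, m)) (B : 'M[C]_(m, n))
    (F : 'I_m -> 'I_m -> V -> C) (G : 'I_n -> 'I_n -> V -> C) : bfam F ->
  (forall i j v, G i j v = \sum_k \sum_l A i k * B l j * F k l v) ->
  dual_mxnorm G <= mnorm A * dual_mxnorm F * mnorm B.
Proof.
move=> Fb GE; have b0 : 0 <= mnorm A * dual_mxnorm F * mnorm B.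
  by rewrite !mulr_ge0 ?mnorm_ge0 ?dual_mxnorm_ge0.
apply: dual_mxnorm_le => // p X X1; apply: mnorm_form_le => // eta xi.
pose eta' (s : 'I_m * 'I_p) := \sum_i eta (i, s.2) * A i s.1.
pose xi' (s : 'I_m * 'I_p) := \sum_j B s.1 j * xi (j, s.2).
have -> : mform (ev G X) eta xi = mform (ev F X) eta' xi'.
  rewrite !mform_pair; apply: eq_bigr => q _; apply: eq_bigr => r _.
  rewrite /mform /ev /= /eta' /xi' /=.
  transitivity (\sum_i \sum_j \sum_k \sum_l
     eta (i, q) * (A i k * B l j * F k l (X q r)) * xi (j, r)).
    apply: eq_bigr => i _; apply: eq_bigr => j _; rewrite GE mulr_sumr mulr_suml.
    by apply: eq_bigr => k _; rewrite mulr_sumr mulr_suml.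
  rewrite exchange_big22; apply: eq_bigr => k _; apply: eq_bigr => l _ /=.
  rewrite -mulrA mulr_suml; apply: eq_bigr => i _.
  rewrite !mulr_sumr; apply: eq_bigr => j _; ring.
have ep : l2norm eta' <= mnorm A * l2norm eta.
  apply: l2norm_le; first by rewrite mulr_ge0 ?mnorm_ge0 ?l2norm_ge0.
  rewrite exprMn sqr_l2norm !sum_pair exchange_big [in leRHS]exchange_big mulr_sumr /=.
  apply: ler_sum => q _.
  have := ler_sqr_ge0 (l2norm_ge0 _) (mnormPT A (fun i => eta (i, q))).
  by rewrite exprMn !sqr_l2norm.
have xp : l2norm xi' <= mnorm B * l2norm xi.
  apply: l2norm_le; first by rewrite mulr_ge0 ?mnorm_ge0 ?l2norm_ge0.
  rewrite exprMn sqr_l2norm !sum_pair exchange_big [in leRHS]exchange_big mulr_sumr /=.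
  apply: ler_sum => q _.
  have := ler_sqr_ge0 (l2norm_ge0 _) (mnormP B (fun i => xi (i, q))).
  by rewrite exprMn !sqr_l2norm.
rewrite (le_trans (mform_le _ _ _)) //.
apply: (@le_trans _ _ (dual_mxnorm F * (mnorm A * l2norm eta) * (mnorm B * l2norm xi))).
  have e0 := l2norm_ge0 eta'; have x0 := l2norm_ge0 xi'.
  rewrite ler_pM ?mulr_ge0 ?mnorm_ge0 ?dual_mxnorm_ge0 //.
  by rewrite ler_pM ?mnorm_ge0 // dual_ub.
by rewrite le_eqVlt; apply/orP; left; apply/eqP; ring.
Qed.

(** For the upper bound the test vectors are split along the blocks and a1 b1 + a2 b2 <= a b is
    Cauchy-Schwarz in the plane; for the lower bound the test vectors of a block are extended by
    zero. *)
Lemma dual_mxnorm_block m n (F : 'I_m -> 'I_m -> V -> C) (G : 'I_n -> 'I_n -> V -> C)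
    (H : 'I_(m + n) -> 'I_(m + n) -> V -> C) : bfam F -> bfam G ->
  (forall i j v, H (lshift n i) (lshift n j) v = F i j v) ->
  (forall i j v, H (rshift m i) (rshift m j) v = G i j v) ->
  (forall i j v, H (lshift n i) (rshift m j) v = 0) ->
  (forall i j v, H (rshift m i) (lshift n j) v = 0) ->
  dual_mxnorm H = Num.max (dual_mxnorm F) (dual_mxnorm G).
Proof.
move=> Fb Gb HF HG H1 H2; set c := Num.max _ _.
have c0 : 0 <= c by rewrite le_max dual_mxnorm_ge0.
have Hb : bfam H.
  have bext (f g : V -> C) : (forall v, f v = g v) -> bounded_functional f -> bounded_functional g.
    by move=> /funext ->.
  have b0 : bounded_functional (fun _ : V => 0 : C) := bounded_functional0 V.
  move=> i j; rewrite -(splitK i) -(splitK j).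
  case: (fintype.split i) => i'; case: (fintype.split j) => j' /=.
  - by apply: bext (Fb i' j') => v; rewrite HF.
  - by apply: bext b0 => v; rewrite H1.
  - by apply: bext b0 => v; rewrite H2.
  - by apply: bext (Gb i' j') => v; rewrite HG.
have formE p (X : 'M[V]_p) eta xi : mform (ev H X) eta xi =
  mform (ev F X) (fun s => eta (lshift n s.1, s.2)) (fun s => xi (lshift n s.1, s.2)) +
  mform (ev G X) (fun s => eta (rshift m s.1, s.2)) (fun s => xi (rshift m s.1, s.2)).
  rewrite /mform !sum_pair big_split_ord /=; congr (_ + _); apply: eq_bigr => i _;
    apply: eq_bigr => q _; rewrite !sum_pair big_split_ord /=.
    rewrite [X in _ + X]big1 ?addr0 => [|j _].
      by apply: eq_bigr => j _; apply: eq_bigr => r _; rewrite /ev /= HF.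
    by rewrite big1 // => r _; rewrite /ev /= H1 mulr0 mul0r.
  rewrite [X in X + _]big1 ?add0r => [|j _].
    by apply: eq_bigr => j _; apply: eq_bigr => r _; rewrite /ev /= HG.
  by rewrite big1 // => r _; rewrite /ev /= H2 mulr0 mul0r.
have splitN p (eta : 'I_(m + n) * 'I_p -> C) : l2norm eta ^+ 2 =
   l2norm (fun s : 'I_m * 'I_p => eta (lshift n s.1, s.2)) ^+ 2 +
   l2norm (fun s : 'I_n * 'I_p => eta (rshift m s.1, s.2)) ^+ 2.
  by rewrite !sqr_l2norm !sum_pair big_split_ord.
apply/eqP; rewrite eq_le; apply/andP; split.
  apply: dual_mxnorm_le => // p X X1; apply: mnorm_form_le => // eta xi.
  rewrite formE (le_trans (rnormD _ _)) //.
  have := mform_le (ev F X) (fun s => eta (lshift n s.1, s.2)) (fun s => xi (lshift n s.1, s.2)).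
  have := mform_le (ev G X) (fun s => eta (rshift m s.1, s.2)) (fun s => xi (rshift m s.1, s.2)).
  have Fc : mnorm (ev F X) <= c by rewrite (le_trans (dual_ub Fb X1)) // le_max lexx.
  have Gc : mnorm (ev G X) <= c by rewrite (le_trans (dual_ub Gb X1)) // le_max lexx orbT.
  have := splitN _ eta; have := splitN _ xi.
  have := l2norm_ge0 eta; have := l2norm_ge0 xi.
  set a := l2norm eta; set b := l2norm xi.
  have := l2norm_ge0 (fun s : 'I_m * 'I_p => eta (lshift n s.1, s.2)).
  have := l2norm_ge0 (fun s : 'I_m * 'I_p => xi (lshift n s.1, s.2)).
  have := l2norm_ge0 (fun s : 'I_n * 'I_p => eta (rshift m s.1, s.2)).
  have := l2norm_ge0 (fun s : 'I_n * 'I_p => xi (rshift m s.1, s.2)).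
  set a1 := l2norm (fun s : 'I_m * 'I_p => eta _); set b1 := l2norm (fun s : 'I_m * 'I_p => xi _).
  set a2 := l2norm (fun s : 'I_n * 'I_p => eta _); set b2 := l2norm (fun s : 'I_n * 'I_p => xi _).
  move=> b20 a20 b10 a10 b0 a0 bE aE hG hF.
  have ab : a1 * b1 + a2 * b2 <= a * b.
    rewrite -(@ler_pXn2r _ 2) ?nnegrE ?addr_ge0 ?mulr_ge0 // exprMn bE aE.
    have := sqr_ge0 (a1 * b2 - a2 * b1); nra.
  apply: le_trans (lerD hF hG) _.
  rewrite (@le_trans _ _ (c * (a1 * b1) + c * (a2 * b2))) //.
    by rewrite -!mulrA lerD // ler_wpM2r ?mulr_ge0.
  by rewrite -mulrDr -mulrA ler_wpM2l.
rewrite ge_max; apply/andP; split; apply: dual_mxnorm_le; rewrite ?dual_mxnorm_ge0 // => p X X1;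
  apply: le_trans (dual_ub Hb X1); apply: mnorm_form_le; rewrite ?mnorm_ge0 // => eta xi.
  pose ex (z : 'I_m * 'I_p -> C) (s : 'I_(m + n) * 'I_p) :=
    if fintype.split s.1 is inl i then z (i, s.2) else 0.
  have exl z : (fun s => ex z (lshift n s.1, s.2)) = z.
    by apply/funext => -[i q]; rewrite /ex /= (unsplitK (inl _ i)).
  have exr z : (fun s => ex z (rshift m s.1, s.2)) = fun=> 0.
    by apply/funext => -[i q]; rewrite /ex /= (unsplitK (inr _ i)).
  have exn z : l2norm (ex z) = l2norm z.
    apply/eqP; rewrite -(@eqrXn2 _ 2) ?l2norm_ge0 // splitN exl exr l2norm0.
    by rewrite expr0n addr0.
  have := mform_le (ev H X) (ex eta) (ex xi); rewrite !exn formE !exl !exr.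
  rewrite [X in _ + X](_ : _ = 0) ?addr0 // /mform big1 // => s _.
  by rewrite big1 // => t _; rewrite mulr0.
pose ex (z : 'I_n * 'I_p -> C) (s : 'I_(m + n) * 'I_p) :=
  if fintype.split s.1 is inr i then z (i, s.2) else 0.
have exl z : (fun s => ex z (lshift n s.1, s.2)) = fun=> 0.
  by apply/funext => -[i q]; rewrite /ex /= (unsplitK (inl _ i)).
have exr z : (fun s => ex z (rshift m s.1, s.2)) = z.
  by apply/funext => -[i q]; rewrite /ex /= (unsplitK (inr _ i)).
have exn z : l2norm (ex z) = l2norm z.
  apply/eqP; rewrite -(@eqrXn2 _ 2) ?l2norm_ge0 // splitN exl exr l2norm0.
  by rewrite expr0n add0r.
have := mform_le (ev H X) (ex eta) (ex xi); rewrite !exn formE !exl !exr.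
rewrite [X in X + _](_ : _ = 0) ?add0r // /mform big1 // => s _.
by rewrite big1 // => t _; rewrite mulr0.
Qed.
End Regular.
End DualNorms.

(** * The predual as an operator space *)

Section VonNeumannNorm.
Variables (R : realType) (H : hilbert R) (M : vnAlg H).
Local Notation C := (cpx R).

Lemma vn_opZ a (x : M) : vn_op (a *: x : M) = a *: vn_op x.
Proof. exact: erefl. Qed.
Lemma vn_opD (x y : M) : vn_op (x + y : M) = vn_op x + vn_op y.
Proof. exact: erefl. Qed.
Lemma bop_scaleE (T : bop H H) a z : (a *: T : bop H H) z = a *: T z.
Proof. exact: erefl. Qed.
Lemma vnZE a (x : M) z : (a *: x : M) z = a *: x z.
Proof. by rewrite vn_opZ; exact: bop_scaleE. Qed.
Lemma bop_addE (T S : bop H H) z : (T + S : bop H H) z = T z + S z.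
Proof. exact: erefl. Qed.
Lemma vnDE (x y : M) z : (x + y : M) z = x z + y z.
Proof. by rewrite vn_opD; exact: bop_addE. Qed.
Lemma vn0E z : (0 : M) z = 0.
Proof. by rewrite -(scale0r (0 : M)) vnZE scale0r. Qed.
Lemma vn_sumE (I : Type) (r : seq I) (P : pred I) (F : I -> M) z :
  (\sum_(i <- r | P i) F i : M) z = \sum_(i <- r | P i) (F i) z.
Proof.
apply: (big_morph (fun y : M => (y : bop H H) z)) => [x y|]; first exact: vnDE.
exact: vn0E.
Qed.

Definition vact n (X : 'M[M]_n) (xi : 'I_n -> H) i : H := \sum_j (X i j : M) (xi j).

Lemma vactZ n (X : 'M[M]_n) a xi : vact X (fun i => a *: xi i) = (fun i => a *: vact X xi i).
Proof.
apply/funext => i; rewrite /vact scaler_sumr; apply: eq_bigr => j _.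
by rewrite bopZ.
Qed.

Lemma vn_mxnormP n (X : 'M[M]_n) xi : l2norm (vact X xi) <= vn_mxnorm X * l2norm xi.
Proof.
move: xi; apply: l2_homogeneous => [a v|xi x1]; first exact: vactZ.
have : forall ij : 'I_n * 'I_n, exists c, forall z, rnorm ((X ij.1 ij.2 : M) z) <= c * rnorm z.
  by move=> ij; have [_ h] := bopP (X ij.1 ij.2 : M).
move=> /choice[c cP].
have bnd eta : l2norm eta <= 1 ->
   l2norm (vact X eta) <= \sum_j Num.sqrt (\sum_i `|c (i, j)| ^+ 2).
  move=> e1; rewrite (le_trans (l2norm_sum _ _ _)) //; apply: ler_sum => j _.
  rewrite ler_wsqrtr //; apply: ler_sum => i _.
  rewrite ler_sqr_ge0 ?rnorm_ge0 // (le_trans (cP (i, j) _)) //.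
  rewrite (@le_trans _ _ (`|c (i, j)| * rnorm (eta j))) //.
    by rewrite ler_wpM2r ?rnorm_ge0 // ler_norm.
  by rewrite ler_piMr // (le_trans (l2norm_coord _ _)).
apply: (@le_sup _ _ (\sum_j Num.sqrt (\sum_i `|c (i, j)| ^+ 2))); last by exists xi.
by move=> _ [eta /= e1 <-]; exact: bnd.
Qed.

Lemma vn_mxnorm_ge0 n (X : 'M[M]_n) : 0 <= vn_mxnorm X.
Proof. by apply: sup_ge0 => _ [xi _ <-]; exact: l2norm_ge0. Qed.

Definition vform n (X : 'M[M]_n) (xi eta : 'I_n -> H) : C :=
  \sum_i \sum_j ip ((X i j : M) (xi j)) (eta i).

Lemma vformE n (X : 'M[M]_n) xi eta : vform X xi eta = \sum_i ip (vact X xi i) (eta i).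
Proof. by apply: eq_bigr => i _; rewrite /vact ip_suml. Qed.

Lemma vform_le n (X : 'M[M]_n) xi eta :
  rnorm (vform X xi eta) <= vn_mxnorm X * l2norm xi * l2norm eta.
Proof.
rewrite vformE (le_trans (rnorm_sum _ _ _)) //.
rewrite (@le_trans _ _ (\sum_i rnorm (vact X xi i) * rnorm (eta i))) //.
  by apply: ler_sum => i _; exact: ip_CS.
rewrite (le_trans (sum_CS_sqrt _ _ _ _)) // -/(l2norm eta) -/(l2norm (vact X xi)).
by rewrite ler_wpM2r ?l2norm_ge0 // vn_mxnormP.
Qed.

Lemma vn_mxnorm_form_le n (X : 'M[M]_n) c : 0 <= c ->
  (forall xi eta, rnorm (vform X xi eta) <= c * l2norm xi * l2norm eta) ->
  vn_mxnorm X <= c.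
Proof.
move=> c0 Xc; apply: sup_ler => // _ [xi /= x1 <-]; rewrite -/(vact X xi).
apply: (@le_trans _ _ (c * l2norm xi)); last by rewrite ler_piMr.
have [->|n0] := eqVneq (l2norm (vact X xi)) 0; first by rewrite mulr_ge0 ?l2norm_ge0.
have n1 : 0 < l2norm (vact X xi) by rewrite lt_def n0 l2norm_ge0.
rewrite -(ler_pM2r n1) -expr2 sqr_l2norm.
apply: le_trans (Xc xi (vact X xi)); rewrite (le_trans _ (cre_norm _)) // vformE.
by under [in leRHS]eq_bigr do rewrite ipxx; rewrite -rmorph_sum.
Qed.

Lemma vnorm_vn (x : M) xi : rnorm (x xi) <= vnorm (V := vn_mx M) x * rnorm xi.
Proof.
have := vn_mxnormP (const_mx x : 'M[M]_1) (fun=> xi).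
by rewrite /l2norm !big_ord1 /vact !big_ord1 mxE !sqrtr_sqr !ger0_norm ?rnorm_ge0.
Qed.

Lemma vnorm_vn_le (x : M) c : 0 <= c -> (forall xi, rnorm (x xi) <= c * rnorm xi) ->
  vnorm (V := vn_mx M) x <= c.
Proof.
move=> c0 xc; apply: sup_ler => // _ [xi /= x1 <-].
rewrite /l2norm big_ord1 big_ord1 mxE sqrtr_sqr ger0_norm ?rnorm_ge0 //.
by rewrite (le_trans (xc _)) // ler_piMr // (le_trans (l2norm_coord _ _)).
Qed.

Lemma vn_regular : regular (vn_mx M).
Proof.
split=> [n X|n t X|m X a b]; first exact: vn_mxnorm_ge0.
  have t0 := rnorm_ge0 t; have X0 : 0 <= vn_mxnorm X := vn_mxnorm_ge0 X.
  apply: vn_mxnorm_form_le => [|xi eta]; first exact: mulr_ge0.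
  have -> : vform (map_mx ( *:%R t) X) xi eta = t * vform X xi eta.
    rewrite /vform mulr_sumr; apply: eq_bigr => i _; rewrite mulr_sumr.
    apply: eq_bigr => j _.
    have -> : (map_mx ( *:%R t) X : 'M[M]_n) i j = t *: (X i j : M).
      exact: mxE.
    by rewrite vnZE ipZl.
  by rewrite rnormM -!mulrA ler_wpM2l // mulrA vform_le.
have X0 : 0 <= vn_mxnorm X := vn_mxnorm_ge0 X.
apply: vn_mxnorm_form_le => [|xi eta]; first by rewrite !mulr_ge0 ?l2norm_ge0.
rewrite /vform !big_ord1 mxE.
rewrite vn_sumE.
(* The scalars are moved onto the test vectors; b passes through the conjugate-linear argument of
   [ip]. *)
have -> : ip (\sum_i ((\sum_l (b i * a l) *: X i l : M) (xi ord0))) (eta ord0) =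
  vform X (fun l => a l *: xi ord0) (fun k => (b k)^* *: eta ord0).
  rewrite ip_suml; apply: eq_bigr => k _; rewrite vn_sumE ip_suml; apply: eq_bigr => l _.
  by rewrite vnZE bopZ ipZl ipZl ipZr conjCK mulrA [a l * b k]mulrC.
rewrite (le_trans (vform_le _ _ _)) //.
have sc (z : H) (c : 'I_m -> C) : l2norm (fun l => c l *: z) = l2norm c * rnorm z.
  rewrite /l2norm; under eq_bigr do rewrite rnormZ exprMn.
  by rewrite -mulr_suml sqrtrM ?sum_rnorm_ge0 // sqrtr_sqr ger0_norm ?rnorm_ge0.
rewrite !sc (@l2norm_eq _ _ _ _ (fun k => (b k)^* : C) b); last by move=> i; rewrite rnorm_conj.
rewrite -[mxnorm X]/(vn_mxnorm X).
have l1 (z : 'I_1 -> H) : l2norm z = rnorm (z ord0).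
  by rewrite /l2norm big_ord1 sqrtr_sqr ger0_norm ?rnorm_ge0.
by rewrite !l1 le_eqVlt; apply/orP; left; apply/eqP; ring.
Qed.
End VonNeumannNorm.

Section PredualBasics.
Variables (R : realType) (H : hilbert R) (M : vnAlg H).
Local Notation C := (cpx R).

Lemma predual_normal (f : predual M) : normal_functional (f : M -> C).
Proof. exact: (lsetV (S := predual_linset M)). Qed.

Lemma predual_ext (f g : predual M) : (forall x, f x = g x) -> f = g.
Proof. by move=> fg; apply/val_inj/funext. Qed.

Lemma predual_linE (f g : predual M) a x : (a *: f + g : predual M) x = a * f x + g x.
Proof. by []. Qed.

Lemma predual0E x : (0 : predual M) x = 0.
Proof. by []. Qed.

Lemma predual_sumE (I : Type) (r : seq I) (P : pred I) (F : I -> predual M) x :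
  (\sum_(i <- r | P i) F i : predual M) x = \sum_(i <- r | P i) F i x.
Proof. by apply: (big_morph (fun f : predual M => f x)). Qed.

Lemma normal_scalar (f : M -> C) : normal_functional f -> scalar f.
Proof.
move=> [xi [eta [sx se fE]]] a; change (forall x y : M, f (a *: x + y) = a * f x + f y) => x y.
have := cvg_series_lin (a := a) (fE x) (fE y).
have -> : (fun n => a * ip (x (xi n)) (eta n) + ip (y (xi n)) (eta n)) =
   (fun n => ip ((a *: x + y : M) (xi n)) (eta n)).
  by apply/funext => n; rewrite vnDE vnZE ipDl ipZl.
by move=> /csum_eq <-; apply/esym/csum_eq; exact: fE.
Qed.

Lemma normal_bounded (f : M -> C) : normal_functional f -> bounded_functional (V := vn_mx M) f.
Proof.
move=> fN; split; first exact: normal_scalar.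
have [xi [eta [sx se fE]]] := fN.
exists (Num.sqrt (nsq xi) * Num.sqrt (nsq eta)).
change (forall x : M, rnorm (f x) <=
  Num.sqrt (nsq xi) * Num.sqrt (nsq eta) * vnorm (V := vn_mx M) x) => x.
rewrite -(csum_eq (fE x)) (le_trans (csum_ip_le (sq_summable_bop (T := x) sx) se)) //.
rewrite [leRHS]mulrAC ler_wpM2r ?sqrtr_ge0 //.
have v0 : 0 <= vnorm (V := vn_mx M) x := vnorm_ge0 (vn_regular M) _.
rewrite mulrC -(ger0_norm v0) -sqrtr_sqr -sqrtrM ?sqr_ge0 // ler_wsqrtr //.
by apply: nsq_bop => // z; exact: vnorm_vn.
Qed.

Lemma predual_bounded (f : predual M) : bounded_functional (V := vn_mx M) (f : M -> C).
Proof. exact/normal_bounded/predual_normal. Qed.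

Definition pnorm (f : predual M) : R := vnorm (V := predual_mx M) f.

Lemma pnormE f : pnorm f = norm1 (V := vn_mx M) (f : M -> C).
Proof.
rewrite /pnorm /vnorm /= /norm1; congr dual_mxnorm.
by apply/funext => i; apply/funext => j; rewrite mxE.
Qed.

Lemma pnorm_ge0 f : 0 <= pnorm f.
Proof. by rewrite pnormE norm1_ge0. Qed.

Lemma pnormP (f : predual M) (x : M) : rnorm (f x) <= pnorm f * vnorm (V := vn_mx M) x.
Proof. by rewrite pnormE; exact: (norm1P (vn_regular M) x (predual_bounded f)). Qed.

Lemma pnorm_le (f : predual M) c : 0 <= c ->
  (forall x : M, rnorm (f x) <= c * vnorm (V := vn_mx M) x) -> pnorm f <= c.
Proof.
move=> c0 fc; rewrite pnormE; apply: (norm1_le (vn_regular M)) => //.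
by case: (predual_bounded f).
Qed.

(** Injectivity of M speaks of operator spaces, so Ruan's axioms are checked for the predual and, in
    [sub_opspace], for the subspace from which the slice map is extended. *)
Lemma predual_opspace : opspace (predual_mx M).
Proof.
have Vr := vn_regular M.
have fb n (X : 'M[predual_mx M]_n) : bfam (V := vn_mx M) (fun i j => predual_app (X i j : predual M)).
  by move=> i j; exact: predual_bounded.
split=> [n X X0|n X Y|m n X Y|m n A X B].
- apply/matrixP => i j; rewrite [RHS]mxE; apply: predual_ext => x.
  exact: (dual_eq0 Vr (fb _ X) X0 i j x).
- apply: (dual_mxnormD Vr (fb _ X) (fb _ Y)) => i j v.
  by rewrite mxE.
- apply: (dual_mxnorm_block Vr (fb _ X) (fb _ Y)) => i j v.
  + by rewrite block_mxEul.
  + by rewrite block_mxEdr.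
  + by rewrite block_mxEur mxE.
  + by rewrite block_mxEdl mxE.
- apply: (dual_mxnorm_mul Vr (fb _ X)) => i j v.
  rewrite mxE predual_sumE; apply: eq_bigr => k _; rewrite predual_sumE.
  by apply: eq_bigr => l _.
Qed.
End PredualBasics.

(** * Subspaces of operator spaces *)

Section SubSpace.
Variables (R : realType) (V : mxSpace R) (S : linset V).
Local Notation C := (cpx R).

Lemma lval_lin (a : C) (x y : lsub S) : lval (a *: x + y) = a *: lval x + lval y.
Proof. exact: erefl. Qed.
Lemma lval0 : lval (0 : lsub S) = 0.
Proof. exact: erefl. Qed.
Lemma lvalD (x y : lsub S) : lval (x + y) = lval x + lval y.
Proof. exact: erefl. Qed.
Lemma lvalZ (a : C) (x : lsub S) : lval (a *: x) = a *: lval x.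
Proof. exact: erefl. Qed.
Lemma lval_sum (I : Type) (r : seq I) (P : pred I) (F : I -> lsub S) :
  lval (\sum_(i <- r | P i) F i) = \sum_(i <- r | P i) lval (F i).
Proof. exact: (big_morph (@lval _ _ S) lvalD lval0). Qed.

Definition sub_mx : mxSpace R :=
  @MxSpace R (lsub S) (fun n X => mxnorm (map_mx (@lval _ _ S) X : 'M[V]_n)).

Lemma sub_opspace : opspace V -> opspace sub_mx.
Proof.
move=> [V1 V2 V3 V4]; split=> [n X X0|n X Y|m n X Y|m n A X B].
- apply/matrixP => i j; rewrite [RHS]mxE; apply: val_inj.
  have /matrixP /(_ i j) := V1 n _ X0.
  by rewrite [LHS]mxE [RHS]mxE.
- have -> : mxnorm (X + Y : 'M[sub_mx]_n) =
     mxnorm (map_mx (@lval _ _ S) X + map_mx (@lval _ _ S) Y : 'M[V]_n).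
    change (mxnorm (map_mx (@lval _ _ S) (X + Y) : 'M[V]_n) =
      mxnorm (map_mx (@lval _ _ S) X + map_mx (@lval _ _ S) Y : 'M[V]_n)).
    by congr mxnorm; apply/matrixP => i j; rewrite !mxE.
  exact: V2.
- have -> : mxnorm (block_mx X 0 0 Y : 'M[sub_mx]_(m + n)) = mxnorm (block_mx
     (map_mx (@lval _ _ S) X) 0 0 (map_mx (@lval _ _ S) Y) : 'M[V]_(m + n)).
    change (mxnorm (map_mx (@lval _ _ S) (block_mx X 0 0 Y) : 'M[V]_(m + n)) = mxnorm (block_mx
     (map_mx (@lval _ _ S) X) 0 0 (map_mx (@lval _ _ S) Y) : 'M[V]_(m + n))).
    congr mxnorm; rewrite [LHS]map_block_mx; congr block_mx; apply/matrixP => i j;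
    by rewrite mxE [RHS]mxE [X in lval X]mxE lval0.
  exact: V3.
- have -> : mxnorm (\matrix_(i < n, j < n) \sum_(k < m) \sum_(l < m)
      (A i k * B l j) *: X k l : 'M[sub_mx]_n) = mxnorm (\matrix_(i < n, j < n)
    \sum_(k < m) \sum_(l < m) (A i k * B l j) *: (map_mx (@lval _ _ S) X : 'M[V]_m) k l).
    change (mxnorm (map_mx (@lval _ _ S) (\matrix_(i < n, j < n) \sum_(k < m) \sum_(l < m)
      (A i k * B l j) *: X k l) : 'M[V]_n) = mxnorm (\matrix_(i < n, j < n)
    \sum_(k < m) \sum_(l < m) (A i k * B l j) *: (map_mx (@lval _ _ S) X : 'M[V]_m) k l)).
    congr mxnorm; apply/matrixP => i j; rewrite !mxE lval_sum; apply: eq_bigr => k _.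
    by rewrite lval_sum; apply: eq_bigr => l _; rewrite lvalZ mxE.
  exact: V4.
Qed.

Lemma sub_isometry : complete_isometry (V := sub_mx) (W := V) (@lval _ _ S).
Proof. by split=> [a x y|n X]; [exact: lval_lin|]. Qed.
End SubSpace.

(** * Vector functionals and operators represented by forms *)

Section VectorFunctionals.
Variables (R : realType) (H : hilbert R) (M : vnAlg H).
Local Notation C := (cpx R).
Local Notation vM := (vnorm (V := vn_mx M)).

Definition single (V : zmodType) (v : V) (n : nat) : V := if n is 0 then v else 0.

Lemma series_single (V : zmodType) (u : nat -> V) : (forall n, u n.+1 = 0) ->
  forall n, series u n.+1 = u 0.
Proof.
move=> u0; elim=> [|n IH]; first by rewrite seriesS series0 add0r.
by rewrite seriesS IH u0 addr0.
Qed.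

Lemma sq_summable_single (V : normedModType C) (v : V) : sq_summable (single v).
Proof.
apply: (@sq_summable_le _ _ _ (rnorm v ^+ 2)) => -[|n]; first by rewrite series0 sqr_ge0.
by rewrite series_single // => k; rewrite /= rnorm0 expr0n.
Qed.

Lemma omega_normal (xi eta : H) : normal_functional (fun x : M => ip (x xi) eta).
Proof.
exists (single xi), (single eta); split=> [||x]; try exact: sq_summable_single.
apply/cvgn_rnormP => e e0; exists 1%N => -[|n] // _.
by rewrite series_single ?subrr ?rnorm0 // => k /=; rewrite ipx0.
Qed.

Definition omega (xi eta : H) : predual M :=
  mklsub (S := predual_linset M) (omega_normal xi eta).

Lemma omegaE xi eta x : omega xi eta x = ip (x xi) eta.
Proof. by []. Qed.

Lemma vn_mulE (x y : M) xi : vn_mul x y xi = x (y xi).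
Proof. by []. Qed.

Lemma vM_ge0 (x : M) : 0 <= vM x.
Proof. exact: vnorm_ge0 (vn_regular M) x. Qed.

Lemma vM_mul (x y : M) : vM (vn_mul x y) <= vM x * vM y.
Proof.
apply: vnorm_vn_le => [|xi]; first by rewrite mulr_ge0 ?vM_ge0.
rewrite vn_mulE (le_trans (vnorm_vn _ _)) // -mulrA ler_wpM2l ?vM_ge0 //.
exact: vnorm_vn.
Qed.

Lemma pnorm_omega xi eta : pnorm (omega xi eta) <= rnorm xi * rnorm eta.
Proof.
apply: pnorm_le => [|x]; first by rewrite mulr_ge0 ?rnorm_ge0.
rewrite omegaE (le_trans (ip_CS _ _)) // mulrAC ler_wpM2r ?rnorm_ge0 //.
by rewrite mulrC vnorm_vn.
Qed.

Lemma predual_series (f : predual M) : exists xi eta : nat -> H,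
  [/\ sq_summable xi, sq_summable eta &
      forall x : M, f x = csum (fun n => ip (x (xi n)) (eta n))].
Proof.
have [xi [eta [sx se fE]]] := predual_normal f; exists xi, eta; split=> // x.
by rewrite (csum_eq (fE x)).
Qed.

Lemma trr_normal (p : M) (f : predual M) : normal_functional (fun x : M => f (vn_mul x p)).
Proof.
have [xi [eta [sx se fE]]] := predual_normal f.
exists (fun n => p (xi n)), eta; split.
- exact: sq_summable_bop sx.
- exact: se.
- move=> x; exact: (fE (vn_mul x p)).
Qed.
Definition trr p f : predual M := mklsub (S := predual_linset M) (trr_normal p f).
Lemma trl_normal (p : M) (f : predual M) : normal_functional (fun x : M => f (vn_mul p x)).
Proof.
have [xi [eta [sx se fE]]] := predual_normal f.
exists xi, (fun n => adj p (eta n)); split.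
- exact: sx.
- exact: sq_summable_bop se.
- move=> x; have -> : (fun n => ip (x (xi n)) (adj p (eta n))) =
    (fun n => ip (vn_mul p x (xi n)) (eta n)) by apply/funext => n; rewrite -adjP.
  exact: (fE (vn_mul p x)).
Qed.
Definition trl p f : predual M := mklsub (S := predual_linset M) (trl_normal p f).
Lemma trrE p f x : trr p f x = f (vn_mul x p).
Proof. by []. Qed.
Lemma trlE p f x : trl p f x = f (vn_mul p x).
Proof. by []. Qed.

Lemma pnorm_trr p f : pnorm (trr p f) <= vM p * pnorm f.
Proof.
apply: pnorm_le => [|x]; first by rewrite mulr_ge0 ?vM_ge0 ?pnorm_ge0.
have -> : vM p * pnorm f * vM x = pnorm f * (vM x * vM p) by ring.
by rewrite trrE (le_trans (pnormP _ _)) // ler_wpM2l ?pnorm_ge0 ?vM_mul.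
Qed.
Lemma pnorm_trl p f : pnorm (trl p f) <= vM p * pnorm f.
Proof.
apply: pnorm_le => [|x]; first by rewrite mulr_ge0 ?vM_ge0 ?pnorm_ge0.
have -> : vM p * pnorm f * vM x = pnorm f * (vM p * vM x) by ring.
by rewrite trlE (le_trans (pnormP _ _)) // ler_wpM2l ?pnorm_ge0 ?vM_mul.
Qed.

(* The Riesz theorem gives an operator, and the balance over the commutant puts it in the
   bicommutant of M. *)
Lemma form_vn (s : H -> H -> C) c : 0 <= c -> (forall eta, scalar (s^~ eta)) ->
  (forall xi a eta eta', s xi (a *: eta + eta') = a^* * s xi eta + s xi eta') ->
  (forall xi eta, rnorm (s xi eta) <= c * rnorm xi * rnorm eta) ->
  (forall U, commutant (vn_set M) U -> forall xi eta, s (U xi) eta = s xi (adj U eta)) ->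
  exists x : M, (forall xi eta, ip (x xi) eta = s xi eta) /\ vM x <= c.
Proof.
move=> c0 sL sA sB sU.
have rep eta : exists z, forall xi, s xi eta = ip xi z.
  apply: (@riesz _ _ (s^~ eta) (sL eta) (c * rnorm eta)) => xi.
  by rewrite mulrAC.
have [f fP] := choice rep.
have fb eta : rnorm (f eta) <= c * rnorm eta.
  have [->|n0] := eqVneq (rnorm (f eta)) 0; first by rewrite mulr_ge0 ?rnorm_ge0.
  have n1 : 0 < rnorm (f eta) by rewrite lt_def n0 rnorm_ge0.
  rewrite -(ler_pM2r n1) -expr2 -ip_rnorm -fP (le_trans (cre_norm _)) //.
  by rewrite mulrAC.
have fS : bop_set f.
  split=> [a eta eta'|]; last by exists c.
  by apply: ip_ext => xi; rewrite ipDr ipZr -!fP sA.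
pose T := adj (mkbop fS).
have TE xi eta : ip (T xi) eta = s xi eta by rewrite /T adjP'; exact/esym/fP.
have TM : vn_set M T.
  rewrite -vn_bicommutant => U UM; apply: bop_ext => xi.
  apply: ip_ext => eta; rewrite (ipC eta) [RHS]ipC; congr (_ ^*).
  by rewrite !bcompE TE sU // adjP -TE.
exists (mklsub (S := vn_linset M) TM); split=> [xi eta|]; first exact: TE.
apply: vnorm_vn_le => // xi; change (rnorm (T xi) <= c * rnorm xi).
have [->|n0] := eqVneq (rnorm (T xi)) 0; first by rewrite mulr_ge0 ?rnorm_ge0.
have n1 : 0 < rnorm (T xi) by rewrite lt_def n0 rnorm_ge0.
by rewrite -(ler_pM2r n1) -expr2 -ip_rnorm TE (le_trans (cre_norm _)).
Qed.

End VectorFunctionals.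

(** * Slice maps *)

Section Squares.
Definition shell n := [seq (i, n) | i <- index_iota 0 n.+1] ++ [seq (n, j) | j <- index_iota 0 n].
Fixpoint square n := if n is m.+1 then square m ++ shell m else [::].
(* The first n * n values of sqpair fill the square [0, n) x [0, n). *)
Definition sqpair k := nth (0, 0)%N (square k.+1) k.

Lemma size_square n : size (square n) = (n * n)%N.
Proof.
elim: n => //= n IH; rewrite size_cat IH size_cat !size_map !size_iota !subn0.
ring.
Qed.

Lemma nth_square m n k : (m <= n)%N -> (k < m * m)%N ->
  nth (0, 0)%N (square n) k = nth (0, 0)%N (square m) k.
Proof.
move=> mn km; elim: n mn => [|n IH]; first by rewrite leqn0 => /eqP ->.
rewrite leq_eqVlt => /predU1P[<- //|]; rewrite ltnS => mn /=.
by rewrite nth_cat size_square (leq_trans km) ?leq_mul // IH.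
Qed.

Lemma sqpairE n k : (k < n * n)%N -> sqpair k = nth (0, 0)%N (square n) k.
Proof.
move=> kn; rewrite /sqpair; have kk : (k < k.+1 * k.+1)%N by rewrite mulSn ltn_addr.
case: (leqP n k.+1) => nk; first by rewrite (nth_square nk kn).
by rewrite (nth_square (ltnW nk) kk).
Qed.

Lemma sum_square (V : nmodType) (E : nat -> nat -> V) n :
  \sum_(p <- square n) E p.1 p.2 = \sum_(0 <= i < n) \sum_(0 <= j < n) E i j.
Proof.
elim: n => [|n IH]; first by rewrite big_nil big_nil.
rewrite /= big_cat IH big_cat !big_map /= [RHS]big_nat_recr //=.
have -> : \sum_(0 <= i < n) \sum_(0 <= j < n.+1) E i j =
    \sum_(0 <= i < n) \sum_(0 <= j < n) E i j + \sum_(0 <= i < n) E i n.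
  by rewrite -big_split; apply: eq_bigr => i _; rewrite big_nat_recr.
rewrite (big_nat_recr n) //= [X in _ = _ + X]big_nat_recr //=.
by rewrite -!addrA; congr (_ + (_ + _)); exact: addrC.
Qed.

(** For a series known to converge, the partial sums over squares determine the limit; this is how
    double series of product functionals are summed. *)
Lemma series_sqpair (V : zmodType) (E : nat -> nat -> V) n :
  series (fun k => E (sqpair k).1 (sqpair k).2) (n * n)%N =
  \sum_(0 <= i < n) \sum_(0 <= j < n) E i j.
Proof.
rewrite -sum_square (big_nth (0, 0)%N) size_square seriesEnat /=.
by apply: eq_big_nat => k /andP[_ kn]; rewrite (sqpairE kn).
Qed.
End Squares.

Lemma ip_vn_lin (R : realType) (H : hilbert R) (M : vnAlg H) (x y : M) t (a b : H) :
  ip ((t *: x + y : M) a) b = t * ip (x a) b + ip (y a) b.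
Proof. by rewrite vnDE vnZE ipDl ipZl. Qed.

Section Slices.
Variables (R : realType) (H : hilbert R) (HH : hilbert_tensor H H) (M : vnAlg H).
Local Notation C := (cpx R).
Local Notation N := (vn_tensor HH M M).
Local Notation vM := (vnorm (V := vn_mx M)).
Local Notation vN := (vnorm (V := vn_mx N)).
Local Notation "x '⊗' y" := (tens HH x y) (at level 40).

Lemma op_tens_adj (T : bop HH HH) (S U : bop H H) :
  op_tens T S U -> op_tens (adj T) (adj S) (adj U).
Proof.
move=> TSU x y; apply/eqP; rewrite -subr_eq0; apply/eqP/(ht_total (HK := HH)) => c d.
by rewrite ipDr ipNr -adjP TSU !tens_ip -!adjP subrr.
Qed.

Lemma op_tens_comp (T T' : bop HH HH) (S U S' U' : bop H H) :
  op_tens T S U -> op_tens T' S' U' -> op_tens (bcomp T T') (bcomp S S') (bcomp U U').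
Proof. by move=> TSU TSU' x y; rewrite !bcompE TSU' TSU. Qed.

Lemma elem_tensor_comm (U V : bop H H) (T : bop HH HH) :
  commutant (vn_set M) U -> commutant (vn_set M) V -> op_tens T U V ->
  commutant (@elem_tensors R H H HH M M) T.
Proof.
move=> UM VM TUV S [x [y Sxy]]; apply: (tens_bop_ext (HK := HH)) => a b.
rewrite !bcompE Sxy TUV TUV Sxy -!bcompE.
by rewrite (UM _ (vnP x)) (VM _ (vnP y)).
Qed.

(** With U or V the identity, this gives the balance over the commutant that [form_vn] requires of a
    slice in one leg. *)
Lemma tensor_comm (U V : bop H H) (T : bop HH HH) (D : N) :
  commutant (vn_set M) U -> commutant (vn_set M) V -> op_tens T U V ->
  forall z, T (D z) = D (T z).
Proof.
move=> UM VM TUV z; rewrite -!bcompE.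
have DN : commutant (commutant (@elem_tensors R H H HH M M)) D := vnP D.
by rewrite (DN _ (elem_tensor_comm UM VM TUV)).
Qed.

Lemma elem_tensor_vn (T : bop HH HH) : @elem_tensors R H H HH M M T -> vn_set N T.
Proof. by move=> ET U UE; rewrite -UE. Qed.

Lemma comm_bone : commutant (vn_set M) (bone H).
Proof. exact: commutant1. Qed.

(** The slice belongs to M, and not merely to all operators on H, because 1 ⊗ U commutes with D for
    U in the commutant of M. *)
Lemma slr_ex (D : N) (xi eta : H) : exists x : M,
  (forall a b, ip (x a) b = ip (D (xi ⊗ a)) (eta ⊗ b)) /\
  vM x <= vN D * rnorm xi * rnorm eta.
Proof.
have D0 : 0 <= vN D := vM_ge0 D.
apply: (@form_vn _ _ _ (fun a b => ip (D (xi ⊗ a)) (eta ⊗ b) : C)).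
- by rewrite !mulr_ge0 ?rnorm_ge0.
- by move=> b t a a'; rewrite tensDr tensZr bopD bopZ ipDl ipZl.
- by move=> a t b b'; rewrite tensDr tensZr ipDr ipZr.
- move=> a b; rewrite (le_trans (ip_CS _ _)) // rnorm_tens.
  have -> : vN D * rnorm xi * rnorm eta * rnorm a * rnorm b =
    vN D * (rnorm xi * rnorm a) * (rnorm eta * rnorm b) by ring.
  by rewrite ler_wpM2r ?mulr_ge0 ?rnorm_ge0 // -(rnorm_tens HH xi a) vnorm_vn.
- move=> U UM a b; have [T TU] := op_tens_ex HH (bone H) U.
  have := TU xi a; rewrite -[bone H xi]/xi => <-.
  rewrite -(tensor_comm D comm_bone UM TU) adjP (op_tens_adj TU).
  by congr (ip _ (_ ⊗ _)); apply: ip_ext => c; rewrite -adjP.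
Qed.

Lemma slr_sig (D : N) (xi eta : H) : {x : M |
  (forall a b, ip (x a) b = ip (D (xi ⊗ a)) (eta ⊗ b)) /\
  vM x <= vN D * rnorm xi * rnorm eta}.
Proof. exact: cid (slr_ex D xi eta). Qed.
(* (omega_{xi, eta} ⊗ id)(D). *)
Definition slr D xi eta : M := projT1 (slr_sig D xi eta).
Lemma slrP D xi eta a b : ip (slr D xi eta a) b = ip (D (xi ⊗ a)) (eta ⊗ b).
Proof. by rewrite /slr; case: slr_sig => x [/= ->]. Qed.
Lemma slr_le D xi eta : vM (slr D xi eta) <= vN D * rnorm xi * rnorm eta.
Proof. by rewrite /slr; case: slr_sig => x []. Qed.

Lemma vn_ext (x y : M) : (forall a b, ip (x a) b = ip (y a) b) -> x = y.
Proof.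
move=> xy; apply: val_inj; apply: bop_ext => a.
by apply: ip_ext => b; rewrite ipC xy -ipC.
Qed.

Lemma slr_linl D t xi xi' eta :
  slr D (t *: xi + xi') eta = t *: slr D xi eta + slr D xi' eta.
Proof.
apply: vn_ext => a b.
rewrite slrP tensDl tensZl bopD bopZ ipDl ipZl -!slrP; exact/esym/ip_vn_lin.
Qed.
Lemma slr_linr D t xi eta eta' :
  slr D xi (t *: eta + eta') = t^* *: slr D xi eta + slr D xi eta'.
Proof.
apply: vn_ext => a b.
rewrite slrP tensDl tensZl ipDr ipZr -!slrP; exact/esym/ip_vn_lin.
Qed.
Lemma slr_linD t D D' xi eta :
  slr (t *: D + D') xi eta = t *: slr D xi eta + slr D' xi eta.
Proof.
apply: vn_ext => a b.
rewrite slrP ip_vn_lin -!slrP; exact/esym/ip_vn_lin.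
Qed.

Lemma slr_balanced D U xi eta : commutant (vn_set M) U ->
  slr D (U xi) eta = slr D xi (adj U eta).
Proof.
move=> UM; apply: vn_ext => a b; rewrite !slrP.
have [T TU] := op_tens_ex HH U (bone H).
have := TU xi a; rewrite -[bone H a]/a => <-.
rewrite -(tensor_comm D UM comm_bone TU) adjP (op_tens_adj TU).
by congr (ip _ (_ ⊗ _)); apply: ip_ext => c; rewrite -adjP.
Qed.

Lemma predual_lin (f : predual M) a (x y : M) : f (a *: x + y) = a * f x + f y.
Proof. by case: (predual_bounded f) => fL _; exact: fL. Qed.

(** Slicing is done in two stages: the vector slices of D lie in M, so f can be applied to them, and
    the resulting form on H is represented in turn. *)
Lemma sl_ex (f : predual M) (D : N) : exists x : M,
  (forall xi eta, ip (x xi) eta = f (slr D xi eta)) /\ vM x <= pnorm f * vN D.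
Proof.
have D0 : 0 <= vN D := vM_ge0 D.
apply: (@form_vn _ _ _ (fun xi eta => f (slr D xi eta))).
- by rewrite mulr_ge0 ?pnorm_ge0.
- by move=> eta a xi xi'; rewrite slr_linl predual_lin.
- by move=> xi a eta eta'; rewrite slr_linr predual_lin.
- move=> xi eta; rewrite (le_trans (pnormP _ _)) // -!mulrA ler_wpM2l ?pnorm_ge0 //.
  by rewrite mulrA slr_le.
- by move=> U UM xi eta; rewrite slr_balanced.
Qed.

Lemma sl_sig (f : predual M) (D : N) : {x : M |
  (forall xi eta, ip (x xi) eta = f (slr D xi eta)) /\ vM x <= pnorm f * vN D}.
Proof. exact: cid (sl_ex f D). Qed.
(* (id ⊗ f)(D). *)
Definition sl f D : M := projT1 (sl_sig f D).
Lemma slP f D xi eta : ip (sl f D xi) eta = f (slr D xi eta).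
Proof. by rewrite /sl; case: sl_sig => x [/= ->]. Qed.
Lemma sl_le f D : vM (sl f D) <= pnorm f * vN D.
Proof. by rewrite /sl; case: sl_sig => x []. Qed.

Lemma sl_linl a f g D : sl (a *: f + g) D = a *: sl f D + sl g D.
Proof.
apply: vn_ext => xi eta.
rewrite slP predual_linE -!slP; exact/esym/ip_vn_lin.
Qed.
Lemma sl_linr a f D D' : sl f (a *: D + D') = a *: sl f D + sl f D'.
Proof.
apply: vn_ext => xi eta.
rewrite slP slr_linD predual_lin -!slP; exact/esym/ip_vn_lin.
Qed.

Lemma slr_elem (T : N) (x y : M) xi eta : op_tens T x y ->
  slr T xi eta = ip (x xi) eta *: y.
Proof. by move=> Txy; apply: vn_ext => a b; rewrite slrP Txy tens_ip vnZE ipZl. Qed.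

Lemma predualZ (f : predual M) a x : f (a *: x) = a * f x.
Proof.
have f0 : f 0 = 0 by have := predual_lin f (-1) 0 0; rewrite scaler0 addr0 mulN1r addNr.
by have := predual_lin f a x 0; rewrite f0 !addr0.
Qed.

Lemma sl_elem f (T : N) (x y : M) : op_tens T x y -> sl f T = f y *: x.
Proof.
move=> Txy; apply: vn_ext => xi eta; rewrite slP (slr_elem _ _ Txy) predualZ.
by rewrite mulrC -ipZl -vnZE.
Qed.

Lemma sl_mulr f (D T : N) (p q : M) : op_tens T p q ->
  sl f (vn_mul D T) = vn_mul (sl (trr q f) D) p.
Proof.
move=> Tpq; apply: vn_ext => xi eta; rewrite slP.
apply: (etrans _ (esym (slP _ D (p xi) eta))); rewrite trrE; congr (f _).
by apply: vn_ext => a b; rewrite slrP vn_mulE Tpq -slrP.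
Qed.

Lemma sl_mull f (D T : N) (p q : M) : op_tens T p q ->
  sl f (vn_mul T D) = vn_mul p (sl (trl q f) D).
Proof.
move=> Tpq; apply: vn_ext => xi eta; rewrite slP.
apply: (etrans _ (esym (adjP p _ _))); rewrite slP trlE; congr (f _).
apply: vn_ext => a b; rewrite slrP vn_mulE adjP (op_tens_adj Tpq) -slrP.
by rewrite -adjP.
Qed.

(** Write h - h' as a series with vectors zeta and theta: vanishing on elementary tensors says that
    zeta lies in the annihilator. These tensors contain the identity and are stable under products
    and adjoints, as [bicommutant_annih] asks. *)
Lemma predual_eq_elem (h h' : predual N) :
  (forall (T : N) (x y : M), op_tens T x y -> h T = h' T) -> h = h'.
Proof.
move=> hh; apply/eqP; rewrite -subr_eq0; apply/eqP; apply: predual_ext => D.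
have [zeta [theta [sz st kE]]] := predual_series (h - h').
rewrite [LHS]kE; apply: (bicommutant_annih (A := @elem_tensors R H H HH M M)) => //.
- by exists (vn_one M), (vn_one M) => x y.
- exact: elem_tensors_adj.
- move=> S T [x [y Sxy]] [x' [y' Txy]]; exists (vn_mul x x'), (vn_mul y y').
  exact: op_tens_comp.
- move=> S [x [y Sxy]]; have SN : vn_set N S by apply: elem_tensor_vn; exists x, y.
  have := kE (mklsub (S := vn_linset N) SN) => <-.
  have -> : forall z : N, (h - h' : predual N) z = h z - h' z by [].
  by rewrite (hh _ x y) ?subrr.
- exact: (vnP D).
Qed.
End Slices.

(** * Product functionals and convolution *)

Section TensorFunctional.
Variables (R : realType) (H : hilbert R) (HH : hilbert_tensor H H) (M : vnAlg H).
Local Notation C := (cpx R).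
Local Notation N := (vn_tensor HH M M).
Local Notation vN := (vnorm (V := vn_mx N)).
Local Notation "x '⊗' y" := (tens HH x y) (at level 40).

Lemma sq_summable_sqpair (x y : nat -> H) : sq_summable x -> sq_summable y ->
  sq_summable (fun k => x (sqpair k).1 ⊗ y (sqpair k).2).
Proof.
move=> xs ys; apply: (@sq_summable_le _ _ _ (nsq x * nsq y)) => n.
have nn : (n <= n * n)%N by case: n => // n; rewrite mulSn leq_addr.
have mon : nondecreasing_seq (series
    (fun k => rnorm (x (sqpair k).1 ⊗ y (sqpair k).2) ^+ 2)).
  by apply: nondecreasing_series => k _ _; rewrite sqr_ge0.
apply: (le_trans (mon _ _ nn)).
have -> : (fun k => rnorm (x (sqpair k).1 ⊗ y (sqpair k).2) ^+ 2) =
  (fun k => rnorm (x (sqpair k).1) ^+ 2 * rnorm (y (sqpair k).2) ^+ 2).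
  by apply/funext => k; rewrite rnorm_tens exprMn.
rewrite (series_sqpair (fun i j => rnorm (x i) ^+ 2 * rnorm (y j) ^+ 2)).
under eq_bigr do rewrite -mulr_sumr.
rewrite -mulr_suml.
have := nsq_ge n xs; have := nsq_ge n ys; rewrite !seriesEnat /= => hy hx.
by rewrite ler_pM // sumr_ge0 // => i _; rewrite sqr_ge0.
Qed.

(** Series for b and a make b ⊗ a a double series of vector functionals at the tensors of their
    vectors, enumerated along squares. It converges absolutely, so its limit can be compared with
    the iterated sum b(sl a D) on squares only. *)
Lemma fun_tens_normal (b a : predual M) : normal_functional (fun D : N => b (sl a D)).
Proof.
have [xi [eta [sx se bE]]] := predual_series b.
have [xi' [eta' [sx' se' aE]]] := predual_series a.
pose ze k := xi (sqpair k).1 ⊗ xi' (sqpair k).2.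
pose th k := eta (sqpair k).1 ⊗ eta' (sqpair k).2.
have sz : sq_summable ze by exact: sq_summable_sqpair.
have st : sq_summable th by exact: sq_summable_sqpair.
exists ze, th; split=> // D.
have cv := csum_ip_cvg (sq_summable_bop (T := D) sz) st.
suff <- : csum (fun k => ip (D (ze k)) (th k)) = b (sl a D) by exact: cv.
pose t i j : C := ip (D (xi i ⊗ xi' j)) (eta i ⊗ eta' j).
have D0 : 0 <= vN D := vM_ge0 D.
pose u i : C := a (slr D (xi i) (eta i)).
have uE i : u i = csum (t i).
  by rewrite /u aE; congr csum; apply/funext => j; rewrite slrP.
have bu : b (sl a D) = csum u.
  by rewrite bE; congr csum; apply/funext => i; rewrite slP.
have us : series u @ \oo --> csum u.
  rewrite -bu; have := csum_ip_cvg (sq_summable_bop (T := sl a D) sx) se.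
  rewrite bE; have -> // : (fun n => ip (sl a D (xi n)) (eta n)) = u.
  by apply/funext => i; rewrite slP.
have ts i : series (t i) @ \oo --> csum (t i).
  have := csum_ip_cvg (sq_summable_bop (T := slr D (xi i) (eta i)) sx') se'.
  have -> // : (fun n => ip (slr D (xi i) (eta i) (xi' n)) (eta' n)) = t i.
  by apply/funext => j; rewrite slrP.
set p := fun n => rnorm (xi n) * rnorm (eta n).
set q := fun n => rnorm (xi' n) * rnorm (eta' n).
have p0 n : 0 <= p n by rewrite mulr_ge0 ?rnorm_ge0.
have q0 n : 0 <= q n by rewrite mulr_ge0 ?rnorm_ge0.
have tle i j : rnorm (t i j) <= vN D * p i * q j.
  rewrite (le_trans (ip_CS _ _)) // rnorm_tens.
  have -> : vN D * p i * q j =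
    (vN D * (rnorm (xi i) * rnorm (xi' j))) * (rnorm (eta i) * rnorm (eta' j)).
    by rewrite /p /q; ring.
  by rewrite ler_wpM2r ?mulr_ge0 ?rnorm_ge0 // -(rnorm_tens HH) vnorm_vn.
pose B := Num.sqrt (nsq xi) * Num.sqrt (nsq eta).
have pB n : series p n <= B by exact: series_ip_le.
have B0 : 0 <= B by rewrite mulr_ge0 ?sqrtr_ge0.
pose s n := \sum_(0 <= i < n) \sum_(0 <= j < n) t i j.
(* Cutting the i-th inner sum at n costs at most vN D times [p i] times a tail of q, and the sums of
   the [p i] stay below B. *)
have close e : 0 < e -> exists n0, forall n, (n0 <= n)%N -> rnorm (series u n - s n) <= vN D * B * e.
  move=> e0; have [n0 n0P] := series_tail_small q0 (sq_summable_mul sx' se') e0.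
  exists n0 => n nn0.
  have each i : rnorm (u i - series (t i) n) <= vN D * p i * e.
    rewrite uE; apply: (@cvg_rnorm_le _ _ \oo _ C (fun m => series (t i) m - series (t i) n)).
      by apply: cvgB; [exact: ts|exact: cvg_cst].
    exists n => // m /= nm.
    have := n0P n m; rewrite nn0 nm => /(_ isT) /ltW qe.
    have -> : series (t i) m - series (t i) n = \sum_(n <= j < m) t i j.
      by rewrite !seriesEnat /= (big_cat_nat (n := n) (m := 0%N) (p := m)) //= addrAC subrr add0r.
    rewrite (le_trans (rnorm_sum _ _ _)) //.
    rewrite (@le_trans _ _ (\sum_(n <= j < m) vN D * p i * q j)) //.
      by apply: ler_sum => j _; exact: tle.
    rewrite -mulr_sumr; apply: ler_wpM2l; first exact: mulr_ge0.
    apply: le_trans qe; rewrite !seriesEnat.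
    by rewrite /= (big_cat_nat (n := n) (m := 0%N) (p := m)) //= addrAC subrr add0r.
  have -> : series u n - s n = \sum_(0 <= i < n) (u i - series (t i) n).
    by rewrite sumrB /s; congr (_ - _); apply: eq_bigr => i _; rewrite seriesEnat.
  rewrite (le_trans (rnorm_sum _ _ _)) //.
  rewrite (@le_trans _ _ (\sum_(0 <= i < n) vN D * p i * e)) //.
    by apply: ler_sum => i _; exact: each.
  rewrite -mulr_suml -mulr_sumr; apply: ler_wpM2r; first exact: ltW.
  by apply: ler_wpM2l => //; have := pB n; rewrite seriesEnat.
apply: csum_eq; rewrite bu.
have /cvgn_rnormP cv' := cv.
have /cvgn_rnormP us' := us.
have eqn : csum (fun k => ip (D (ze k)) (th k)) = csum u.
  apply/eqP; rewrite -subr_eq0; apply/eqP; apply: rnorm_eq0; apply/eqP.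
  rewrite eq_le rnorm_ge0 andbT; apply/ler_addgt0Pr => e e0; rewrite add0r.
  have DB : 0 <= vN D * B by rewrite mulr_ge0.
  have DB1 : 0 < vN D * B + 1 by rewrite ltr_wpDl.
  have e2 : 0 < e / 4 by rewrite divr_gt0.
  have e3 : 0 < e / 4 / (vN D * B + 1) by rewrite divr_gt0.
  have [n1 P1] := cv' _ e2; have [n2 P2] := us' _ e2; have [n3 P3] := close _ e3.
  pose n := maxn n1 (maxn n2 n3).
  have nn : (n <= n * n)%N by case: (n) => // k; rewrite mulSn leq_addr.
  have h1 := P1 (n * n)%N (leq_trans (leq_maxl _ _) nn).
  have h2 := P2 n (leq_trans (leq_maxl _ _) (leq_maxr _ _)).
  have h3 := P3 n (leq_trans (leq_maxr _ _) (leq_maxr _ _)).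
  have E : series (fun k => ip (D (ze k)) (th k)) (n * n)%N = s n by exact: (series_sqpair t).
  rewrite E in h1.
  have h3' : rnorm (series u n - s n) <= e / 4.
    apply: le_trans h3 _; rewrite mulrCA ler_piMr ?ltW //.
    by rewrite ltr_pdivrMr // mul1r ltrDl.
  set X := csum _ in h1 *; set Y := csum u in h2 *.
  have -> : X - Y = (X - s n) - (series u n - s n) - (Y - series u n) by ring.
  have := rnormD (X - s n - (series u n - s n)) (- (Y - series u n)).
  have := rnormD (X - s n) (- (series u n - s n)).
  rewrite !rnormN; lra.
by rewrite -eqn.
Qed.

(** [fun_tens] is defined by choice: normality of b after slicing by a shows that a candidate
    exists, and [predual_eq_elem] that it is unique. *)
Lemma fun_tens_sl (b a : predual M) (D : N) : fun_tens HH b a D = b (sl a D).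
Proof.
pose h : predual N := mklsub (S := predual_linset N) (fun_tens_normal b a).
have hE (T : N) (x y : M) : op_tens T x y -> h T = b x * a y.
  move=> Txy; change (b (sl a T) = b x * a y).
  by rewrite (sl_elem _ Txy) predualZ mulrC.
have ex : exists h : predual N, [set h : predual N |
    forall (T : N) (x y : M), op_tens T x y -> h T = b x * a y] h by exists h.
have fE := xgetPex 0 ex.
have -> : fun_tens HH b a = h; last by [].
apply: predual_eq_elem => T x y Txy; rewrite (hE _ _ _ Txy); exact: fE.
Qed.

(** Replaces the convolution by slices of Gamma x; normality of Gamma excludes the default value of
    [xget]. *)
Lemma convolution_sl (Gamma : M -> N) (f g : predual M) : normal_star_hom Gamma ->
  forall x, (convolution Gamma f g : predual M) x = f (sl g (Gamma x)).
Proof.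
move=> [_ _ _ _ GN].
have kN := GN (fun_tens HH f g).
pose k : predual M := mklsub (S := predual_linset M) kN.
have ex : exists k : predual M, [set k : predual M |
    forall x : M, k x = fun_tens HH f g (Gamma x)] k by exists k.
by move=> x; rewrite -fun_tens_sl; exact: (xgetPex 0 ex).
Qed.
End TensorFunctional.

(** * The von Neumann algebra as the dual of its predual *)

Section PredualDual.
Variables (R : realType) (H : hilbert R) (M : vnAlg H).
Local Notation C := (cpx R).
Local Notation vM := (vnorm (V := vn_mx M)).
Local Notation A := (predual_mx M).
Local Notation dnorm := (vnorm (V := mxdual A)).

Lemma mnormZ_le (I J : finType) (B : I -> J -> C) t :
  mnorm (fun i j => t * B i j) <= rnorm t * mnorm B.
Proof.
apply: mnorm_le => [|xi]; first by rewrite mulr_ge0 ?rnorm_ge0 ?mnorm_ge0.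
have -> : mact (fun i j => t * B i j) xi = fun i => t *: mact B xi i.
  apply/funext => i; rewrite /mact scaler_sumr; apply: eq_bigr => j _.
  exact/esym/mulrA.
by rewrite l2normZ -mulrA ler_wpM2l ?rnorm_ge0 // mnormP.
Qed.

Lemma predual_regular : regular A.
Proof.
have fb n (X : 'M[A]_n) : bfam (V := vn_mx M) (fun i j => predual_app (X i j : predual M)).
  by move=> i j; exact: predual_bounded.
have Vr := vn_regular M.
split=> [n X|n t X|m X a b]; first exact: dual_mxnorm_ge0.
  have X0 : 0 <= mxnorm X by exact: dual_mxnorm_ge0.
  apply: dual_mxnorm_le => [|m Y Y1]; first by rewrite mulr_ge0 ?rnorm_ge0.
  set E := ev _ _.
  have -> : E = fun p q => t *
      ev (V := vn_mx M) (fun i j => predual_app (X i j : predual M)) Y p q.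
    apply/funext => p; apply/funext => q; rewrite /E /ev mxE.
    have := predual_linE (X p.1 q.1 : predual M) 0 t (Y p.2 q.2 : M).
    by rewrite addr0 predual0E addr0.
  rewrite (le_trans (mnormZ_le _ _)) // ler_wpM2l ?rnorm_ge0 //.
  exact: (dual_ub Vr (fb _ X) Y1).
have X0 : 0 <= mxnorm X by exact: dual_mxnorm_ge0.
apply: pnorm_le => [|x]; first by rewrite !mulr_ge0 ?l2norm_ge0.
(* Evaluation at x is the scalar form of X against the 1 x 1 matrix x, which the dual matrix norm
   bounds. *)
have -> : (\sum_k \sum_l (b k * a l) *: X k l : predual M) x =
  mform (ev (V := vn_mx M) (fun i j => predual_app (X i j : predual M))
           (const_mx x : 'M[vn_mx M]_1)) (fun p => b p.1) (fun p => a p.1).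
  rewrite /mform predual_sumE sum_pair; apply: eq_bigr => k _.
  rewrite predual_sumE big_ord1 sum_pair; apply: eq_bigr => l _.
  rewrite big_ord1 /ev mxE.
  have := predual_linE (X k l : predual M) 0 (b k * a l) x.
  rewrite addr0 predual0E addr0 => -> /=.
  by rewrite mulrAC.
rewrite (le_trans (mform_le _ _ _)) //.
have h := dual_le Vr (const_mx x : 'M[vn_mx M]_1) (fb _ X).
have l1 (c : 'I_m -> C) : l2norm (fun p : 'I_m * 'I_1 => c p.1) = l2norm c.
  by rewrite /l2norm sum_pair; under eq_bigr do rewrite big_ord1.
rewrite !l1.
have -> : mxnorm X * l2norm b * l2norm a * vM x = mxnorm X * vM x * l2norm b * l2norm a.
  by ring.
by rewrite ler_wpM2r ?l2norm_ge0 // ler_wpM2r ?l2norm_ge0.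
Qed.

Lemma dual_bfun (phi : mxdual A) : bounded_functional (V := A) (dual_app phi).
Proof. exact: (lsetV (S := dual_linset A)). Qed.

Lemma dual_lin (phi : mxdual A) a (f g : A) :
  dual_app phi (a *: f + g) = a * dual_app phi f + dual_app phi g.
Proof. by case: (dual_bfun phi) => h _; exact: h. Qed.

Lemma dual_ext (phi psi : mxdual A) : (forall f, dual_app phi f = dual_app psi f) -> phi = psi.
Proof. by move=> h; apply/val_inj/funext. Qed.

Lemma dnormE (phi : mxdual A) : dnorm phi = norm1 (dual_app phi).
Proof.
rewrite /vnorm /= /norm1; congr dual_mxnorm.
by apply/funext => i; apply/funext => j; rewrite mxE.
Qed.

Lemma dnorm_ge0 phi : 0 <= dnorm phi.
Proof. by rewrite dnormE norm1_ge0. Qed.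

Lemma dnormP (phi : mxdual A) (f : predual M) : rnorm (dual_app phi f) <= dnorm phi * pnorm f.
Proof. by rewrite dnormE; exact: (norm1P predual_regular f (dual_bfun phi)). Qed.

Lemma dnorm_le (phi : mxdual A) c : 0 <= c ->
  (forall f : predual M, rnorm (dual_app phi f) <= c * pnorm f) -> dnorm phi <= c.
Proof.
move=> c0 h; rewrite dnormE; apply: (norm1_le predual_regular) => //.
by case: (dual_bfun phi).
Qed.

Lemma eval_bounded (x : M) : bounded_functional (V := A) (fun f : predual M => f x).
Proof.
split=> [a f g|]; first exact: predual_linE.
by exists (vM x) => f; rewrite mulrC; exact: pnormP.
Qed.
Definition of_vn (x : M) : mxdual A := mklsub (S := dual_linset A) (eval_bounded x).
Lemma of_vnE x (f : predual M) : dual_app (of_vn x) f = f x.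
Proof. by []. Qed.

Lemma predualB (f g : predual M) x : (f - g : predual M) x = f x - g x.
Proof. by []. Qed.

(** The values of phi at vector functionals form a bounded form balanced over the commutant, which
    yields x. A general f is the norm limit of the partial sums [g n] of its series, and phi is norm
    continuous. *)
Lemma dual_repr (phi : mxdual A) : exists x : M, forall f : predual M, dual_app phi f = f x.
Proof.
have phiD f g : dual_app phi (f + g) = dual_app phi f + dual_app phi g.
  by have := dual_lin phi 1 f g; rewrite scale1r mul1r.
have omega_linl a (xi xi' eta : H) :
   omega M (a *: xi + xi') eta = a *: omega M xi eta + omega M xi' eta.
  by apply: predual_ext => x; rewrite predual_linE !omegaE bopD bopZ ipDl ipZl.
have omega_linr a (xi eta eta' : H) :
   omega M xi (a *: eta + eta') = a^* *: omega M xi eta + omega M xi eta'.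
  by apply: predual_ext => x; rewrite predual_linE !omegaE ipDr ipZr.
have [x [xE _]] : exists x : M,
    (forall xi eta, ip (x xi) eta = dual_app phi (omega M xi eta)) /\ vM x <= dnorm phi.
  apply: (@form_vn _ _ M (fun xi eta => dual_app phi (omega M xi eta))).
  - exact: dnorm_ge0.
  - by move=> eta a xi xi'; rewrite omega_linl dual_lin.
  - by move=> xi a eta eta'; rewrite omega_linr dual_lin.
  - move=> xi eta; rewrite (le_trans (dnormP _ _)) // -mulrA ler_wpM2l ?dnorm_ge0 //.
    exact: pnorm_omega.
  - move=> U UM xi eta; congr (dual_app phi _); apply: predual_ext => y.
    rewrite !omegaE -adjP; congr (ip _ _).
    by have := UM _ (vnP y) => /(congr1 (fun T : bop H H => T xi)).
exists x => f.
have [xi [eta [sx se fE]]] := predual_normal f.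
pose g n : predual M := \sum_(k < n) omega M (xi k) (eta k).
have gE n y : g n y = series (fun k => ip (y (xi k)) (eta k)) n.
  by rewrite /g predual_sumE seriesEord.
have phig n : dual_app phi (g n) = series (fun k => ip (x (xi k)) (eta k)) n.
  rewrite /g seriesEord; elim: (n) => [|m IH]; last first.
    rewrite [RHS]big_ord_recr [X in dual_app _ X]big_ord_recr phiD IH.
    by congr (_ + _); exact/esym/xE.
  rewrite !big_ord0; have := dual_lin phi (-1) 0 0.
  by rewrite scaler0 addr0 mulN1r addNr => h; rewrite [RHS]big_ord0; exact: h.
apply/eqP; rewrite -subr_eq0; apply/eqP; apply: rnorm_eq0; apply/eqP.
rewrite eq_le rnorm_ge0 andbT; apply/ler_addgt0Pr => e e0; rewrite add0r.
have d1 : 0 < dnorm phi + 1 by rewrite ltr_wpDl ?dnorm_ge0.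
have e2 : 0 < e / 2 by rewrite divr_gt0.
have e3 : 0 < e / 2 / (dnorm phi + 1) by rewrite divr_gt0.
have q0 n : 0 <= rnorm (xi n) * rnorm (eta n) by rewrite mulr_ge0 ?rnorm_ge0.
have [n1 P1] := series_tail_small q0 (sq_summable_mul sx se) e3.
have /cvgn_rnormP/(_ _ e2) [n2 P2] := fE x.
pose n := maxn n1 n2.
have tail : pnorm (f - g n) <= e / 2 / (dnorm phi + 1).
  apply: pnorm_le => [|y]; first exact: ltW.
  rewrite predualB gE.
  apply: (@cvg_rnorm_le _ _ \oo _ C (fun m => series (fun k => ip (y (xi k)) (eta k)) m -
     series (fun k => ip (y (xi k)) (eta k)) n)).
    by apply: cvgB; [exact: fE|exact: cvg_cst].
  exists n => // m /= nm.
  have := P1 n m; rewrite leq_maxl nm => /(_ isT) /ltW qe.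
  rewrite !seriesEnat /= (big_cat_nat (n := n) (m := 0%N) (p := m)) //= addrAC subrr add0r.
  rewrite (le_trans (rnorm_sum _ _ _)) //.
  rewrite (@le_trans _ _ (\sum_(n <= k < m) vM y * (rnorm (xi k) * rnorm (eta k)))) //.
    apply: ler_sum => k _; rewrite (le_trans (ip_CS _ _)) // mulrA.
    by rewrite ler_wpM2r ?rnorm_ge0 // vnorm_vn.
  rewrite -mulr_sumr mulrC; apply: ler_wpM2r; first exact: vM_ge0.
  apply: le_trans qe; rewrite !seriesEnat.
  by rewrite /= (big_cat_nat (n := n) (m := 0%N) (p := m)) //= addrAC subrr add0r.
have -> : dual_app phi f - f x = dual_app phi (f - g n) - (f x - g n x).
  have -> : dual_app phi (f - g n) = dual_app phi f - dual_app phi (g n).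
    by have := dual_lin phi (-1) (g n) f; rewrite scaleN1r addrC mulN1r => ->; rewrite addrC.
  by rewrite phig gE; ring.
rewrite (le_trans (rnormD _ _)) // rnormN [leRHS]splitr lerD //.
  rewrite (le_trans (dnormP _ _)) // (le_trans (ler_wpM2l (dnorm_ge0 _) tail)) //.
  rewrite mulrCA ler_piMr ?ltW // ltr_pdivrMr // mul1r ltrDl //.
by rewrite gE; apply/ltW; apply: P2; rewrite leq_maxr.
Qed.

(** Pairing with this matrix is the compression of M to the span of e and f, a complete contraction
    into scalar matrices. It is the test matrix that ties operator norms to completely bounded
    norms. *)
Lemma omega_mx_le n (e f : 'I_n -> H) : orthosys e -> orthosys f ->
  mxnorm (\matrix_(k, l) omega M (e l) (f k) : 'M[A]_n) <= 1.
Proof.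
move=> eo fo; apply: dual_mxnorm_le => // m X X1.
apply: mnorm_form_le => // eta xi; rewrite mul1r.
have -> : mform (ev (V := vn_mx M)
    (fun i j => predual_app ((\matrix_(k, l) omega M (e l) (f k) : 'M[A]_n) i j : predual M)) X)
    eta xi = vform X (fun q => \sum_l xi (l, q) *: e l) (fun p => \sum_k (eta (k, p))^* *: f k).
  rewrite mform_pair; apply: eq_bigr => p _; apply: eq_bigr => q _.
  rewrite bop_sum ip_suml /mform exchange_big; apply: eq_bigr => l _ /=.
  rewrite ip_sumr; apply: eq_bigr => k _; rewrite /ev /= mxE omegaE bopZ ipZl ipZr conjCK.
  by rewrite mulrA mulrC mulrA.
rewrite (le_trans (vform_le _ _ _)) //.
have bnd (g : 'I_n -> H) (z : 'I_n * 'I_m -> C) : orthosys g ->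
    l2norm (fun q => \sum_l z (l, q) *: g l) <= l2norm z.
  move=> go; apply: l2norm_le; first exact: l2norm_ge0.
  rewrite sqr_l2norm sum_pair exchange_big; apply: ler_sum => q _.
  exact: orthosys_norm_le.
have b1 := bnd e xi eo; have b2 := bnd f (fun p => (eta p)^*) fo.
rewrite (@l2norm_eq _ _ _ _ (fun p => (eta p)^* : C) eta) in b2; last first.
  by move=> i; rewrite rnorm_conj.
rewrite mulrC; apply: ler_pM; rewrite ?mulr_ge0 ?l2norm_ge0 ?vn_mxnorm_ge0 //.
by rewrite (le_trans _ b1) // ler_piMl ?l2norm_ge0.
Qed.
End PredualDual.

(** * Weak compactness through ultrafilters *)

Section UltrafilterTopology.

Lemma ptws_cvgP (I : eqType) (K : topologicalType) (F : set_system (I -> K)) (f : I -> K) :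
  Filter F -> (forall i, (fun g : I -> K => g i) @ F --> f i) ->
  F --> (f : {ptws I -> K}).
Proof.
move=> FF Ff; apply/cvg_sup => i; rewrite cvg_image; last first.
  by rewrite eqEsubset; split=> v // _; exists (fun=> v).
move=> W /= /(Ff i) Q; exists ((fun g => g i) @^-1` W) => //.
by rewrite eqEsubset; split => [j [? + <-//]|j Wj]; exists (fun _ => j).
Qed.

Lemma ultra_fmap (T U : Type) (f : T -> U) (F : set_system T) :
  UltraFilter F -> UltraFilter (f @ F).
Proof.
move=> FU; split; first exact: fmap_proper_filter.
move=> G GF FG; rewrite predeqE => A; split; last exact: FG.
move=> GA; have [//|FnA] := in_ultra_setVsetC (f @^-1` A) FU.
have GnA : G (~` A) by apply: FG.
by have /filter_ex [? []] : G (A `&` ~` A) by exact: filterI.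
Qed.

(* Regularity makes it enough to test ultrafilters on S itself rather than on its closure. *)
Lemma compact_closure_ultra (X : topologicalType) (S : set X) : regular_space X ->
  (forall F : set_system X, UltraFilter F -> F S -> exists p : X, F --> p) ->
  compact (closure S).
Proof.
move=> Xr Scvg; rewrite compact_ultra => F FU FS.
pose B := [set O : set X | open O /\ F O].
(* An open member of F meets S because F contains the closure of S; these traces generate the filter
   refined to U. *)
have GF : ProperFilter (filter_from B (fun O => O `&` S)).
  apply: filter_from_proper; last first.
    move=> O [Oo FO]; have [x [Ox xS]] := filter_ex (filterI FO FS).
    have [y [Sy Oy]] := xS _ (open_nbhs_nbhs (conj Oo Ox)).
    by exists y.
  apply: filter_from_filter.
    by exists setT; split; [exact: openT|exact: filterT].
  move=> O O' [Oo FO] [Oo' FO']; exists (O `&` O').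
    by split; [exact: openI|exact: filterI].
  by move=> x [[? ?] ?].
have [U [UU GU]] := ultraFilterLemma GF.
have US : U S.
  apply: GU; exists setT; first by split; [exact: openT|exact: filterT].
  by move=> x [].
have [p Up] := Scvg U UU US.
have pS : closure S p.
  by move=> V /Up UV; have [x [Sx Vx]] := filter_ex (filterI US UV); exists x.
exists p; split=> // V Vp.
have [W Wp WV] := Xr p V Vp.
apply: filterS WV _.
(* Otherwise the complement of [closure W] is an open member of F, so U contains its trace on S,
   although U converges to p and W is a neighbourhood of p. *)
have [//|FnW] := in_ultra_setVsetC (closure W) FU.
have : U (~` closure W `&` S).
  apply: GU; exists (~` closure W) => //; split=> //.
  by apply: closed_openC; exact: closed_closure.
move=> /(filterI (Up _ Wp)) /filter_ex [x [Wx [nWx _]]].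
by case: nWx; exact: subset_closure.
Qed.

End UltrafilterTopology.

Section WeakTopology.
Variables (R : realType).
Local Notation C := (cpx R).
Implicit Types V W : mxSpace R.

Definition weak_ev W (v : weak_top W) : {ptws mxdual W -> C} :=
  fun g : mxdual W => dual_app g (v : W).

Lemma weak_cvgP W (T : Type) (F : set_system T) (FF : Filter F) (u : T -> W) (p : W) :
  (u : T -> weak_top W) @ F --> (p : weak_top W) <->
  forall g : mxdual W, (fun t => dual_app g (u t)) @ F --> (dual_app g p : C).
Proof.
split=> [up g|up].
  have h1 : (fun t => weak_ev (u t : weak_top W)) @ F --> weak_ev (p : weak_top W).
    exact: (cvg_comp _ _ up (@initial_continuous _ _ (@weak_ev W) p)).
  have h2 := @proj_continuous (mxdual W) (fun=> C) g (weak_ev (p : weak_top W)).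
  exact: (cvg_comp _ _ h1 h2).
move=> O [_ [[B Bo <-] Bp] BO].
have h : (fun t => weak_ev (u t : weak_top W)) @ F --> weak_ev (p : weak_top W).
  by apply: ptws_cvgP => g; exact: up.
have : F [set t | B (weak_ev (u t : weak_top W))] by apply: h; exact: open_nbhs_nbhs.
by move=> /filterS; apply=> t Bt; apply: BO.
Qed.

(** The initial topology carries a uniform structure, and uniform spaces are regular. *)
Lemma weak_regular W : regular_space (weak_top W).
Proof. exact: (@uniform_regular (weak_top W)). Qed.

(* Weak compactness of T, tested on ultrafilters of the unit ball of V. *)
Definition ultra_weak V W (T : V -> W) := forall U : set_system V, UltraFilter U ->
  U [set v | vnorm v <= 1] ->
  exists p : W, forall g : mxdual W, (fun v => dual_app g (T v)) @ U --> (dual_app g p : C).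

Lemma weakly_compact_ultra V W (T : V -> W) : weakly_compact T -> ultra_weak T.
Proof.
move=> [_]; rewrite compact_ultra => Tc U UU Ub.
have Us : U [set v : V | closure ([set T v | v in [set v | vnorm v <= 1]] : set (weak_top W))
    (T v : weak_top W)].
  by apply: filterS Ub => v vb; apply: subset_closure; exists v.
have [p [_ Up]] := Tc _ (ultra_fmap (T : V -> weak_top W) UU) Us.
by exists p; apply/(weak_cvgP (F := U)).
Qed.

(** An ultrafilter on the image of the unit ball is carried to the ball by a choice s of preimages,
    where the hypothesis applies. *)
Lemma ultra_weakly_compact V W (T : V -> W) : linear T -> ultra_weak T -> weakly_compact T.
Proof.
move=> TL Tu; split=> //; apply: compact_closure_ultra; first exact: weak_regular.
move=> F FU FS.
have : forall w : W, exists v : V, (exists2 v', vnorm v' <= 1 & T v' = w) -> vnorm v <= 1 /\ T v = w.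
  move=> w; have [[v v1 vw]|nw] := pselect (exists2 v', vnorm v' <= 1 & T v' = w).
    by exists v.
  by exists 0 => /nw.
move=> /choice[s sP].
have Fs : F [set w : weak_top W | vnorm (s w) <= 1 /\ T (s w) = w].
  by apply: filterS FS => w [v /= v1 vw]; apply: sP; exists v.
have Us : F [set w : weak_top W | vnorm (s w) <= 1] by apply: filterS Fs => w [].
have [p pP] := Tu _ (ultra_fmap (s : weak_top W -> V) FU) Us.
exists p; apply/(@weak_cvgP W (weak_top W) F _ id) => g.
apply: cvg_trans (pP g).
apply: near_eq_cvg; apply: filterS Fs => w [_ /= ->] //.
Qed.
End WeakTopology.

(** * Stability of weak compactness along ultrafilters *)

Section UltraLimits.
Variables (R : realType).
Local Notation C := (cpx R).

Lemma ultra_bounded_cvg (T : Type) (U : set_system T) (UU : UltraFilter U) (u : T -> C) c :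
  U [set t | rnorm (u t) <= c] -> exists l : C, u @ U --> l.
Proof.
move=> Uc.
have comp (f : C -> R) : (forall z, `|f z| <= rnorm z) -> exists a : R, (fun t => f (u t)) @ U --> a.
  move=> fle; have := @segment_compact R (- c) c; rewrite compact_ultra.
  move=> h; have Us : U [set t | `[- c, c]%classic (f (u t))].
    apply: filterS Uc => t tc /=; rewrite in_itv /= -ler_norml.
    exact: le_trans (fle _) tc.
  have [a [_ ?]] := h _ (ultra_fmap (fun t => f (u t)) UU) Us.
  by exists a.
have [a ua] := comp _ (@ler_norm_Re R); have [b ub] := comp _ (@ler_norm_Im R).
by exists (a +i* b)%C; exact: cvg_ReIm.
Qed.

Lemma cvg_uniqueC (T : Type) (U : set_system T) (UU : ProperFilter U) (u : T -> C) (a b : C) :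
  u @ U --> a -> u @ U --> b -> a = b.
Proof.
move=> ua ub; apply/eqP; rewrite -subr_eq0; apply/eqP/rnorm_eq0/eqP.
rewrite eq_le rnorm_ge0 andbT.
have h : (fun t => u t - u t) @ U --> (a - b : C) by apply: cvgB; [exact: ua|exact: ub].
apply: (@cvg_rnorm_le _ _ U UU C _ _ 0 h).
by near=> t; rewrite /= subrr rnorm0.
Unshelve. all: by end_near. Qed.
End UltraLimits.

Section UltraWeakPredual.
Variables (R : realType) (H : hilbert R) (M : vnAlg H).
Local Notation C := (cpx R).
Local Notation A := (predual_mx M).
Local Notation W := (mxdual A).
Local Notation dnorm := (vnorm (V := W)).
Implicit Types (T : A -> W) (g : mxdual W).

Lemma bidual_bfun g : bounded_functional (V := W) (dual_app g).
Proof. exact: (lsetV (S := dual_linset W)). Qed.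

Lemma bidual_bound g : exists2 c, 0 <= c & forall phi : W, rnorm (dual_app g phi) <= c * dnorm phi.
Proof.
have [_ [c cP]] := bidual_bfun g; exists `|c| => // phi.
by rewrite (le_trans (cP phi)) // ler_wpM2r ?dnorm_ge0 // ler_norm.
Qed.

Lemma bidual_lin g a (phi psi : W) :
  dual_app g (a *: phi + psi) = a * dual_app g phi + dual_app g psi.
Proof. by case: (bidual_bfun g) => h _; exact: h. Qed.

Lemma bidualD g (phi psi : W) : dual_app g (phi + psi) = dual_app g phi + dual_app g psi.
Proof. by have := bidual_lin g 1 phi psi; rewrite scale1r mul1r. Qed.
Lemma bidual0 g : dual_app g (0 : W) = 0.
Proof. by have := bidual_lin g (-1) 0 0; rewrite scaler0 addr0 mulN1r addNr. Qed.
Lemma bidualZ g a (phi : W) : dual_app g (a *: phi) = a * dual_app g phi.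
Proof. by have := bidual_lin g a phi 0; rewrite bidual0 !addr0. Qed.
Lemma bidualB g (phi psi : W) : dual_app g (phi - psi) = dual_app g phi - dual_app g psi.
Proof. by rewrite bidualD -scaleN1r bidualZ mulN1r. Qed.

Lemma dual_linE a (phi psi : W) f :
  dual_app (a *: phi + psi : W) f = a * dual_app phi f + dual_app psi f.
Proof. by []. Qed.

Lemma evalW_bounded (f : A) : bounded_functional (V := W) (fun phi : W => dual_app phi f).
Proof.
split=> [a phi psi|]; first exact: dual_linE.
by exists (pnorm f) => phi; rewrite mulrC; exact: dnormP.
Qed.
Definition evalW (f : A) : mxdual W := mklsub (S := dual_linset W) (evalW_bounded f).

Lemma ultra_weak_ball T r : linear T -> ultra_weak T -> 0 < r ->
  forall U : set_system A, UltraFilter U -> U [set f | pnorm f <= r] ->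
  exists p : W, forall g, (fun f => dual_app g (T f)) @ U --> (dual_app g p : C).
Proof.
move=> TL Tu r0 U UU Ur.
pose s (f : A) : A := ((r^-1)%:C)%C *: f.
have pnormZ t (f : predual M) : pnorm (t *: f) <= rnorm t * pnorm f.
  apply: pnorm_le => [|x]; first by rewrite mulr_ge0 ?rnorm_ge0 ?pnorm_ge0.
  have -> : (t *: f : predual M) x = t * f x.
    by have := predual_linE f 0 t x; rewrite addr0 predual0E addr0.
  by rewrite rnormM -mulrA ler_wpM2l ?rnorm_ge0 // pnormP.
have Us : U [set f | pnorm (s f) <= 1].
  apply: filterS Ur => f fr /=; apply: le_trans (pnormZ _ _) _.
  by rewrite rnorm_real ger0_norm ?invr_ge0 ?(ltW r0) // [leLHS]mulrC ler_pdivrMr // mul1r.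
have [p pP] := Tu _ (ultra_fmap s UU) Us.
exists ((r%:C)%C *: p) => g; rewrite bidualZ.
have -> : (fun f => dual_app g (T f)) = (fun f => (r%:C)%C * dual_app g (T (s f))).
  apply/funext => f; rewrite -bidualZ; congr dual_app.
  have T0 : T 0 = 0 by have := TL (-1) 0 0; rewrite !scaleN1r oppr0 addr0 addNr.
  have := TL ((r^-1)%:C)%C f 0; rewrite !addr0 T0 addr0 /s => ->.
  by rewrite scalerA -rmorphM /= mulfV ?gt_eqF // rmorph1 scale1r.
apply: cvgM; [exact: cvg_cst|exact: pP].
Qed.

Lemma ultra_weakD T1 T2 : ultra_weak T1 -> ultra_weak T2 ->
  ultra_weak (fun f => T1 f + T2 f).
Proof.
move=> u1 u2 U UU Ub; have [p pP] := u1 U UU Ub; have [q qP] := u2 U UU Ub.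
exists (p + q) => g; rewrite bidualD; under eq_fun do rewrite bidualD.
by apply: cvgD; [exact: pP|exact: qP].
Qed.

(** Q carries the unit ball into the ball of radius c, and g after S is again a bounded functional,
    so the limit for T along the image ultrafilter is mapped by S to the required one. *)
Lemma ultra_weak_comp T (Q : A -> A) (S : W -> W) c d : linear T -> linear S -> 0 < c ->
  (forall f, pnorm (Q f) <= c * pnorm f) -> (forall phi, dnorm (S phi) <= d * dnorm phi) ->
  ultra_weak T -> ultra_weak (fun f => S (T (Q f))).
Proof.
move=> TL SL c0 Qc Sd Tu U UU Ub.
have Uc : U [set f | pnorm (Q f) <= c].
  apply: filterS Ub => f f1 /=; apply: le_trans (Qc f) _.
  by apply: ler_piMr; [exact: ltW|exact: f1].
have [p pP] := ultra_weak_ball TL Tu c0 (ultra_fmap Q UU) Uc.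
exists (S p) => g.
have gS : bounded_functional (V := W) (fun phi : W => dual_app g (S phi)).
  split=> [a phi psi|]; first by rewrite SL bidual_lin.
  have [e e0 eP] := bidual_bound g; exists (e * d) => phi.
  by rewrite (le_trans (eP _)) // -mulrA ler_wpM2l.
exact: (pP (mklsub (S := dual_linset W) gS)).
Qed.

(** The limit p is first built pointwise: [T a] evaluated at f is bounded, hence converges along U.
    If T' is close to T, then p is equally close to the weak limit p' of T', and three error terms
    give weak convergence to p. *)
Lemma ultra_weak_limit T c : 0 <= c -> (forall f, dnorm (T f) <= c * pnorm f) ->
  (forall e : R, 0 < e -> exists2 T', ultra_weak T' &
     forall f, dnorm (T f - T' f) <= e * pnorm f) -> ultra_weak T.
Proof.
move=> c0 Tc Tlim U UU Ub.
have lim f : exists l : C, (fun a => dual_app (T a) f) @ U --> l.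
  apply: (@ultra_bounded_cvg _ _ _ UU _ (c * pnorm f)).
  apply: filterS Ub => a a1 /=; rewrite (le_trans (dnormP _ _)) // ler_wpM2r ?pnorm_ge0 //.
  by rewrite (le_trans (Tc a)) // ler_piMr.
have [k kP] := choice lim.
have kb : bounded_functional (V := A) k.
  split=> [a f f'|]; last first.
    exists c => f; apply: (cvg_rnorm_le (kP f)).
    apply: filterS Ub => a a1 /=; rewrite (le_trans (dnormP _ _)) // ler_wpM2r ?pnorm_ge0 //.
    by rewrite (le_trans (Tc a)) // ler_piMr.
  have h : (fun b => dual_app (T b) (a *: f + f')) @ U --> (a * k f + k f' : C).
    under eq_fun do rewrite dual_lin.
    by apply: cvgD; [apply: cvgM; [exact: cvg_cst|exact: kP]|exact: kP].
  exact: (@cvg_uniqueC _ _ U _ _ _ _ (kP (a *: f + f')) h).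
pose p : W := mklsub (S := dual_linset A) kb.
exists p => g.
have [b b0 gb] := bidual_bound g.
apply/cvg_rnormP => e e0.
have b1 : 0 < b + 1 by rewrite ltr_wpDl.
have e3 : 0 < e / 3 by rewrite divr_gt0.
have e1 : 0 < e / 3 / (b + 1) by rewrite divr_gt0.
have small x : x <= e / 3 / (b + 1) -> b * x <= e / 3.
  move=> xe; rewrite (le_trans (ler_wpM2l b0 xe)) // mulrCA ler_piMr ?ltW //.
  by rewrite ltr_pdivrMr // mul1r ltrDl.
have [T' T'u T'e] := Tlim _ e1.
have [p' p'P] := T'u U UU Ub.
have pp' : dnorm (p - p') <= e / 3 / (b + 1).
  apply: dnorm_le => [|f]; first exact: ltW.
  have -> : dual_app (p - p' : W) f = k f - dual_app p' f by [].
  apply: (@cvg_rnorm_le _ _ U _ C (fun a => dual_app (T a) f - dual_app (T' a) f)).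
    (* Evaluation at f is one of the functionals against which p' is a weak limit. *)
    by apply: cvgB; [exact: kP|exact: (p'P (evalW f))].
  apply: filterS Ub => a a1 /=.
  have -> : dual_app (T a) f - dual_app (T' a) f = dual_app (T a - T' a : W) f by [].
  rewrite (le_trans (dnormP _ _)) // ler_wpM2r ?pnorm_ge0 //.
  by rewrite (le_trans (T'e a)) // ler_piMr // ltW.
have /cvg_rnormP /(_ _ e3) near' := p'P g.
apply: filterS (filterI near' Ub) => a [h a1] /=.
have -> : dual_app g p - dual_app g (T a) = dual_app g (p - p') +
   (dual_app g p' - dual_app g (T' a)) - dual_app g (T a - T' a).
  by rewrite !bidualB; ring.
have h1 : rnorm (dual_app g (p - p')) <= e / 3 by rewrite (le_trans (gb _)) // small.
have h2 : rnorm (dual_app g (T a - T' a)) <= e / 3.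
  rewrite (le_trans (gb _)) // small // (le_trans (T'e a)) // ler_piMr //.
  exact: ltW.
rewrite (le_lt_trans (rnormD _ _)) // rnormN.
have h3 := rnormD (dual_app g (p - p')) (dual_app g p' - dual_app g (T' a)).
by move: h h1 h2 h3; lra.
Qed.
End UltraWeakPredual.

(** * Elements with weakly compact slice map *)

Section WeakSlices.
Variables (R : realType) (H : hilbert R) (HH : hilbert_tensor H H) (M : vnAlg H).
Local Notation N := (vn_tensor HH M M).
Local Notation vM := (vnorm (V := vn_mx M)).
Local Notation vN := (vnorm (V := vn_mx N)).
Local Notation A := (predual_mx M).
Local Notation W := (mxdual A).
Local Notation dnorm := (vnorm (V := W)).

Definition slice (D : N) (a : A) : W := of_vn (sl a D).

Lemma sliceE D a (b : A) : dual_app (slice D a) b = (b : predual M) (sl a D).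
Proof. by []. Qed.

Lemma of_vn_lin t (x y : M) : of_vn (t *: x + y) = t *: of_vn x + of_vn y.
Proof. by apply: dual_ext => f; rewrite dual_linE !of_vnE predual_lin. Qed.

Lemma slice_linear D : linear (slice D).
Proof. by move=> t a b; rewrite /slice sl_linl of_vn_lin. Qed.

Lemma of_vn_le x : dnorm (of_vn x) <= vM x.
Proof.
apply: dnorm_le => [|f]; first exact: vM_ge0.
by rewrite of_vnE mulrC pnormP.
Qed.

Lemma slice_le D a : dnorm (slice D a) <= vN D * pnorm a.
Proof. by rewrite (le_trans (of_vn_le _)) // mulrC sl_le. Qed.

Lemma slice_linr t D E a : slice (t *: D + E) a = t *: slice D a + slice E a.
Proof. by rewrite /slice sl_linr of_vn_lin. Qed.

Definition weak_slices (D : N) := ultra_weak (slice D).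

Lemma weak_slicesD D E : weak_slices D -> weak_slices E -> weak_slices (D + E).
Proof.
move=> wD wE; have := ultra_weakD wD wE; congr ultra_weak; apply/funext => a.
by have := slice_linr 1 D E a; rewrite !scale1r.
Qed.

Lemma weak_slices_limit D : (forall e : R, 0 < e ->
  exists2 E, weak_slices E & vN (D - E) <= e) -> weak_slices D.
Proof.
move=> lim; apply: (ultra_weak_limit (c := vN D)); first exact: vM_ge0.
  exact: slice_le.
move=> e /lim [E wE DE]; exists (slice E) => // a.
have -> : slice D a - slice E a = slice (D - E) a.
  have := slice_linr (-1) E D a; rewrite !scaleN1r.
  by rewrite (addrC (- E)) (addrC (- slice E a)).
by rewrite (le_trans (slice_le _ _)) // ler_wpM2r ?pnorm_ge0.
Qed.

Lemma dual_pre_bounded (Q : predual M -> predual M) c (phi : W) : 0 <= c -> linear Q ->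
  (forall f, pnorm (Q f) <= c * pnorm f) ->
  bounded_functional (V := A) (fun f : predual M => dual_app phi (Q f)).
Proof.
move=> c0 QL Qc; split=> [a f g|].
  by rewrite [Q _]QL dual_lin.
exists (dnorm phi * c) => f; rewrite (le_trans (dnormP _ _)) // -mulrA.
by rewrite ler_wpM2l ?dnorm_ge0 // Qc.
Qed.

Lemma trr_linear (p : M) : linear (trr p).
Proof. by move=> a f g; apply: predual_ext => x; rewrite trrE !predual_linE !trrE. Qed.
Lemma trl_linear (p : M) : linear (trl p).
Proof. by move=> a f g; apply: predual_ext => x; rewrite trlE !predual_linE !trlE. Qed.

(** Transposes of the module actions on the predual: on M they are right multiplication by p and,
    for [dual_trl], left multiplication. *)
Definition dual_trr (p : M) (phi : W) : W := mklsub (S := dual_linset A)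
  (dual_pre_bounded phi (vM_ge0 p) (trr_linear p) (pnorm_trr p)).
Definition dual_trl (p : M) (phi : W) : W := mklsub (S := dual_linset A)
  (dual_pre_bounded phi (vM_ge0 p) (trl_linear p) (pnorm_trl p)).

Lemma dual_trrE p phi f : dual_app (dual_trr p phi) f = dual_app phi (trr p f).
Proof. by []. Qed.
Lemma dual_trlE p phi f : dual_app (dual_trl p phi) f = dual_app phi (trl p f).
Proof. by []. Qed.

Lemma dual_trr_linear p : linear (dual_trr p).
Proof.
by move=> a phi psi; apply: dual_ext => f; rewrite dual_trrE !dual_linE !dual_trrE.
Qed.
Lemma dual_trl_linear p : linear (dual_trl p).
Proof.
by move=> a phi psi; apply: dual_ext => f; rewrite dual_trlE !dual_linE !dual_trlE.
Qed.

Lemma dual_trr_le p phi : dnorm (dual_trr p phi) <= vM p * dnorm phi.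
Proof.
apply: dnorm_le => [|f]; first by rewrite mulr_ge0 ?vM_ge0 ?dnorm_ge0.
rewrite dual_trrE (le_trans (dnormP _ _)) // (mulrC (vM p)) -mulrA.
by rewrite ler_wpM2l ?dnorm_ge0 // pnorm_trr.
Qed.
Lemma dual_trl_le p phi : dnorm (dual_trl p phi) <= vM p * dnorm phi.
Proof.
apply: dnorm_le => [|f]; first by rewrite mulr_ge0 ?vM_ge0 ?dnorm_ge0.
rewrite dual_trlE (le_trans (dnormP _ _)) // (mulrC (vM p)) -mulrA.
by rewrite ler_wpM2l ?dnorm_ge0 // pnorm_trl.
Qed.

Lemma weak_slices_mulr (D T : N) (p q : M) : op_tens T p q ->
  weak_slices D -> weak_slices (vn_mul D T).
Proof.
move=> Tpq wD.
(* The constant in [ultra_weak_comp] must be positive, and q may be 0. *)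
have q0 : 0 < vM q + 1 by rewrite ltr_wpDl ?vM_ge0.
have Qc (f : A) : pnorm (trr q f) <= (vM q + 1) * pnorm f.
  by rewrite (le_trans (pnorm_trr _ _)) // ler_wpM2r ?pnorm_ge0 // lerDl.
have := ultra_weak_comp (slice_linear D) (dual_trr_linear p) q0 Qc (dual_trr_le p) wD.
congr ultra_weak; apply/funext => f; apply: dual_ext => b.
by rewrite dual_trrE !sliceE trrE (sl_mulr _ _ Tpq).
Qed.

Lemma weak_slices_mull (D T : N) (p q : M) : op_tens T p q ->
  weak_slices D -> weak_slices (vn_mul T D).
Proof.
move=> Tpq wD.
have q0 : 0 < vM q + 1 by rewrite ltr_wpDl ?vM_ge0.
have Qc (f : A) : pnorm (trl q f) <= (vM q + 1) * pnorm f.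
  by rewrite (le_trans (pnorm_trl _ _)) // ler_wpM2r ?pnorm_ge0 // lerDl.
have := ultra_weak_comp (slice_linear D) (dual_trl_linear p) q0 Qc (dual_trl_le p) wD.
congr ultra_weak; apply/funext => f; apply: dual_ext => b.
by rewrite dual_trlE !sliceE trlE (sl_mull _ _ Tpq).
Qed.

Lemma vn_mulDr (D E F : N) : vn_mul D (E + F) = vn_mul D E + vn_mul D F.
Proof. by apply: vn_ext => a b; rewrite vn_mulE vnDE bopD [in RHS]vnDE !vn_mulE. Qed.
Lemma vn_mulDl (D E F : N) : vn_mul (E + F) D = vn_mul E D + vn_mul F D.
Proof. by apply: vn_ext => a b; rewrite vn_mulE vnDE [in RHS]vnDE !vn_mulE. Qed.

(* The elements of the spatial (minimal) tensor product of M with itself. *)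
Definition spatial (E : N) := forall e : R, 0 < e ->
  exists n (T : 'I_n -> N) (p q : 'I_n -> M),
    (forall i, op_tens (T i) (p i) (q i)) /\ vN (E - \sum_i T i) <= e.

Lemma weak_slices0 : weak_slices 0.
Proof.
move=> U UU _; exists 0 => g.
have -> : (fun v => dual_app g (slice 0 v)) = (fun=> dual_app g (0 : W)).
  apply/funext => v; congr (dual_app g _); apply: dual_ext => f; rewrite sliceE.
  have -> : sl v (0 : N) = 0.
    have h2 := sl_linr (-1) v (0 : N) 0; rewrite scaleN1r oppr0 addr0 in h2.
    by rewrite h2 scaleN1r addNr.
  by rewrite -(scale0r (0 : M)) predualZ mul0r.
exact: cvg_cst.
Qed.

Lemma weak_slices_spatial (D E : N) : weak_slices D -> spatial E ->
  weak_slices (vn_mul D E) /\ weak_slices (vn_mul E D).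
Proof.
move=> wD sE.
have D0 : 0 < vN D + 1 by rewrite ltr_wpDl //; exact: vM_ge0.
have small (F : N) (e : R) : 0 < e -> vN F <= e / (vN D + 1) ->
    vN (vn_mul D F) <= e /\ vN (vn_mul F D) <= e.
  move=> e0 Fe; have DF : vN D * vN F <= e.
    have h : vN D * vN F <= (vN D + 1) * (e / (vN D + 1)).
      by apply: ler_pM => //; [exact: vM_ge0|exact: vM_ge0|rewrite lerDl].
    by apply: le_trans h _; rewrite mulrCA mulfV ?mulr1 // gt_eqF.
  split; first exact: le_trans (vM_mul _ _) DF.
  by apply: le_trans (vM_mul _ _) _; rewrite mulrC.
split; apply: weak_slices_limit => e e0.
  have [|n [T [p [q [Tpq ET]]]]] := sE (e / (vN D + 1)); first exact: divr_gt0.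
  exists (vn_mul D (\sum_i T i)).
    elim/big_ind: _ => [|E1 E2 w1 w2|i _].
    - have -> : vn_mul D (0 : N) = 0 by apply: vn_ext => a b; rewrite vn_mulE !vn0E bop0.
      exact: weak_slices0.
    - by rewrite vn_mulDr; exact: weak_slicesD.
    - exact: weak_slices_mulr (Tpq i) wD.
  have -> : vn_mul D E - vn_mul D (\sum_i T i) = vn_mul D (E - \sum_i T i).
    by apply/eqP; rewrite subr_eq -vn_mulDr subrK.
  by have [] := small _ _ e0 ET.
have [|n [T [p [q [Tpq ET]]]]] := sE (e / (vN D + 1)); first exact: divr_gt0.
exists (vn_mul (\sum_i T i) D).
  elim/big_ind: _ => [|E1 E2 w1 w2|i _].
  - have -> : vn_mul (0 : N) D = 0 by apply: vn_ext => a b; rewrite vn_mulE !vn0E.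
    exact: weak_slices0.
  - by rewrite vn_mulDl; exact: weak_slicesD.
  - exact: weak_slices_mull (Tpq i) wD.
have -> : vn_mul E D - vn_mul (\sum_i T i) D = vn_mul (E - \sum_i T i) D.
  by apply/eqP; rewrite subr_eq -vn_mulDl subrK.
by have [] := small _ _ e0 ET.
Qed.
End WeakSlices.

(** * Completely compact slice maps *)

(** Induction on k. A last functional that vanishes on the common kernel of the others gets
    coefficient 0; otherwise some a has value 1 under it and 0 under the others, and G minus the
    last functional times G a reduces to k functionals. *)
Lemma factor_functionals (K : fieldType) (V U : lmodType K) k (y : 'I_k -> V -> K) (G : V -> U) :
  (forall i, scalar (y i)) -> linear G -> (forall v, (forall i, y i v = 0) -> G v = 0) ->
  exists p : 'I_k -> U, forall v, G v = \sum_i y i v *: p i.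
Proof.
elim: k y G => [|k IH] y G yL GL G0.
  by exists (fun=> 0) => v; rewrite big_ord0; apply: G0; case.
pose y' i := y (lift ord_max i).
have [y0|] := pselect (forall v, (forall i, y' i v = 0) -> y ord_max v = 0).
  have [|||p pP] := IH y' G.
  - by move=> i; exact: yL.
  - exact: GL.
  - move=> v v0; apply: G0 => i; case: (unliftP ord_max i) => [j|] ->; first exact: v0.
    exact: y0.
  exists (fun i => if unlift ord_max i is Some j then p j else 0) => v.
  rewrite big_ord_recr /= unlift_none scaler0 addr0 pP; apply: eq_bigr => i _.
  have -> : widen_ord (leqnSn k) i = lift ord_max i by apply: val_inj; rewrite [RHS]lift_max.
  by rewrite liftK.
move=> /existsNP [v0 /not_implyP [v00 /eqP yv0]].
pose a := (y ord_max v0)^-1 *: v0.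
have GD u v : G (u + v) = G u + G v by have := GL 1 u v; rewrite !scale1r.
have GZ t v : G (t *: v) = t *: G v.
  have g0 : G 0 = 0 by apply: (addrI (G 0)); rewrite -GD !addr0.
  by have := GL t v 0; rewrite g0 !addr0.
have yZ i t v : y i (t *: v) = t * y i v.
  have g0 : y i 0 = 0 by have := yL i (-1) 0 0; rewrite scaler0 addr0 mulN1r addNr.
  by have := yL i t v 0; rewrite g0 !addr0.
have yD i u v : y i (u + v) = y i u + y i v by have := yL i 1 u v; rewrite scale1r mul1r.
have ya : y ord_max a = 1 by rewrite yZ mulVf.
have y'a i : y' i a = 0 by have h := v00 i; rewrite /y' in h *; rewrite yZ h mulr0.
pose G' v := G v - y ord_max v *: G a.
have [|||p pP] := IH y' G'.
- by move=> i; exact: yL.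
- move=> t u v; rewrite /G' GD GZ yD yZ scalerDl -scalerA scalerBr.
  by rewrite opprD addrACA.
- move=> v v'0; rewrite /G'.
  have -> : G v - y ord_max v *: G a = G (v - y ord_max v *: a).
    by rewrite GD -!scaleNr (GZ (- y ord_max v) a).
  apply: G0 => i; rewrite -scaleNr yD yZ; case: (unliftP ord_max i) => [j|] ->.
    have h := v'0 j; have h' := y'a j; rewrite /y' in h h'.
    by rewrite h h' mulr0 addr0.
  by rewrite ya mulr1 subrr.
exists (fun i => if unlift ord_max i is Some j then p j else G a) => v.
rewrite big_ord_recr /= unlift_none -[LHS](subrK (y ord_max v *: G a)) -/(G' v) pP.
congr (_ + _); apply: eq_bigr => i _.
have -> : widen_ord (leqnSn k) i = lift ord_max i by apply: val_inj; rewrite [RHS]lift_max.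
by rewrite liftK.
Qed.

Section Spatial.
Variables (R : realType) (H : hilbert R) (HH : hilbert_tensor H H) (M : vnAlg H).
Local Notation C := (cpx R).
Local Notation N := (vn_tensor HH M M).
Local Notation vN := (vnorm (V := vn_mx N)).
Local Notation A := (predual_mx M).
Local Notation W := (mxdual A).
Local Notation "x '⊗' y" := (tens HH x y) (at level 40).

Lemma cbnorm_lt (V U : mxSpace R) (T : V -> U) (e : R) : (cbnorm T < e%:E)%E ->
  forall n (X : 'M[V]_n), mxnorm X <= 1 -> mxnorm (map_mx T X) < e.
Proof.
move=> Te n X X1; rewrite -lte_fin; apply: le_lt_trans Te.
by apply: ereal_sup_ubound; exists n, X.
Qed.

Lemma cbnorm_le (V U : mxSpace R) (T : V -> U) (c : R) : (cbnorm T <= c%:E)%E ->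
  forall n (X : 'M[V]_n), mxnorm X <= 1 -> mxnorm (map_mx T X) <= c.
Proof.
move=> Te n X X1; rewrite -lee_fin; apply: le_trans Te.
by apply: ereal_sup_ubound; exists n, X.
Qed.

Lemma le_cbnorm (V U : mxSpace R) (T : V -> U) (c : R) :
  (forall n (X : 'M[V]_n), mxnorm X <= 1 -> mxnorm (map_mx T X) <= c) -> (cbnorm T <= c%:E)%E.
Proof. by move=> h; apply: ge_ereal_sup => _ [n [X [X1 ->]]]; rewrite lee_fin h. Qed.

(* Gram-Schmidt on the right legs writes a vector of the algebraic tensor product as
   \sum_l xi_l ⊗ e_l with e orthonormal, so that its norm is the l2-norm of xi. *)
Lemma vN_slice_le (D : N) c : 0 <= c ->
  (forall n (e : 'I_n -> H), orthosys e ->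
     vn_mxnorm (\matrix_(k, l) sl (omega M (e l) (e k)) D) <= c) -> vN D <= c.
Proof.
move=> c0 Dc; apply: vnorm_vn_le => //.
apply: (dense_form_le c0 (@tens_dense _ _ _ HH) (@tens_dense _ _ _ HH)).
move=> z w [n [x [y zE]]] [m [x' [y' wE]]].
(* The right legs of z and w share one orthonormal system, so that D is tested by a single square
   matrix. *)
pose Y (i : 'I_(n + m)) := match fintype.split i with inl j => y j | inr j => y' j end.
have [e eo ex] := gram_schmidt Y.
have ey i : expands e (y i) by have := ex (lshift m i); rewrite /Y (unsplitK (inl _ i)).
have ey' i : expands e (y' i) by have := ex (rshift n i); rewrite /Y (unsplitK (inr _ i)).
pose cf k (u : 'I_k -> H) (v : 'I_k -> H) l := \sum_i ip (v i) (e l) *: u i.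
have zE' : z = \sum_l cf _ x y l ⊗ e l by rewrite zE (tens_expandr _ _ ey).
have wE' : w = \sum_l cf _ x' y' l ⊗ e l by rewrite wE (tens_expandr _ _ ey').
(* Where e l is zero, the coefficients against it vanish as well, so zero vectors of the system cost
   nothing. *)
have nrm k (u v : 'I_k -> H) : l2norm (cf k u v) <= rnorm (\sum_l cf k u v l ⊗ e l).
  apply: l2norm_le; first exact: rnorm_ge0.
  rewrite rnorm_tens_sumr // le_eqVlt; apply/orP; left; apply/eqP; apply: eq_bigr => l _.
  have [_ /(_ l) [->|el0]] := eo; first by rewrite mulr1.
  by rewrite /cf big1 ?rnorm0 ?mul0r // => i _; rewrite el0 ipx0 scale0r.
have -> : ip (D z) w = vform (\matrix_(k, l) sl (omega M (e l) (e k)) D) (cf _ x y) (cf _ x' y').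
  rewrite zE' wE' bop_sum ip_suml /vform exchange_big; apply: eq_bigr => l _ /=.
  rewrite ip_sumr; apply: eq_bigr => k _; rewrite mxE slP omegaE slrP //.
rewrite (le_trans (vform_le _ _ _)) //.
apply: ler_pM; rewrite ?mulr_ge0 ?vn_mxnorm_ge0 ?l2norm_ge0 //; last by rewrite wE' nrm.
apply: ler_pM; rewrite ?vn_mxnorm_ge0 ?l2norm_ge0 //; last by rewrite zE' nrm.
exact: Dc.
Qed.

Section CompletelyCompactSlices.
Variables (D : N) (T : A -> W).
Hypothesis TD : forall a b : predual M, dual_app (T a) b = a (sl b D).

(* Vectors of the preannihilator of Y do not see Y, so the norm of the slice map there is
   controlled by the distance of T to Y. *)
Lemma slice_preann_le (Y : set W) e : 0 < e -> Y 0 ->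
  (@cbnorm R A (mxquot Y) T < e%:E)%E ->
  forall n (X : 'M[A]_n), (forall i j (psi : W), Y psi -> dual_app psi (X i j) = 0) ->
  mxnorm X <= 1 -> vn_mxnorm (map_mx (fun a : A => sl a D) X) <= e.
Proof.
move=> e0 Y0 Te n X XY X1.
apply: vn_mxnorm_form_le => [|xi eta]; first exact: ltW.
(* Orthonormalizing the test vectors puts [Om] in the unit ball of the matrices over the predual, so
   T [Om] lies within e of a matrix Z over Y. *)
have [u uo ux] := gram_schmidt xi; have [v vo vx] := gram_schmidt eta.
pose Om : 'M[A]_n := \matrix_(k, l) omega M (u l) (v k).
pose S : set R := [set mxnorm (map_mx T Om - Z : 'M[W]_n) |
  Z in [set Z : 'M[W]_n | forall i j, Y (Z i j)]].
have Se : inf S < e := cbnorm_lt Te (omega_mx_le M uo vo : mxnorm Om <= 1).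
have hS : has_inf S.
  split; first by exists (mxnorm (map_mx T Om - 0)), 0 => // i j; rewrite mxE.
  by exists 0 => _ [Z _ <-]; exact: dual_mxnorm_ge0.
have d0 : 0 < e - inf S by rewrite subr_gt0.
have [_ [Z ZY <-]] := inf_adherent d0 hS; rewrite [ltRHS]addrC subrK => Ze.
pose et (p : 'I_n * 'I_n) : C := (ip (eta p.2) (v p.1))^*.
pose xe (p : 'I_n * 'I_n) : C := ip (xi p.2) (u p.1).
pose F k l := dual_app ((map_mx T Om - Z) k l : W).
(* The transposition: T at a vector functional, evaluated at X i j, is a matrix coefficient of the
   slice by X i j, and Z k l vanishes there. *)
have FE k l i j : F k l (X i j) = ip (sl (X i j) D (u l)) (v k).
  rewrite /F !mxE; have -> : dual_app (T (omega M (u l) (v k)) - Z k l : W) (X i j) =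
    dual_app (T (omega M (u l) (v k))) (X i j) - dual_app (Z k l) (X i j) by [].
  by rewrite (XY i j _ (ZY k l)) subr0 TD omegaE.
have -> : vform (map_mx (fun a : A => sl a D) X) xi eta = mform (ev F X) et xe.
  rewrite mform_pair; apply: eq_bigr => i _; apply: eq_bigr => j _.
  rewrite mxE {1}(ux j) bop_sum ip_suml /mform exchange_big; apply: eq_bigr => l _ /=.
  rewrite bopZ ipZl {1}(vx i) ip_sumr mulr_sumr; apply: eq_bigr => k _.
  by rewrite ipZr /ev /= FE /et /xe /=; ring.
rewrite (le_trans (mform_le _ _ _)) //.
have Fb : bfam F by move=> k l; exact: dual_bfun.
have m1 : mnorm (ev F X) <= e.
  by rewrite (le_trans (dual_ub (predual_regular M) Fb X1)) // ltW.
have etn : l2norm et <= l2norm eta.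
  apply: l2norm_le; first exact: l2norm_ge0.
  rewrite sqr_l2norm sum_pair exchange_big; apply: ler_sum => i _ /=.
  by rewrite (expands_parseval (vx i)); apply: ler_sum => k _; rewrite rnorm_conj.
have xen : l2norm xe <= l2norm xi.
  apply: l2norm_le; first exact: l2norm_ge0.
  rewrite sqr_l2norm sum_pair exchange_big; apply: ler_sum => i _ /=.
  by rewrite (expands_parseval (ux i)).
rewrite mulrAC; apply: ler_pM; rewrite ?mulr_ge0 ?mnorm_ge0 ?l2norm_ge0 //.
by apply: ler_pM; rewrite ?mnorm_ge0 ?l2norm_ge0.
Qed.

Hypothesis Tcc : completely_compact T.
Hypothesis Minj : injective_opspace (vn_mx M).

Lemma spatial_completely_compact : spatial D.
Proof.
move=> e e0; have [_ /(_ e e0) [Y [k [w YE]] Te]] := Tcc.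
have Y0 : Y 0.
  by rewrite YE; exists (fun=> 0) => //; rewrite big1 // => i _; rewrite scale0r.
pose Lset : set A := [set a | forall i, dual_app (w i) a = 0].
have L0 : Lset 0.
  by move=> i; have := dual_lin (w i) (-1) 0 0; rewrite scaler0 addr0 mulN1r addNr.
have LP (a : C) (u v : A) : Lset u -> Lset v -> Lset (a *: u + v).
  by move=> u0 v0 i; rewrite dual_lin u0 v0 mulr0 addr0.
pose L := Linset L0 LP.
have LY (a : lsub L) (psi : W) : Y psi -> dual_app psi (lval a) = 0.
  rewrite YE => -[c _ <-].
  have aL : Lset (lval a) := lsetV a.
  have -> : dual_app (\sum_i c i *: w i : W) (lval a) = \sum_i c i * dual_app (w i) (lval a).
    have mD (phi chi : W) : dual_app (phi + chi) (lval a) =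
        dual_app phi (lval a) + dual_app chi (lval a).
      by have := dual_linE 1 phi chi (lval a); rewrite scale1r mul1r.
    rewrite (big_morph (fun phi : W => dual_app phi (lval a)) (id1 := 0) mD) //.
  by rewrite big1 // => i _; rewrite aL mulr0.
(* [injective_opspace] extends complete contractions, so the slice map on L is divided by e and its
   extension S multiplied by e again. *)
pose t : C := ((e^-1)%:C)%C.
pose S0 (a : sub_mx L) : vn_mx M := t *: sl (lval a) D.
have S0L : linear S0.
  by move=> a u v; rewrite /S0 lval_lin sl_linl scalerDr !scalerA mulrC.
have S0c : complete_contraction S0.
  split=> //; apply: le_cbnorm => n X X1.
  have -> : map_mx S0 X = map_mx ( *:%R t)
     (map_mx (fun a : A => sl a D) (map_mx (@lval _ _ L) X) : 'M[vn_mx M]_n).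
    by apply/matrixP => i j; rewrite !mxE.
  have [_ VZ _] := vn_regular M.
  apply: (le_trans (VZ _ _ _)); rewrite rnorm_real ger0_norm ?invr_ge0 ?(ltW e0) //.
  rewrite mulrC ler_pdivrMr // mul1r; apply: (slice_preann_le e0 Y0 Te) => // i j psi psiY.
  by rewrite mxE; exact: LY.
have [S [SL Sc] SE] := Minj (sub_opspace L (predual_opspace M)) (predual_opspace M)
  (sub_isometry L) S0c.
pose G (a : A) : M := sl a D - ((e%:C)%C : C) *: (S a : M).
have GL : linear G.
  move=> a u v; rewrite /G sl_linl SL scalerDr !scalerA (mulrC _ a) -scalerA.
  by rewrite opprD addrACA -scalerBr.
(* On L the map e S agrees with the slice map, so G vanishes on the common kernel of the w i and has
   finite rank. *)
have [p pP] : exists p : 'I_k -> M, forall a, G a = \sum_i dual_app (w i) a *: p i.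
  apply: (factor_functionals (y := fun i a => dual_app (w i) a)) => //.
    by move=> i; case: (dual_bfun (w i)).
  move=> a aL; have := SE (@mklsub _ _ L a aL); rewrite /S0 /G => ->.
  by rewrite scalerA -rmorphM /= mulfV ?gt_eqF // rmorph1 scale1r subrr.
(* The generators of Y are elements of M, which become the right legs of the approximating
   tensors. *)
have [x xP] := choice (fun i => dual_repr (w i)).
have Tex i : exists E : N, op_tens E (p i) (x i).
  have [E Epx] := op_tens_ex HH (p i) (x i).
  have EN : vn_set N E by apply: elem_tensor_vn; exists (p i), (x i).
  by exists (mklsub (S := vn_linset N) EN).
have [E EP] := choice Tex.
exists k, E, p, x; split=> //; apply: vN_slice_le => [|n u uo]; first exact: ltW.
have slE a : sl a (D - \sum_i E i) = ((e%:C)%C : C) *: (S a : M).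
  have slB (F F' : N) : sl a (F - F') = sl a F - sl a F'.
    by have := sl_linr (-1) a F' F; rewrite !scaleN1r addrC => ->; rewrite addrC.
  have slD (F F' : N) : sl a (F + F') = sl a F + sl a F'.
    by have := sl_linr 1 a F F'; rewrite !scale1r.
  have sl0 : sl a (0 : N) = 0 by apply: (addrI (sl a (0 : N))); rewrite -slD !addr0.
  have -> : sl a (D - \sum_i E i) = sl a D - \sum_i dual_app (w i) a *: p i.
    rewrite slB; congr (_ - _); rewrite (big_morph _ slD sl0); apply: eq_bigr => i _.
    by rewrite (sl_elem _ (EP i)) xP.
  by rewrite -pP /G opprB addrC subrK.
have -> : \matrix_(i, l) sl (omega M (u l) (u i)) (D - \sum_i E i) = map_mx ( *:%R (e%:C)%C)
    (map_mx S (\matrix_(i, l) omega M (u l) (u i) : 'M[A]_n) : 'M[vn_mx M]_n).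
  by apply/matrixP => i l; rewrite !mxE slE.
have [_ VZ _] := vn_regular M.
apply: (le_trans (VZ _ _ _)); rewrite rnorm_real ger0_norm ?(ltW e0) //.
by rewrite ler_piMr ?(ltW e0) // (cbnorm_le Sc) // omega_mx_le.
Qed.
End CompletelyCompactSlices.
End Spatial.

(** [convolution_sl] identifies the left action of x with the slice map of Gamma x. *)
Lemma WAP_vnP (R : realType) (H : hilbert R) (HH : hilbert_tensor H H) (M : vnAlg H)
    (Gamma : M -> vn_tensor HH M M) (x : M) : normal_star_hom Gamma ->
  WAP_vn Gamma x <-> weak_slices (Gamma x).
Proof.
move=> GN; split=> [[phi [T TL Tw] phix]|wx].
  have -> : weak_slices (Gamma x) = ultra_weak T.
    congr ultra_weak; apply/funext => a; apply: dual_ext => b.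
    by rewrite TL phix sliceE -(convolution_sl b a GN).
  exact: weakly_compact_ultra.
exists (of_vn x) => //; exists (slice (Gamma x)) => [a b|].
  by rewrite of_vnE sliceE (convolution_sl b a GN).
exact: ultra_weakly_compact (slice_linear _) wx.
Qed.

Theorem corollary3p3 (R : realType) (H : hilbert R) (HH : hilbert_tensor H H)
    (HHl : hilbert_tensor HH H) (HHr : hilbert_tensor H HH) (M : vnAlg H)
    (Gamma : M -> vn_tensor HH M M) :
  hopf_von_neumann HHl HHr Gamma ->
  injective_opspace (vn_mx M) ->
  forall x y : M, WAP_vn Gamma x -> CAP_vn Gamma y ->
    WAP_vn Gamma (vn_mul x y) /\ WAP_vn Gamma (vn_mul y x).
Proof.
move=> [GN _ _] Minj x y /(WAP_vnP x GN) wx [phi [_ [T TR Tcc]] phiy].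
(* The right action T a is the slice of Gamma y by a in the first leg, the transpose of the slice
   maps used for weak compactness. *)
have TD (a b : predual M) : dual_app (T a) b = a (sl b (Gamma y)).
  by rewrite TR phiy (convolution_sl a b GN).
have sy := spatial_completely_compact TD Tcc Minj.
have [_ _ GM _ _] := GN.
by split; apply/(WAP_vnP _ GN); rewrite GM; have [] := weak_slices_spatial wx sy.
Qed.
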